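(* Let $\phi:\mathbb D\to\mathbb D$ be an inner function of positive hyperbolic step. Then there exist a non-constant Blaschke product $B$ and a unimodular constant $\tau$ such that $B\circ\phi=\tau B$.
   Context: $\mathbb D$ is the open unit disk. For $n\in\mathbb N_0$, $\phi^{[n]}$ denotes the $n$-th iterate of $\phi$. The pseudo-hyperbolic distance is $\rho(z_1,z_2)=\left|\frac{z_2-z_1}{1-\overline{z_2}z_1}\right|$. A holomorphic self-map $\phi$ of $\mathbb D$ is of positive hyperbolic step if $\lim_{n\to\infty}\rho(\phi^{[n]}(z_0),\phi^{[n+1]}(z_0))>0$ for some $z_0\in\mathbb D$. *)

(* Defs.v *)
From mathcomp Require Import all_boot all_order all_algebra.
From mathcomp Require Import all_classical all_reals all_analysis.
From mathcomp Require Import complex.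
Import Order.TTheory GRing.Theory Num.Theory numFieldNormedType.Exports.
Set Implicit Arguments. Unset Strict Implicit. Unset Printing Implicit Defensive.
Local Open Scope ring_scope.
Local Open Scope classical_set_scope.

(* Complex numbers are R[i] (mathcomp-real-closed) over R : realType,
   with the norm topology coming from its numFieldType structure.
   `|z| : R[i] is the modulus (a real nonnegative element of R[i]). *)

Section Defs.
Variable R : realType.
Local Notation C := R[i].

Definition in_disk (z : C) : Prop := `|z| < 1.

Definition holo_on_disk (f : C -> C) : Prop :=
  forall z, in_disk z -> derivable (f : C^o -> C^o) z 1.

Definition holo_selfmap (f : C -> C) : Prop :=
  holo_on_disk f /\ forall z, in_disk z -> in_disk (f z).

Definition expi (t : R) : C := (cos t +i* sin t)%C.

Definition unimodular_radial_limit (f : C -> C) (t : R) : Prop :=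
  exists L : C, `|L| = 1 /\
    (fun r : R => (f ((r%:C)%C * expi t) : C^o)) @ (1 : R)^'- --> (L : C^o).

(* inner function: holomorphic self-map of D whose radial limits exist and
   are unimodular at almost every point of the unit circle (a.e. w.r.t.
   Lebesgue measure in the angle t; the condition is 2pi-periodic in t) *)
Definition inner (f : C -> C) : Prop :=
  holo_selfmap f /\
  {ae (@lebesgue_measure R), forall t : R, unimodular_radial_limit f t}.

Definition rho (z1 z2 : C) : C := `|(z2 - z1) / (1 - Num.conj z2 * z1)|.

Definition positive_hyperbolic_step (f : C -> C) : Prop :=
  exists z0 : C, in_disk z0 /\
    exists l : C, 0 < l /\
      (fun n : nat => (rho (iter n f z0) (iter n.+1 f z0) : C^o)) @ \oo --> (l : C^o).

(* Blaschke factor; None stands for the trivial factor 1 (used to encode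
   finite Blaschke products as sequences) *)
Definition blaschke_factor (a : option C) (z : C) : C :=
  match a with
  | None => 1
  | Some a => if a == 0 then z
              else (`|a| / a) * ((a - z) / (1 - Num.conj a * z))
  end.

Definition blaschke_product (B : C -> C) : Prop :=
  exists (c : C) (a : nat -> option C),
    `|c| = 1 /\
    (forall n x, a n = Some x -> in_disk x) /\
    cvgn (series (fun n => (if a n is Some x then complex.Re (1 - `|x|) else 0 : R))) /\
    forall z, in_disk z ->
      (fun n => (c * \prod_(i < n) blaschke_factor (a i) z : C^o)) @ \oo --> (B z : C^o).

End Defs.

(* Main.v *)
(** The radial limits of [phi] enter only through the fact that the means of [1 - |phi|^2]
    over circles tend to [0] as the radius tends to [1] ("weakly inner"), a property stable
    under composition.  If [phi] has a fixed point in the disk, a positive hyperbolic step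
    forces [phi] to be a rotation about it, and one Blaschke factor is enough.  Otherwise,
    renormalising the iterates of [phi] by Moebius maps along the orbit of [z0] gives in the
    limit a weakly inner [G] with [G \o phi = M \o G], where [M] is an automorphism of the
    disk without fixed point in the disk, so that [1 - |M^k (G 0)|^2 = O(1/k^2)], [k] in Z.
    Hence for every [a] in the disk the product over [k] in Z of suitable unimodular multiples
    of [(M^k G - a) / (1 - a^* M^k G)] converges, and composing with [phi] shifts [k], which
    gives [B \o phi = tau B].  As in Frostman's theorem, integrating [-ln |B|] over real [a]
    yields some [a] for which the circular means of [-ln |B|] tend to [0] along a sequence of
    radii, and such a bounded function is a Blaschke product. *)
Require Import Defs.
From mathcomp Require Import all_boot all_order all_algebra.
From mathcomp Require Import all_classical all_reals all_analysis.
From mathcomp Require Import measurable_realfun complex.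
From mathcomp Require Import ring lra zify.
Import Order.TTheory GRing.Theory Num.Theory numFieldNormedType.Exports.
Set Implicit Arguments. Unset Strict Implicit. Unset Printing Implicit Defensive.
Local Open Scope ring_scope.
Local Open Scope classical_set_scope.

(** Boundary values compose badly: that [f] has unimodular limits almost everywhere says nothing
    about [f \o phi] unless [phi] is known not to send positive measure into a null set. Circular
    means inside the disk avoid this. Their stability comes from a change of variables: a weakly
    inner [phi] turns them, in the limit, into integrals against the Poisson kernel at [phi 0], and
    it is enough to test this on Taylor coefficients.

    One estimate drives all convergence: a holomorphic map into the closed disk that is nearly
    unimodular at one point is nearly constant on compact sets. The hyperbolic steps along the orbit
    decrease to a positive limit, so their differences are summable; this makes the renormalised
    iterates converge and bounds the loss of mean square on all circles at once, without which a
    limit of weakly inner functions may fail to be weakly inner. The same estimate makes the orbit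
    product converge.

    The automorphism may be parabolic, where the decay is no better than [1/k^2]. Real parameters
    [a] suffice in the Frostman argument since [|w - a| >= |Re w - a|] and the logarithm is
    integrable on a line. *)

Section ComplexModulus.
Variable R : realType.
Local Notation C := R[i].
Local Notation nc := (@ComplexField.Normc.normc R).
Local Notation Re := (@complex.Re R).
Local Notation Im := (@complex.Im R).
Implicit Types z w : C.

(** The norm of [R[i]] takes its values in [R[i]] itself; estimates are carried out with the real
    modulus [nc] instead, where order reasoning and [lra] apply. *)
Lemma normE z : `|z| = (nc z)%:C%C. Proof. by []. Qed.

Lemma nc_ge0 z : 0 <= nc z.
Proof. by case: z => a b; rewrite /= sqrtr_ge0. Qed.

Lemma nc_sqr z : nc z ^+ 2 = Re z ^+ 2 + Im z ^+ 2.
Proof. by case: z => a b; rewrite /= sqr_sqrtr // addr_ge0 // sqr_ge0. Qed.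

Lemma nc0 : nc 0 = 0. Proof. exact: ComplexField.Normc.normc0. Qed.
Lemma nc1 : nc 1 = 1. Proof. exact: ComplexField.Normc.normc1. Qed.
Lemma ncM z w : nc (z * w) = nc z * nc w.
Proof. exact: ComplexField.Normc.normcM. Qed.
Lemma ncV z : nc z^-1 = (nc z)^-1.
Proof. exact: ComplexField.Normc.normcV. Qed.
Lemma nc_eq0 z : (nc z == 0) = (z == 0).
Proof.
by apply/eqP/eqP => [/ComplexField.Normc.eq0_normc//|->]; rewrite nc0.
Qed.
Lemma nc_gt0 z : (0 < nc z) = (z != 0).
Proof. by rewrite lt_neqAle nc_ge0 andbT eq_sym nc_eq0. Qed.
Lemma ncD z w : nc (z + w) <= nc z + nc w.
Proof. by have := ler_normD z w; rewrite !normE -rmorphD/= lecR. Qed.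
Lemma ncN z : nc (- z) = nc z.
Proof. by have := normrN z; rewrite !normE => -[]. Qed.
Lemma ncC z w : nc (z - w) = nc (w - z). Proof. by rewrite -ncN opprB. Qed.
Lemma ncB z w : nc (z - w) <= nc z + nc w.
Proof. by rewrite -(ncN w) ncD. Qed.
Lemma ncB_ge z w : nc z - nc w <= nc (z - w).
Proof. by rewrite lerBlDr (le_trans _ (ncD _ _))// subrK. Qed.
Lemma ncJ z : nc z^*%C = nc z.
Proof. by case: z => a b; rewrite /= sqrrN. Qed.
Lemma ncX z n : nc (z ^+ n) = nc z ^+ n.
Proof. by elim: n => [|n IH]; rewrite ?expr0 ?nc1// !exprS ncM IH. Qed.
Lemma nc_real (x : R) : nc x%:C%C = `|x|.
Proof. by rewrite /= expr0n addr0 sqrtr_sqr. Qed.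
Lemma nc_posreal (x : R) : 0 <= x -> nc x%:C%C = x.
Proof. by move=> x0; rewrite nc_real ger0_norm. Qed.
Lemma nc_Re z : `|Re z| <= nc z.
Proof.
rewrite -(@ler_pXn2r _ 2)// ?nnegrE ?nc_ge0// nc_sqr real_normK ?num_real//.
by rewrite lerDl sqr_ge0.
Qed.
Lemma nc_Im z : `|Im z| <= nc z.
Proof.
rewrite -(@ler_pXn2r _ 2)// ?nnegrE ?nc_ge0// nc_sqr real_normK ?num_real//.
by rewrite lerDr sqr_ge0.
Qed.
Lemma Re_le z : Re z <= nc z. Proof. exact: le_trans (ler_norm _) (nc_Re z). Qed.
Lemma nc_le z : nc z <= `|Re z| + `|Im z|.
Proof.
rewrite -(@ler_pXn2r _ 2)// ?nnegrE ?nc_ge0 ?addr_ge0// nc_sqr.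
rewrite sqrrD !real_normK ?num_real//.
by rewrite lerD2r lerDl mulrn_wge0 // mulr_ge0.
Qed.
Lemma nc_sqrC z : ((nc z) ^+ 2)%:C%C = z * z^*%C.
Proof.
by rewrite nc_sqr; case: z => a b; rewrite /real_complex_def; apply/eqP;
  rewrite eq_complex /=; apply/andP; split; apply/eqP; ring.
Qed.
Lemma ReB z w : Re (z - w) = Re z - Re w. Proof. by case: z; case: w. Qed.
Lemma ImB z w : Im (z - w) = Im z - Im w. Proof. by case: z; case: w. Qed.
Lemma ReD z w : Re (z + w) = Re z + Re w. Proof. by case: z; case: w. Qed.
Lemma ImD z w : Im (z + w) = Im z + Im w. Proof. by case: z; case: w. Qed.
Lemma ReM z w : Re (z * w) = Re z * Re w - Im z * Im w.
Proof. by case: z; case: w. Qed.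
Lemma ImM z w : Im (z * w) = Re z * Im w + Im z * Re w.
Proof. by case: z => a b; case: w => c d; rewrite /= addrC. Qed.
Lemma ReJ z : Re z^*%C = Re z. Proof. by case: z. Qed.
Lemma ImJ z : Im z^*%C = - Im z. Proof. by case: z. Qed.
Lemma ReN z : Re (- z) = - Re z. Proof. by case: z. Qed.
Lemma ImN z : Im (- z) = - Im z. Proof. by case: z. Qed.
Lemma Re1 : Re 1 = 1. Proof. by []. Qed.
Lemma Im1 : Im 1 = 0. Proof. by []. Qed.
Definition ReImE := (ReB, ImB, ReD, ImD, ReM, ImM, ReJ, ImJ, ReN, ImN, Re1, Im1).

Lemma complex_eqP z w : Re z = Re w -> Im z = Im w -> z = w.
Proof. by case: z => a b; case: w => c d /= -> ->. Qed.

Lemma nc_expi t : nc (expi t) = 1.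
Proof. by rewrite /= cos2Dsin2 sqrtr1. Qed.

Lemma in_diskE z : in_disk z <-> nc z < 1.
Proof. by rewrite /in_disk normE -[1]/(1%:C%C) ltcR. Qed.

Lemma nc_sum_le (I : Type) (s : seq I) (P : pred I) (F : I -> C) :
  nc (\sum_(i <- s | P i) F i) <= \sum_(i <- s | P i) nc (F i).
Proof.
elim/big_rec2: _ => [|i y x _ h]; first by rewrite nc0.
by rewrite (le_trans (ncD _ _))// lerD2l.
Qed.

Lemma nc_prod (I : Type) (s : seq I) (P : pred I) (F : I -> C) :
  nc (\prod_(i <- s | P i) F i) = \prod_(i <- s | P i) nc (F i).
Proof.
by elim/big_rec2: _ => [|i y x _ h]; rewrite ?nc1// ncM h.
Qed.

(** * Continuity and limits in terms of the real modulus *)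

Lemma continuous_ncP (T : topologicalType) (f : T -> C) (x : T) :
  {for x, continuous (f : T -> C^o)} <->
  forall e : R, 0 < e -> \forall y \near x, nc (f y - f x) < e.
Proof.
split=> [/cvgrPdist_lt fx e e0|h].
  have e0' : 0 < e%:C%C :> C by rewrite -[0]/(0%:C%C) ltcR.
  by apply: filterS (fx _ e0') => y; rewrite normE ltcR ncC.
apply/cvgrPdist_lt => e e0.
have [Ie Re0] : Im e = 0 /\ 0 < Re e.
  by move: e0; rewrite ltcE/= => /andP[/eqP-> ->].
apply: filterS (h _ Re0) => y; rewrite ncC.
by case: e Ie Re0 {e0} => a b /= -> a0; rewrite normE -[(a +i* 0)%C]/(a%:C%C) ltcR.
Qed.

Lemma nbhs_ncP (z : C) (P : C -> Prop) :
  (\forall w \near (z : C^o), P w) <->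
  exists2 d : R, 0 < d & forall w, nc (w - z) < d -> P w.
Proof.
split.
  move=> /nbhs_ballP[d d0 h].
  have [Id Rd] : Im d = 0 /\ 0 < Re d.
    by move: d0; rewrite /= ltcE/= => /andP[/eqP-> ->].
  exists (Re d) => // w wz; apply: h; rewrite -ball_normE /= normE.
  by case: d Id Rd wz {d0} => a b /= -> a0 wz; rewrite -[(a +i* 0)%C]/(a%:C%C) ltcR ncC.
move=> [d d0 h]; apply/nbhs_ballP; exists d%:C%C.
  by rewrite /= -[0]/(0%:C%C) ltcR.
by move=> w; rewrite -ball_normE /= normE ltcR ncC; exact: h.
Qed.

Lemma continuousC_ncP (f : C -> C) z :
  {for z, continuous (f : C^o -> C^o)} <->
  forall e : R, 0 < e -> exists2 d : R, 0 < d &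
    forall w, nc (w - z) < d -> nc (f w - f z) < e.
Proof.
rewrite (@continuous_ncP (C^o) f z); split=> h e e0.
  exact/nbhs_ncP/h.
exact/nbhs_ncP/h.
Qed.

Lemma continuousR_ncP (f : R -> C) (t : R) :
  {for t, continuous (f : R -> C^o)} <->
  forall e : R, 0 < e -> exists2 d : R, 0 < d &
    forall s, `|s - t| < d -> nc (f s - f t) < e.
Proof.
rewrite (@continuous_ncP R f t); split=> h e e0.
  have /nbhs_ballP[d d0 hd] := h _ e0; exists d => // s st.
  by apply: hd; rewrite -ball_normE/= distrC.
have [d d0 hd] := h _ e0; apply/nbhs_ballP; exists d => // s.
by rewrite -ball_normE/= distrC; exact: hd.
Qed.

Section ContinuousArithmetic.
Variable T : topologicalType.
Implicit Types (u v : T -> C) (x : T).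

Lemma cont_cst (k : C) x : {for x, continuous ((fun=> k) : T -> C^o)}.
Proof. exact: (@cst_continuous T C^o k x). Qed.
Lemma contD u v x : {for x, continuous (u : T -> C^o)} ->
  {for x, continuous (v : T -> C^o)} ->
  {for x, continuous ((fun y => u y + v y) : T -> C^o)}.
Proof. by move=> cu cv; exact: (@continuousD C C^o T u v x cu cv). Qed.
Lemma contM u v x : {for x, continuous (u : T -> C^o)} ->
  {for x, continuous (v : T -> C^o)} ->
  {for x, continuous ((fun y => u y * v y) : T -> C^o)}.
Proof. by move=> cu cv; exact: (@continuousM C T u v x cu cv). Qed.
Lemma contN u x : {for x, continuous (u : T -> C^o)} ->
  {for x, continuous ((fun y => - u y) : T -> C^o)}.
Proof. by move=> cu; exact: (@continuousN C C^o T u x cu). Qed.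
Lemma contV u x : u x != 0 -> {for x, continuous (u : T -> C^o)} ->
  {for x, continuous ((fun y => (u y)^-1) : T -> C^o)}.
Proof. by move=> u0 cu; exact: (@continuousV C T u x u0 cu). Qed.

End ContinuousArithmetic.

(* One-constructor wrappers: they keep unification from unfolding the topology of [C]. *)
Variant ccont (u : R -> C) : Prop := CCont of continuous (u : R -> C^o).
Variant ccont_at (f : C -> C) (z : C) : Prop := CContAt of {for z, continuous (f : C^o -> C^o)}.

Lemma ccont_atP f z : ccont_at f z <-> forall e : R, 0 < e ->
  exists2 d : R, 0 < d & forall w, nc (w - z) < d -> nc (f w - f z) < e.
Proof. by split=> [[/continuousC_ncP//]|h]; constructor; exact/continuousC_ncP. Qed.

Lemma ccont_at_cst k z : ccont_at (fun=> k) z.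
Proof. by constructor; exact: cont_cst. Qed.
Lemma ccont_at_id z : ccont_at id z.
Proof. by constructor; exact: (@cvg_id C^o). Qed.
Lemma ccont_atD f g z : ccont_at f z -> ccont_at g z -> ccont_at (fun w => f w + g w) z.
Proof. by move=> [hf] [hg]; constructor; apply: (contD hf hg). Qed.
Lemma ccont_atM f g z : ccont_at f z -> ccont_at g z -> ccont_at (fun w => f w * g w) z.
Proof. by move=> [hf] [hg]; constructor; apply: (contM hf hg). Qed.
Lemma ccont_atN f z : ccont_at f z -> ccont_at (fun w => - f w) z.
Proof. by move=> [hf]; constructor; apply: (contN hf). Qed.
Lemma ccont_atV f z : f z != 0 -> ccont_at f z -> ccont_at (fun w => (f w)^-1) z.
Proof. by move=> f0 [hf]; constructor; apply: (contV f0 hf). Qed.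
Lemma ccont_at_comp f g z : ccont_at f z -> ccont_at g (f z) -> ccont_at (fun w => g (f w)) z.
Proof.
by move=> [hf] [hg]; constructor; exact: (@continuous_comp C^o C^o C^o f g z hf hg).
Qed.
Lemma ccont_comp (u : R -> C) f : ccont u -> (forall t, ccont_at f (u t)) ->
  ccont (fun t => f (u t)).
Proof.
move=> [cu] cf; constructor => t; have [cft] := cf t.
exact: (@continuous_comp R C^o C^o u f t (cu t) cft).
Qed.

Lemma ccont_Re (u : R -> C) : ccont u -> continuous (fun t => Re (u t)).
Proof.
move=> [cu] t; apply/cvgrPdist_lt => e e0.
apply: filterS ((continuous_ncP _ _).1 (cu t) e e0) => s.
by apply: le_lt_trans; rewrite -ReB ncC nc_Re.
Qed.

Lemma ccont_Im (u : R -> C) : ccont u -> continuous (fun t => Im (u t)).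
Proof.
move=> [cu] t; apply/cvgrPdist_lt => e e0.
apply: filterS ((continuous_ncP _ _).1 (cu t) e e0) => s.
by apply: le_lt_trans; rewrite -ImB ncC nc_Im.
Qed.

Lemma ccont_nc (u : R -> C) : ccont u -> continuous (fun t => nc (u t)).
Proof.
move=> [cu] t; apply/cvgrPdist_lt => e e0.
apply: filterS ((continuous_ncP _ _).1 (cu t) e e0) => s.
apply: le_lt_trans; rewrite ler_norml; have := ncB_ge (u t) (u s).
by have := ncB_ge (u s) (u t); rewrite (ncC (u t)); lra.
Qed.

Lemma ccont_pair (a b : R -> R) : continuous a -> continuous b ->
  ccont (fun t => (a t +i* b t)%C).
Proof.
move=> ca cb; constructor => t; apply/continuous_ncP => e e0.
have e20 : 0 < e / 2 by rewrite divr_gt0.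
have /cvgrPdist_lt/(_ _ e20) ha := ca t; have /cvgrPdist_lt/(_ _ e20) hb := cb t.
near=> s; apply: (le_lt_trans (nc_le _)); rewrite ReB ImB/= [ltRHS]splitr.
by rewrite ltrD// distrC; near: s.
Unshelve. all: by end_near. Qed.

Lemma ccont_cst z : ccont (fun=> z). Proof. by constructor => t; exact: cont_cst. Qed.
Lemma ccontD u v : ccont u -> ccont v -> ccont (fun t => u t + v t).
Proof. by move=> [cu] [cv]; constructor => t; exact: (contD (cu t) (cv t)). Qed.
Lemma ccontB u v : ccont u -> ccont v -> ccont (fun t => u t - v t).
Proof. by move=> [cu] [cv]; constructor => t; exact: (contD (cu t) (contN (cv t))). Qed.
Lemma ccontM u v : ccont u -> ccont v -> ccont (fun t => u t * v t).
Proof. by move=> [cu] [cv]; constructor => t; exact: (contM (cu t) (cv t)). Qed.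
Lemma ccontV u : ccont u -> (forall t, u t != 0) -> ccont (fun t => (u t)^-1).
Proof. by move=> [cu] u0; constructor => t; exact: (contV (u0 t) (cu t)). Qed.
Lemma ccontX u n : ccont u -> ccont (fun t => u t ^+ n).
Proof.
move=> cu; elim: n => [|n IH].
  by under [X in ccont X]eq_fun do rewrite expr0; exact: ccont_cst.
by under [X in ccont X]eq_fun do rewrite exprS; exact: ccontM.
Qed.
Lemma ccontJ u : ccont u -> ccont (fun t => (u t)^*%C).
Proof.
move=> [cu]; constructor => t; apply/continuous_ncP => e e0.
apply: filterS ((continuous_ncP _ _).1 (cu t) e e0) => s.
by rewrite -rmorphB ncJ.
Qed.
Lemma ccont_real (a : R -> R) : continuous a -> ccont (fun t => (a t)%:C%C).
Proof. by move=> ca; apply: (ccont_pair ca) => t; exact: cvg_cst. Qed.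
Lemma ccont_expi : ccont (@expi R).
Proof. by apply: ccont_pair => t; [exact: continuous_cos|exact: continuous_sin]. Qed.
Lemma ccont_circle (r : R) : ccont (fun t => r%:C%C * expi t).
Proof. by apply: ccontM; [exact: ccont_cst|exact: ccont_expi]. Qed.

Lemma real_continuousM (u v : R -> R) :
  continuous u -> continuous v -> continuous (fun t => u t * v t).
Proof. by move=> cu cv t; apply: (@continuousM R R u v); [exact: cu|exact: cv]. Qed.
Lemma real_continuousD (u v : R -> R) :
  continuous u -> continuous v -> continuous (fun t => u t + v t).
Proof. by move=> cu cv t; apply: (@continuousD R R^o R u v); [exact: cu|exact: cv]. Qed.
Lemma real_continuousB (u v : R -> R) :
  continuous u -> continuous v -> continuous (fun t => u t - v t).
Proof. by move=> cu cv t; apply: (@continuousB R R^o R u v); [exact: cu|exact: cv]. Qed.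

Definition clim (u : nat -> C) (l : C) :=
  (fun n => nc (u n - l)) @ \oo --> (0 : R).

Lemma clim_cvgP u l : (u : nat -> C^o) @ \oo --> (l : C^o) <-> clim u l.
Proof.
split.
  move=> /cvgrPdist_lt h; apply/cvgrPdist_lt => e e0.
  have e0' : 0 < e%:C%C :> C by rewrite -[0]/(0%:C%C) ltcR.
  apply: filterS (h _ e0') => n.
  by rewrite normE ltcR sub0r normrN ger0_norm ?nc_ge0// ncC.
move=> /cvgrPdist_lt h; apply/cvgrPdist_lt => e e0.
have [Ie Re0] : Im e = 0 /\ 0 < Re e.
  by move: e0; rewrite ltcE/= => /andP[/eqP-> ->].
apply: filterS (h _ Re0) => n; rewrite sub0r normrN ger0_norm ?nc_ge0// ncC.
by case: e Ie Re0 {e0} => a b /= -> a0; rewrite normE -[(a +i* 0)%C]/(a%:C%C) ltcR.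
Qed.

Lemma climP u l : clim u l <->
  forall e : R, 0 < e -> exists N, forall n, (N <= n)%N -> nc (u n - l) < e.
Proof.
split.
  move=> /cvgrPdist_lt h e e0; have [N _ hN] := h _ e0; exists N => n /hN.
  by rewrite /= sub0r normrN ger0_norm ?nc_ge0.
move=> h; apply/cvgrPdist_lt => e e0; have [N hN] := h _ e0.
by exists N => // n /hN; rewrite /= sub0r normrN ger0_norm ?nc_ge0.
Qed.

Lemma squeeze0 (u v : nat -> R) : (forall n, 0 <= u n <= v n) ->
  v @ \oo --> (0 : R) -> u @ \oo --> (0 : R).
Proof.
move=> h hv; apply: (@squeeze_cvgr _ _ _ _ (fun=> 0) v) => //; last exact: cvg_cst.
by apply: nearW.
Qed.

Lemma clim_cst z : clim (fun=> z) z.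
Proof. by rewrite /clim subrr nc0; exact: cvg_cst. Qed.

Lemma climD u v a b : clim u a -> clim v b -> clim (fun n => u n + v n) (a + b).
Proof.
move=> ha hb; apply: (@squeeze0 _ (fun n => nc (u n - a) + nc (v n - b))).
  by move=> n; rewrite nc_ge0/= opprD addrACA ncD.
by rewrite -[0]addr0; exact: cvgD.
Qed.

Lemma climM u v a b : clim u a -> clim v b -> clim (fun n => u n * v n) (a * b).
Proof.
move=> /clim_cvgP ha /clim_cvgP hb; apply/clim_cvgP.
exact: (@cvgM C nat \oo _ u v a b ha hb).
Qed.

Lemma climB u v a b : clim u a -> clim v b -> clim (fun n => u n - v n) (a - b).
Proof.
move=> ha hb; apply: (@squeeze0 _ (fun n => nc (u n - a) + nc (v n - b))).
  by move=> n; rewrite nc_ge0/= opprD addrACA -opprD ncB.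
by rewrite -[0]addr0; exact: cvgD.
Qed.

Lemma climV u a : a != 0 -> clim u a -> clim (fun n => (u n)^-1) a^-1.
Proof.
move=> a0 /clim_cvgP ha; apply/clim_cvgP.
exact: (@cvgV C nat \oo _ u a a0 ha).
Qed.

Lemma climJ u a : clim u a -> clim (fun n => (u n)^*%C) a^*%C.
Proof. by move=> ha; apply: (@squeeze0 _ _ _ ha) => n; rewrite nc_ge0 -rmorphB ncJ/=. Qed.

Lemma clim_nc u a : clim u a -> (fun n => nc (u n)) @ \oo --> nc a.
Proof.
move=> ha; apply/subr_cvg0; apply/norm_cvg0P; apply: (squeeze0 _ ha) => n.
rewrite normr_ge0/= ler_norml; have := ncB_ge (u n) a.
by have := ncB_ge a (u n); rewrite (ncC a); lra.
Qed.

Lemma clim_real (u : nat -> R) (l : R) :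
  u @ \oo --> l -> clim (fun n => (u n)%:C%C) l%:C%C.
Proof.
move=> /subr_cvg0 h; rewrite /clim.
under eq_fun do rewrite -rmorphB nc_real.
exact/norm_cvg0P.
Qed.

Lemma clim_unique u a b : clim u a -> clim u b -> a = b.
Proof.
move=> ha hb; have := climB ha hb; under eq_fun do rewrite subrr.
move=> /clim_nc; rewrite nc0 => h.
have : nc (a - b) = 0 by apply: (@cvg_unique _ (@Rhausdorff R) _ _ _ _ h); exact: cvg_cst.
by move=> /eqP; rewrite nc_eq0 subr_eq0 => /eqP.
Qed.

Lemma clim_shift u a : clim u a -> clim (fun n => u n.+1) a.
Proof.
move=> /climP h; apply/climP => e /h[N hN]; exists N => n Nn.
exact/hN/leqW.
Qed.

Lemma clim_le u a (k : R) : clim u a -> (forall n, nc (u n) <= k) -> nc a <= k.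
Proof.
move=> /clim_nc h hk; have <- := cvg_lim (@Rhausdorff R) h.
by apply: limr_le; [exact: (cvgP _ h)|exact: nearW].
Qed.

Lemma clim_Re_Im u a b : (fun n => Re (u n)) @ \oo --> a ->
  (fun n => Im (u n)) @ \oo --> b -> clim u (a +i* b)%C.
Proof.
move=> ha hb.
apply: (@squeeze0 _ (fun n => `|Re (u n) - a| + `|Im (u n) - b|)).
  by move=> n; rewrite nc_ge0/= (le_trans (nc_le _))// ReB ImB.
by rewrite -[0]addr0; apply: cvgD; apply/norm_cvg0P; exact/subr_cvg0.
Qed.

(** Completeness without series: when the increments are dominated by those of a convergent real
    sequence, the real and imaginary parts are Cauchy, and what remains of the majorant bounds the
    distance to the limit. The renormalised iterates and the infinite product both converge through
    this. *)
Lemma clim_telescope (u : nat -> C) (v : nat -> R) (l : R) :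
  (forall n, nc (u n.+1 - u n) <= v n - v n.+1) -> v @ \oo --> l ->
  exists2 a, clim u a & forall n, nc (a - u n) <= v n - l.
Proof.
move=> huv vl.
have step n k : nc (u (n + k)%N - u n) <= v n - v (n + k)%N.
  elim: k => [|k IH]; first by rewrite addn0 !subrr nc0.
  rewrite addnS -(subrKA (u (n + k)%N)) (le_trans (ncD _ _))//.
  by rewrite -(subrKA (v (n + k)%N) (v n)) addrC lerD.
have vnl n : l <= v n.
  have <- := cvg_lim (@Rhausdorff R) vl.
  apply: limr_le; first exact: (cvgP _ vl).
  near=> m; have nm : (n <= m)%N by near: m; exact: nbhs_infty_ge.
  by rewrite -(subnKC nm) -subr_ge0 (le_trans (nc_ge0 _) (step _ _)).
have cau : forall w : nat -> R, (forall n k, `|w (n + k)%N - w n| <= v n - v (n + k)%N) ->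
    cvgn w.
  move=> w hw; apply: (@cauchy_cvg R); apply: cauchy_exP => e e0 /=.
  have : \forall n \near \oo, v n - l < e / 2.
    by move/cvgrPdist_lt: vl => /(_ (e/2)); rewrite divr_gt0// => /(_ isT);
      apply: filterS => n; rewrite distrC; apply: le_lt_trans; exact: ler_norm.
  move=> [N _ hN]; exists (w N); exists N => // m /= Nm.
  rewrite -ball_normE /ball_/= -(subnKC Nm) distrC (le_lt_trans (hw _ _))//.
  have := hN _ (leqnn N); have := vnl (N + (m - N))%N.
  by move: e0 => /=; lra.
have hRe : cvgn (fun n => Re (u n)).
  by apply: cau => n k; rewrite -ReB (le_trans (nc_Re _)).
have hIm : cvgn (fun n => Im (u n)).
  by apply: cau => n k; rewrite -ImB (le_trans (nc_Im _)).
have ul := clim_Re_Im hRe hIm.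
eexists; first exact: ul.
move=> n; apply: (@clim_le (fun k => u (n + k)%N - u n)).
  apply: climB (clim_cst _).
  move/climP: ul => h; apply/climP => e /h[N hN]; exists N => k Nk.
  by apply: hN; rewrite (leq_trans Nk)// leq_addl.
by move=> k; rewrite (le_trans (step _ _))// lerD2l lerN2.
Unshelve. all: by end_near. Qed.

End ComplexModulus.

(** * Integration and bisection *)

Section Integrals.
Variable R : realType.
Local Notation C := R[i].
Local Notation nc := (@ComplexField.Normc.normc R).
Local Notation Re := (@complex.Re R).
Local Notation Im := (@complex.Im R).
Local Notation mu := (@lebesgue_measure R).

Definition rint (a b : R) (u : R -> R) : R := \int[mu]_(x in `[a, b]) u x.

Lemma continuous_integrable (a b : R) (u : R -> R) :
  continuous u -> mu.-integrable `[a, b] (EFin \o u).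
Proof.
move=> cu; apply: continuous_compact_integrable; first exact: segment_compact.
exact/continuous_subspaceT.
Qed.
Hint Resolve continuous_integrable : core.

Lemma rintD a b (u v : R -> R) : continuous u -> continuous v ->
  rint a b (fun x => u x + v x) = rint a b u + rint a b v.
Proof. by move=> cu cv; apply: RintegralD => //; exact: continuous_integrable. Qed.

Lemma rintB a b (u v : R -> R) : continuous u -> continuous v ->
  rint a b (fun x => u x - v x) = rint a b u - rint a b v.
Proof. by move=> cu cv; apply: RintegralB => //; exact: continuous_integrable. Qed.

Lemma rintZ a b k (u : R -> R) : continuous u -> rint a b (fun x => k * u x) = k * rint a b u.
Proof. by move=> cu; apply: RintegralZl => //; exact: continuous_integrable. Qed.

Lemma rint_cst a b k : a <= b -> rint a b (fun=> k) = k * (b - a).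
Proof.
move=> ab; rewrite /rint Rintegral_cst//= lebesgue_measure_itv/= lte_fin.
by move: ab; rewrite le_eqVlt => /predU1P[->|->//]; rewrite ltxx subrr/=.
Qed.

Lemma rint_eq a b (u v : R -> R) : (forall x, a <= x <= b -> u x = v x) -> rint a b u = rint a b v.
Proof.
by move=> uv; apply: eq_Rintegral => x; rewrite inE/= in_itv/= => /uv.
Qed.

Lemma rint_le a b (u v : R -> R) : continuous u -> continuous v ->
  (forall x, a <= x <= b -> u x <= v x) -> rint a b u <= rint a b v.
Proof.
move=> cu cv uv; apply: le_Rintegral => //; try exact: continuous_integrable.
Qed.

Lemma rint_ge0 a b u : (forall x, a <= x <= b -> 0 <= u x) -> 0 <= rint a b u.
Proof. by move=> u0; apply: Rintegral_ge0 => x; rewrite /= in_itv/= => /u0. Qed.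

Lemma rint_split a b c (u : R -> R) : a <= c -> c <= b -> continuous u ->
  rint a b u = rint a c u + rint c b u.
Proof.
move=> ac cb cu.
have h : rint a b u - rint a c u = rint c b u.
  rewrite /rint Rintegral_itvB ?bnd_simp//; last exact: continuous_integrable.
  rewrite Rintegral_itv_obnd_cbnd//.
  by apply: integrableS (@continuous_integrable c b u cu) => //; apply: subset_itvr; rewrite bnd_simp.
by rewrite -h; ring.
Qed.

Lemma rint_deriv (a b : R) (F f : R -> R) : a <= b -> continuous f ->
  (forall x : R, is_derive x 1 F (f x)) -> rint a b f = F b - F a.
Proof.
move=> ab cf dF; move: ab; rewrite le_eqVlt => /predU1P[->|ab].
  by rewrite /rint set_itv1 Rintegral_set1 subrr.
have cF : continuous F.
  by move=> x; apply: differentiable_continuous; apply/derivable1_diffP; exact: ex_derive.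
rewrite /rint /Rintegral (@continuous_FTC2 _ f F)//.
- exact: continuous_subspaceT.
- split; first by move=> x _; exact: ex_derive.
    by apply: cvg_at_right_filter; exact: cF.
  by apply: cvg_at_left_filter; exact: cF.
- by move=> x _; rewrite derive1E derive_val.
Qed.

Definition cint (a b : R) (u : R -> C) : C :=
  (rint a b (fun t => Re (u t)) +i* rint a b (fun t => Im (u t)))%C.

Lemma cint_eq a b u v : (forall x, a <= x <= b -> u x = v x) -> cint a b u = cint a b v.
Proof. by move=> uv; congr (_ +i* _)%C; apply: rint_eq => x /uv ->. Qed.

Lemma cintD a b u v : ccont u -> ccont v ->
  cint a b (fun x => u x + v x) = cint a b u + cint a b v.
Proof.
move=> cu cv; apply: complex_eqP; rewrite ReImE /= -rintD;
  do ?[exact: ccont_Re|exact: ccont_Im];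
  by apply: rint_eq => x _; rewrite ReImE.
Qed.

Lemma cintB a b u v : ccont u -> ccont v ->
  cint a b (fun x => u x - v x) = cint a b u - cint a b v.
Proof.
move=> cu cv; apply: complex_eqP; rewrite ReImE /= -rintB;
  do ?[exact: ccont_Re|exact: ccont_Im];
  by apply: rint_eq => x _; rewrite ReImE.
Qed.

Lemma cintZ a b (k : C) u : ccont u -> cint a b (fun x => k * u x) = k * cint a b u.
Proof.
move=> cu; have cR := ccont_Re cu; have cI := ccont_Im cu.
have cZ (x : R) (w : R -> R) : continuous w -> continuous (fun t => x * w t).
  by move=> cw; apply: real_continuousM => // t; exact: cvg_cst.
apply: complex_eqP; rewrite ReImE /= -!rintZ// -?rintB -?rintD//; do ?exact: cZ;
  by apply: rint_eq => x _; rewrite ReImE.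
Qed.

Lemma cint_split a b c u : a <= c -> c <= b -> ccont u ->
  cint a b u = cint a c u + cint c b u.
Proof.
move=> ac cb cu; apply: complex_eqP; rewrite ReImE /=; apply: rint_split => //.
  exact: ccont_Re.
exact: ccont_Im.
Qed.

(** The factor 2 comes from bounding the real and imaginary parts separately. *)
Lemma cint_bound a b u (K : R) : a <= b -> ccont u ->
  (forall x, a <= x <= b -> nc (u x) <= K) -> nc (cint a b u) <= 2 * K * (b - a).
Proof.
move=> ab cu uK.
have bnd (v : R -> R) : continuous v -> (forall x, a <= x <= b -> `|v x| <= K) ->
    `|rint a b v| <= K * (b - a).
  move=> cv vK; rewrite ler_norml -mulNr -!rint_cst//; apply/andP; split;
    apply: rint_le => //; do ?(move=> t; exact: cvg_cst);
    by move=> x /vK; rewrite ler_norml => /andP[].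
apply: (le_trans (nc_le _)) => /=; rewrite -mulrA mulr2n mulrDl !mul1r.
apply: lerD; apply: bnd; do ?[exact: ccont_Re|exact: ccont_Im] => x /uK;
  apply: le_trans; [exact: nc_Re|exact: nc_Im].
Qed.

Lemma cint_cst a b k : a <= b -> cint a b (fun=> k) = k * (b - a)%:C%C.
Proof.
move=> ab; rewrite /cint !rint_cst//; apply: complex_eqP; rewrite ReImE/= mulr0;
  by rewrite ?subr0 ?add0r.
Qed.

Lemma cint_expi a b : a <= b -> cint a b (fun t => 'i%C * expi t) = expi b - expi a.
Proof.
move=> ab; apply: complex_eqP; rewrite ReImE/=.
  rewrite (@rint_eq _ _ _ (fun t => - sin t)); last by move=> x _; rewrite mul0r mul1r sub0r.
  apply: rint_deriv => // x; apply: cvgN || idtac; exact: continuous_sin.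
rewrite (@rint_eq _ _ _ (fun t => cos t)); last by move=> x _; rewrite mul0r mul1r add0r.
by apply: rint_deriv => // x; exact: continuous_cos.
Qed.

(* Goursat's bisection: an additive rectangle function that is o(diam^2) at every
   point vanishes. *)
Lemma rectangle_bisection (J : R -> R -> R -> R -> C) (s0 s1 t0 t1 : R) :
  s0 <= s1 -> t0 <= t1 ->
  (forall a b c d m, s0 <= a -> a <= m -> m <= b -> b <= s1 -> t0 <= c -> c <= d ->
    d <= t1 -> J a b c d = J a m c d + J m b c d) ->
  (forall a b c d m, s0 <= a -> a <= b -> b <= s1 -> t0 <= c -> c <= m -> m <= d ->
    d <= t1 -> J a b c d = J a b c m + J a b m d) ->
  (forall p q, s0 <= p <= s1 -> t0 <= q <= t1 -> forall e : R, 0 < e ->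
    exists2 del : R, 0 < del & forall a b c d rho : R, s0 <= a -> a <= b -> b <= s1 ->
      t0 <= c -> c <= d -> d <= t1 -> 0 <= rho -> rho < del ->
      `|a - p| <= rho -> `|b - p| <= rho -> `|c - q| <= rho -> `|d - q| <= rho ->
      nc (J a b c d) <= e * rho ^+ 2) ->
  J s0 s1 t0 t1 = 0.
Proof.
move=> s01 t01 Js Jt Jloc; apply/eqP; rewrite -nc_eq0; apply/eqP.
apply/eqP; rewrite eq_le nc_ge0 andbT leNgt; apply/negP => J0.
pose ds n := (s1 - s0) / 2 ^+ n; pose dt n := (t1 - t0) / 2 ^+ n.
have ds0 n : 0 <= ds n by rewrite divr_ge0 ?subr_ge0// exprn_ge0.
have dt0 n : 0 <= dt n by rewrite divr_ge0 ?subr_ge0// exprn_ge0.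
have pow2 n : (2 : R) ^+ n != 0 by rewrite expf_neq0.
have dsS n : ds n = ds n.+1 + ds n.+1.
  by rewrite /ds exprS; field; rewrite pow2.
have dtS n : dt n = dt n.+1 + dt n.+1.
  by rewrite /dt exprS; field; rewrite pow2.
pose Jn n (p : R * R) : R := nc (J p.1 (p.1 + ds n) p.2 (p.2 + dt n)).
pose good n (p : R * R) := [&& s0 <= p.1, p.1 + ds n <= s1, t0 <= p.2 & p.2 + dt n <= t1].
have step n p : good n p -> exists p' : R * R, [/\ good n.+1 p',
    p.1 <= p'.1 <= p.1 + ds n.+1, p.2 <= p'.2 <= p.2 + dt n.+1 &
    Jn n p <= 4 * Jn n.+1 p'].
  case: p => s t /and4P[/= h1 h2 h3 h4].
  have e1 := ds0 n.+1; have e2 := dt0 n.+1.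
  move: h2 h4; rewrite dsS dtS !addrA => h2 h4.
  have JE : J s (s + ds n.+1 + ds n.+1) t (t + dt n.+1 + dt n.+1) =
    (J s (s + ds n.+1) t (t + dt n.+1) +
     J s (s + ds n.+1) (t + dt n.+1) (t + dt n.+1 + dt n.+1)) +
    (J (s + ds n.+1) (s + ds n.+1 + ds n.+1) t (t + dt n.+1) +
     J (s + ds n.+1) (s + ds n.+1 + ds n.+1) (t + dt n.+1) (t + dt n.+1 + dt n.+1)).
    apply: (etrans (Js _ _ _ _ (s + ds n.+1) _ _ _ _ _ _ _)); [lra|lra|lra|lra|lra|lra|lra|].
    by congr (_ + _); apply: Jt; lra.
  pose N := Jn n (s, t).
  have NE : N <= (Jn n.+1 (s, t) + Jn n.+1 (s, t + dt n.+1)) +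
     (Jn n.+1 (s + ds n.+1, t) + Jn n.+1 (s + ds n.+1, t + dt n.+1)).
    rewrite /N /Jn/= (dsS n) (dtS n) (addrA s) (addrA t) JE.
    by apply: (le_trans (ncD _ _)); apply: lerD; exact: ncD.
  have [k1|k1] := leP N (4 * Jn n.+1 (s, t)).
    by exists (s, t); split => //=; rewrite /good/=; [apply/and4P; split|apply/andP|apply/andP]; lra.
  have [k2|k2] := leP N (4 * Jn n.+1 (s, t + dt n.+1)).
    by exists (s, t + dt n.+1); split => //=; rewrite /good/=;
      [apply/and4P; split|apply/andP|apply/andP]; lra.
  have [k3|k3] := leP N (4 * Jn n.+1 (s + ds n.+1, t)).
    by exists (s + ds n.+1, t); split => //=; rewrite /good/=;
      [apply/and4P; split|apply/andP|apply/andP]; lra.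
  have [k4|k4] := leP N (4 * Jn n.+1 (s + ds n.+1, t + dt n.+1)).
    by exists (s + ds n.+1, t + dt n.+1); split => //=; rewrite /good/=;
      [apply/and4P; split|apply/andP|apply/andP]; lra.
  by exfalso; lra.
have good0 : good 0 (s0, t0).
  by rewrite /good /ds /dt /= expr0 !divr1 lexx/= lexx/=; apply/andP; split; lra.
pose f n (p : R * R) := xget (s0, t0) [set p' | [/\ good n.+1 p',
    p.1 <= p'.1 <= p.1 + ds n.+1, p.2 <= p'.2 <= p.2 + dt n.+1 &
    Jn n p <= 4 * Jn n.+1 p']].
have fP n p : good n p -> [/\ good n.+1 (f n p),
    p.1 <= (f n p).1 <= p.1 + ds n.+1, p.2 <= (f n p).2 <= p.2 + dt n.+1 &
    Jn n p <= 4 * Jn n.+1 (f n p)].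
  by move=> /step[p' hp']; rewrite /f; case: xgetP => [x -> //|/(_ p')/(_ hp')].
pose x := fix x n := if n is k.+1 then f k (x k) else (s0, t0).
have xg n : good n (x n).
  by elim: n => [//|n IH]; have [] := fP _ _ IH.
have xJ n : Jn 0%N (s0, t0) <= 4 ^+ n * Jn n (x n).
  elim: n => [|n IH]; first by rewrite expr0 mul1r.
  have [_ _ _ h] := fP _ _ (xg n); apply: (le_trans IH).
  by rewrite exprSr -mulrA ler_wpM2l// exprn_ge0.
pose v n := ds n + dt n.
have [a ua ha] : exists2 a, clim (fun n => ((x n).1 +i* (x n).2)%C) a &
    forall n, nc (a - ((x n).1 +i* (x n).2)%C) <= v n - 0.
  apply: (@clim_telescope R _ v 0).
    move=> n; have [_ h1 h2 _] := fP _ _ (xg n).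
    apply: (le_trans (nc_le _)); rewrite ReB ImB /= /v dsS dtS.
    have -> : ds n.+1 + ds n.+1 + (dt n.+1 + dt n.+1) - (ds n.+1 + dt n.+1) =
      ds n.+1 + dt n.+1 by ring.
    by apply: lerD; rewrite ler_norml; move: h1 h2 => /andP[? ?] /andP[? ?];
      apply/andP; split; have := ds0 n.+1; have := dt0 n.+1; lra.
  have -> : v = (fun n => (s1 - s0 + (t1 - t0)) * (2^-1) ^+ n).
    by apply: funext => n; rewrite /v /ds /dt -mulrDl exprVn.
  rewrite -[X in _ --> X](mulr0 (s1 - s0 + (t1 - t0))).
  apply: cvgMr; apply: cvg_expr; rewrite ger0_norm ?invr_ge0//.
  by rewrite invf_lt1// ltr1n.
have lim_ge (u : nat -> R) (k l : R) : (forall n, k <= u n <= l) ->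
   forall b, u @ \oo --> b -> k <= b <= l.
  move=> hu b ub; rewrite -(cvg_lim (@Rhausdorff R) ub); apply/andP; split.
    by apply: limr_ge; [exact: (cvgP _ ub)|apply: nearW => n; case/andP: (hu n)].
  by apply: limr_le; [exact: (cvgP _ ub)|apply: nearW => n; case/andP: (hu n)].
have aRe : s0 <= Re a <= s1.
  apply: (lim_ge (fun n => (x n).1)).
    by move=> n; have /and4P[? ? ? ?] := xg n; have := ds0 n; lra.
  apply/subr_cvg0/norm_cvg0P; apply: (squeeze0 _ ua) => n.
  by rewrite normr_ge0/=; apply: le_trans (nc_Re _); rewrite ReB.
have aIm : t0 <= Im a <= t1.
  apply: (lim_ge (fun n => (x n).2)).
    by move=> n; have /and4P[? ? ? ?] := xg n; have := dt0 n; lra.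
  apply/subr_cvg0/norm_cvg0P; apply: (squeeze0 _ ua) => n.
  by rewrite normr_ge0/=; apply: le_trans (nc_Im _); rewrite ImB.
pose D := 2 * (s1 - s0 + (t1 - t0)) + 1.
have D0 : 0 < D by rewrite /D; lra.
(* Against the factor [4 ^+ n] of [xJ] and rectangles lying within [D / 2 ^+ n] of the limit point,
   this tolerance bounds [nc (J s0 s1 t0 t1)] by half of itself. *)
have [|del del0 hdel] := Jloc _ _ aRe aIm (nc (J s0 s1 t0 t1) / (2 * D ^+ 2)).
  by rewrite divr_gt0// mulr_gt0// exprn_gt0.
have : (fun n => D * (2^-1) ^+ n) @ \oo --> (0 : R).
  rewrite -[X in _ --> X](mulr0 D).
  apply: cvgMr; apply: cvg_expr; rewrite ger0_norm ?invr_ge0//.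
  by rewrite invf_lt1// ltr1n.
move=> /cvgrPdist_lt/(_ _ del0)[n _ /(_ n (leqnn n))] /=.
rewrite sub0r normrN => /(le_lt_trans (ler_norm _)).
rewrite exprVn -/(D / 2 ^+ n) => Dn.
have /and4P[h1 h2 h3 h4] := xg n.
have hn := ha n; rewrite subr0 in hn.
have vD : v n + v n <= D / 2 ^+ n.
  rewrite /v /ds /dt /D -!mulrDl ler_wpM2r ?invr_ge0 ?exprn_ge0//.
  by lra.
have k1 : `|(x n).1 - Re a| <= v n.
  by apply: le_trans hn; rewrite distrC; apply: le_trans (nc_Re _); rewrite ReB.
have k2 : `|(x n).2 - Im a| <= v n.
  by apply: le_trans hn; rewrite distrC; apply: le_trans (nc_Im _); rewrite ImB.
have := hdel _ _ _ _ (D / 2 ^+ n) h1 _ h2 h3 _ h4.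
have e1 := ds0 n; have e2 := dt0 n.
have vE : v n = ds n + dt n by [].
move=> /(_ _ _ _ Dn).
have b1 : `|(x n).1 - Re a| <= D / 2 ^+ n by lra.
have b2 : `|(x n).1 + ds n - Re a| <= D / 2 ^+ n.
  by move: k1; rewrite !ler_norml => /andP[? ?]; apply/andP; split; lra.
have b3 : `|(x n).2 - Im a| <= D / 2 ^+ n by lra.
have b4 : `|(x n).2 + dt n - Im a| <= D / 2 ^+ n.
  by move: k2; rewrite !ler_norml => /andP[? ?]; apply/andP; split; lra.
have x1 : (x n).1 <= (x n).1 + ds n by lra.
have x2 : (x n).2 <= (x n).2 + dt n by lra.
move=> /(_ x1 x2).
have r0 : 0 <= D / 2 ^+ n by rewrite divr_ge0 ?exprn_ge0// ltW.
move=> /(_ r0 b1 b2 b3 b4) Jle.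
have := xJ n; rewrite {1}/Jn/= /ds /dt expr0 !divr1 (addrC s0) (addrC t0) !subrK => hJ.
have : nc (J s0 s1 t0 t1) <= 4 ^+ n * (nc (J s0 s1 t0 t1) / (2 * D ^+ 2) * (D / 2 ^+ n) ^+ 2).
  by apply: (le_trans hJ); rewrite ler_wpM2l ?exprn_ge0.
have -> : (4 : R) ^+ n = 2 ^+ n ^+ 2 by rewrite -exprM mulnC exprM; congr (_ ^+ _); ring.
have -> : 2 ^+ n ^+ 2 * (nc (J s0 s1 t0 t1) / (2 * D ^+ 2) * (D / 2 ^+ n) ^+ 2) =
  nc (J s0 s1 t0 t1) / 2.
  by field; rewrite pow2/= gt_eqF.
lra.
Qed.

End Integrals.

(** * Holomorphic functions on the disk *)

Section Holomorphic.
Variable R : realType.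
Local Notation C := R[i].
Local Notation nc := (@ComplexField.Normc.normc R).
Implicit Types (f g : C -> C) (z w : C).

(* Caratheodory's form of complex differentiability. *)
Definition chol f z := exists q : C -> C,
  ccont_at q z /\ forall w, f w = f z + q w * (w - z).

Definition hol f := forall z, nc z < 1 -> chol f z.

(** Off [z] the quotient is forced, so one that is continuous at [z] and valid near [z] extends to
    all of [C]; differentiability becomes a local property. *)
Lemma chol_local f q z (d : R) : 0 < d -> ccont_at q z ->
  (forall w, nc (w - z) < d -> f w = f z + q w * (w - z)) -> chol f z.
Proof.
move=> d0 cq hq.
exists (fun w => if w == z then q z else (f w - f z) / (w - z)); split; last first.
  move=> w; case: ifPn => [/eqP ->|wz]; first by rewrite subrr mulr0 addr0.
  by rewrite divfK ?subr_eq0// addrC subrK.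
apply/ccont_atP => e e0; have [d' d'0 hd'] := (ccont_atP _ _).1 cq e e0.
exists (Num.min d d'); first by rewrite lt_min d0.
move=> w; rewrite lt_min => /andP[wd wd']; rewrite eqxx.
case: ifPn => [_|wz]; first by rewrite subrr nc0.
by rewrite hq// [f z + _]addrC addrK mulfK ?subr_eq0//; exact: hd'.
Qed.

Lemma chol_ext f g z (d : R) : 0 < d -> (forall w, nc (w - z) < d -> f w = g w) ->
  chol f z -> chol g z.
Proof.
move=> d0 fg [q [cq hq]]; apply: (chol_local d0 cq) => w wz.
by rewrite -!fg// ?subrr ?nc0.
Qed.

Lemma hol_ext f g : (forall z, nc z < 1 -> f z = g z) -> hol f -> hol g.
Proof.
move=> fg hf z z1; apply: (@chol_ext f _ _ (1 - nc z)) (hf z z1); rewrite ?subr_gt0//.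
move=> w wz; apply: fg; have := ncD (w - z) z; rewrite subrK; lra.
Qed.

Lemma chol_cst k z : chol (fun=> k) z.
Proof.
by exists (fun=> 0); split=> [|w]; [exact: ccont_at_cst|rewrite mul0r addr0].
Qed.

Lemma chol_id z : chol id z.
Proof. by exists (fun=> 1); split=> [|w]; [exact: ccont_at_cst|rewrite mul1r addrC subrK]. Qed.

Lemma chol_continuous f z : chol f z -> ccont_at f z.
Proof.
move=> [q [cq hq]].
have -> : f = (fun w => f z + q w * (w - z)) by apply: funext => w; exact: hq.
apply: ccont_atD; first exact: ccont_at_cst.
apply: ccont_atM => //; apply: ccont_atD; last exact: ccont_at_cst.
exact: ccont_at_id.
Qed.

Lemma cholD f g z : chol f z -> chol g z -> chol (fun w => f w + g w) z.
Proof.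
move=> [q [cq hq]] [p [cp hp]]; exists (fun w => q w + p w); split.
  exact: ccont_atD.
by move=> w; rewrite hq hp; ring.
Qed.

Lemma cholM f g z : chol f z -> chol g z -> chol (fun w => f w * g w) z.
Proof.
move=> [q [cq hq]] hg; have cg := chol_continuous hg; case: hg => p [cp hp].
exists (fun w => q w * g w + f z * p w); split.
  apply: ccont_atD; first exact: ccont_atM.
  by apply: ccont_atM => //; exact: ccont_at_cst.
by move=> w; rewrite hq hp; ring.
Qed.

Lemma cholN f z : chol f z -> chol (fun w => - f w) z.
Proof.
move=> hf; apply: (@chol_ext (fun w => (-1) * f w) _ _ 1) => //.
  by move=> w _; rewrite mulN1r.
by apply: cholM => //; exact: chol_cst.
Qed.

Lemma cholB f g z : chol f z -> chol g z -> chol (fun w => f w - g w) z.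
Proof. by move=> hf hg; apply: cholD => //; exact: cholN. Qed.

Lemma cholV f z : f z != 0 -> chol f z -> chol (fun w => (f w)^-1) z.
Proof.
move=> fz hf; have cf := chol_continuous hf; case: hf => q [cq hq].
have fz0 : 0 < nc (f z) by rewrite nc_gt0.
have [d d0 hd] := (ccont_atP _ _).1 cf _ fz0.
apply: (@chol_local _ (fun w => - q w * ((f w)^-1 * (f z)^-1)) z d d0).
  apply: ccont_atM; first exact: ccont_atN.
  by apply: ccont_atM; [exact: ccont_atV|exact: ccont_at_cst].
move=> w /hd fw; have fw0 : f w != 0.
  by apply/eqP => h; move: fw; rewrite h sub0r ncN ltxx.
have -> : - q w * ((f w)^-1 / f z) * (w - z) = - (q w * (w - z)) * ((f w)^-1 / f z) by ring.
have -> : q w * (w - z) = f w - f z by rewrite (hq w); ring.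
by field; rewrite fw0 fz.
Qed.

Lemma chol_comp f g z : chol f z -> chol g (f z) -> chol (fun w => g (f w)) z.
Proof.
move=> hf; have cf := chol_continuous hf; case: hf => q [cq hq] [p [cp hp]].
exists (fun w => p (f w) * q w); split.
  by apply: ccont_atM => //; exact: ccont_at_comp.
by move=> w; rewrite (hp (f w)) -mulrA; congr (_ + _ * _); rewrite (hq w); ring.
Qed.

Lemma cholX f z n : chol f z -> chol (fun w => f w ^+ n) z.
Proof.
move=> hf; elim: n => [|n IH].
  by under [X in chol X]eq_fun do rewrite expr0; exact: chol_cst.
by under [X in chol X]eq_fun do rewrite exprS; exact: cholM.
Qed.

Lemma hol_cst k : hol (fun=> k). Proof. by move=> z _; exact: chol_cst. Qed.
Lemma hol_id : hol id. Proof. by move=> z _; exact: chol_id. Qed.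
Lemma holD f g : hol f -> hol g -> hol (fun w => f w + g w).
Proof. by move=> hf hg z z1; apply: cholD; [exact: hf|exact: hg]. Qed.
Lemma holB f g : hol f -> hol g -> hol (fun w => f w - g w).
Proof. by move=> hf hg z z1; apply: cholB; [exact: hf|exact: hg]. Qed.
Lemma holM f g : hol f -> hol g -> hol (fun w => f w * g w).
Proof. by move=> hf hg z z1; apply: cholM; [exact: hf|exact: hg]. Qed.
Lemma holX f n : hol f -> hol (fun w => f w ^+ n).
Proof. by move=> hf z z1; apply: cholX; exact: hf. Qed.
Lemma holV f : hol f -> (forall z, nc z < 1 -> f z != 0) -> hol (fun w => (f w)^-1).
Proof. by move=> hf f0 z z1; apply: cholV; [exact: f0|exact: hf]. Qed.
Lemma hol_comp f g : hol f -> (forall z, nc z < 1 -> nc (f z) < 1) -> hol g ->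
  hol (fun w => g (f w)).
Proof. by move=> hf f1 hg z z1; apply: chol_comp; [exact: hf|exact/hg/f1]. Qed.

Lemma holo_on_diskP f : holo_on_disk f -> hol f.
Proof.
move=> hf z z1; have zd : in_disk z by exact/in_diskE.
have /cvg_ex[/= d hd] := hf z zd.
exists (fun w => if w == z then d else (f w - f z) / (w - z)); split; last first.
  move=> w; case: ifPn => [/eqP ->|wz]; first by rewrite subrr mulr0 addr0.
  by rewrite divfK ?subr_eq0// addrC subrK.
apply/ccont_atP => e e0.
move/cvgrPdist_lt: hd => /(_ e%:C%C); rewrite -[0]/(0%:C%C) ltcR => /(_ e0).
rewrite /dnbhs /within/= => /nbhs_ncP[del del0 hdel].
exists del => // w wz; rewrite eqxx; case: ifPn => [_|wz0]; first by rewrite subrr nc0.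
have := hdel (w - z); rewrite subr0 subr_eq0 => /(_ wz wz0).
rewrite normE ltcR ncC; congr (nc (_ - _) < _).
by rewrite /GRing.scale/= mulr1 subrK mulrC.
Qed.

Lemma hol_ccont f (u : R -> C) : hol f -> ccont u -> (forall t, nc (u t) < 1) ->
  ccont (fun t => f (u t)).
Proof.
by move=> hf cu u1; apply: ccont_comp => // t; exact/chol_continuous/hf.
Qed.

Lemma nc_circle (r t : R) : 0 <= r -> nc (r%:C%C * expi t) = r.
Proof. by move=> r0; rewrite ncM nc_expi mulr1 nc_posreal. Qed.

Lemma hol_ccont_circle f (r : R) : hol f -> 0 <= r -> r < 1 ->
  ccont (fun t => f (r%:C%C * expi t)).
Proof.
move=> hf r0 r1; apply: hol_ccont => //; first exact: ccont_circle.
by move=> t; rewrite nc_circle.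
Qed.

Lemma expi_lip (s t : R) : nc (expi s - expi t) <= 2 * `|s - t|.
Proof.
wlog st : s t / t <= s.
  move=> H; have [/H//|/ltW/H] := leP t s.
  by rewrite ncC distrC.
rewrite -cint_expi// ger0_norm ?subr_ge0// -[2]mulr1; apply: cint_bound => //.
  by apply: ccontM; [exact: ccont_cst|exact: ccont_expi].
by move=> x _; rewrite ncM nc_expi mulr1 /= expr0n/= add0r expr1n sqrtr1.
Qed.

Lemma expi_2pi : expi (2 * pi) = expi 0 :> C.
Proof. by rewrite /expi mulr_natl cos2pi sin2pi cos0 sin0. Qed.

(** * Deformation of a circle onto an interior point *)

Section CauchyFormula.
Variables (f : C -> C) (r : R) (z : C).
Hypotheses (hf : hol f) (r1 : r < 1) (zr : nc z < r).

Let r0 : 0 < r. Proof. exact: le_lt_trans (nc_ge0 _) zr. Qed.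
Let zeta t : C := r%:C%C * expi t.
Let m t : C := zeta t - z.
Let k t : C := 'i%C * zeta t / m t.
(** Contraction of the circle onto [z]. Along it the form [f(w) dw / (w - z)] pulls back to
    [f (sig s t) (ds / s + k t dt)], because the derivative of [zeta] is ['i * zeta]. *)
Let sig (s : R) t : C := z + s%:C%C * m t.

Let nczeta t : nc (zeta t) = r. Proof. exact/nc_circle/ltW. Qed.
Let ncm t : r - nc z <= nc (m t).
Proof. by rewrite -(nczeta t) ncB_ge. Qed.
Let m0 t : m t != 0.
Proof. by rewrite -nc_gt0 (lt_le_trans _ (ncm t))// subr_gt0. Qed.
Let ncm2 t : nc (m t) <= 2.
Proof. by rewrite (le_trans (ncB _ _))// nczeta; move: r1 zr; lra. Qed.
Let cm : ccont m.
Proof. by apply: ccontB; [exact: ccont_circle|exact: ccont_cst]. Qed.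
Let ck : ccont k.
Proof.
apply: ccontM; last exact: ccontV.
by apply: ccontM; [exact: ccont_cst|exact: ccont_circle].
Qed.
Let K := (r - nc z)^-1.
Let K0 : 0 < K. Proof. by rewrite invr_gt0 subr_gt0. Qed.
Let nck t : nc (k t) <= K.
Proof.
rewrite /k ncM ncV (ncM 'i%C) nczeta.
have -> : nc 'i%C = 1 by rewrite /= expr0n/= add0r expr1n sqrtr1.
rewrite mul1r (@le_trans _ _ (nc (m t))^-1)//.
  by rewrite ler_piMl ?invr_ge0 ?nc_ge0// ltW.
by rewrite lef_pV2 ?posrE ?subr_gt0// nc_gt0.
Qed.
Let ncsig s t : 0 <= s <= 1 -> nc (sig s t) < 1.
Proof.
move=> /andP[s0 s1]; have -> : sig s t = (1 - s)%:C%C * z + s%:C%C * zeta t.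
  by rewrite /sig /m rmorphB rmorph1; ring.
apply: (le_lt_trans (ncD _ _)); rewrite (ncM _ z) (ncM _ (zeta t)) nczeta !nc_posreal ?subr_ge0//.
by move: (nc_ge0 z) r1 zr; nra.
Qed.

Section Rectangle.
Variable eps : R.
Hypotheses (eps0 : 0 < eps) (eps1 : eps <= 1).

(** Clamping [s] to [[eps, 1]] makes the integrands continuous on the whole line, as [ccont]
    demands, and keeps [1 / s] bounded. *)
Let cl (s : R) := Num.max eps (Num.min 1 s).
Let ccl : continuous cl.
Proof.
have -> : cl = (fun=> eps) \max ((fun=> 1) \min (fun s => s)) by [].
by move=> s; apply: continuous_max; [exact: cvg_cst|apply: continuous_min;
  [exact: cvg_cst|exact: cvg_id]].
Qed.
Let clE s : eps <= s -> s <= 1 -> cl s = s.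
Proof. by move=> h1 h2; rewrite /cl (min_idPr h2) (max_idPr h1). Qed.
Let cl_ge s : eps <= cl s. Proof. by rewrite /cl le_max lexx. Qed.
Let cl_le s : cl s <= 1. Proof. by rewrite /cl ge_max eps1 ge_min lexx. Qed.
Let cl01 s : 0 <= cl s <= 1.
Proof. by rewrite cl_le andbT (le_trans _ (cl_ge s))// ltW. Qed.

Let cfs (t : R) : ccont (fun s => f (sig (cl s) t)).
Proof.
apply: hol_ccont => // [|s]; last exact: ncsig.
apply: ccontD; first exact: ccont_cst.
by apply: ccontM; [exact: ccont_real|exact: ccont_cst].
Qed.
Let cft (s : R) : ccont (fun t => f (sig (cl s) t)).
Proof.
apply: hol_ccont => // [|t]; last exact: ncsig.
apply: ccontD; first exact: ccont_cst.
by apply: ccontM; [exact: ccont_cst|exact: cm].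
Qed.
Let ccli : ccont (fun s => (cl s)%:C%C^-1).
Proof.
apply: ccontV => [|t]; first exact: ccont_real.
by rewrite -nc_gt0 nc_real normr_gt0 gt_eqF// (lt_le_trans eps0).
Qed.

(** The integral of [f(w) / (w - z)] along the image under [sig] of the boundary of [[a, b] x
    [c, d]], opposite sides being combined. *)
Let J (a b c d : R) : C :=
  cint a b (fun s => (f (sig (cl s) c) - f (sig (cl s) d)) / (cl s)%:C%C) +
  cint c d (fun t => (f (sig (cl b) t) - f (sig (cl a) t)) * k t).

Let cJ1 c d : ccont (fun s => (f (sig (cl s) c) - f (sig (cl s) d)) / (cl s)%:C%C).
Proof. by apply: ccontM => //; exact: ccontB. Qed.
Let cJ2 a b : ccont (fun t => (f (sig (cl b) t) - f (sig (cl a) t)) * k t).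
Proof. by apply: ccontM => //; exact: ccontB. Qed.

Let J_additive_s a b c d n : a <= n -> n <= b -> J a b c d = J a n c d + J n b c d.
Proof.
move=> an nb; rewrite /J (cint_split an nb)// addrACA; congr (_ + _).
rewrite -cintD//; apply: cint_eq => t _; ring.
Qed.

Let J_additive_t a b c d n : c <= n -> n <= d -> J a b c d = J a b c n + J a b n d.
Proof.
move=> cn nd; rewrite /J (cint_split cn nd)// addrACA; congr (_ + _).
rewrite -cintD//; apply: cint_eq => t _; ring.
Qed.

Section AffinePart.
Variables (A B : C) (E : C -> C).
Hypothesis fE : forall w, f w = A + B * (w - z) + E w.

Let EE w : E w = f w - (A + B * (w - z)). Proof. by rewrite fE; ring. Qed.

Let cEs (t : R) : ccont (fun s => E (sig (cl s) t)).
Proof.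
under [X in ccont X]eq_fun do rewrite EE; apply: ccontB => //.
apply: ccontD; first exact: ccont_cst.
apply: ccontM; first exact: ccont_cst.
apply: ccontB; last exact: ccont_cst.
apply: ccontD; first exact: ccont_cst.
by apply: ccontM; [exact: ccont_real|exact: ccont_cst].
Qed.

Let cEt (s : R) : ccont (fun t => E (sig (cl s) t)).
Proof.
under [X in ccont X]eq_fun do rewrite EE; apply: ccontB => //.
apply: ccontD; first exact: ccont_cst.
apply: ccontM; first exact: ccont_cst.
apply: ccontB; last exact: ccont_cst.
apply: ccontD; first exact: ccont_cst.
by apply: ccontM; [exact: ccont_cst|exact: cm].
Qed.

(* The affine part of [f] at a point contributes nothing: the form is exact on it. *)
Let J_affine a b c d : eps <= a -> a <= b -> b <= 1 -> c <= d ->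
  J a b c d =
  cint a b (fun s => (E (sig (cl s) c) - E (sig (cl s) d)) / (cl s)%:C%C) +
  cint c d (fun t => (E (sig (cl b) t) - E (sig (cl a) t)) * k t).
Proof.
move=> ea ab b1 cd.
have -> : J a b c d =
   cint a b (fun s => B * (m c - m d) + (E (sig (cl s) c) - E (sig (cl s) d)) / (cl s)%:C%C) +
   cint c d (fun t => B * (b - a)%:C%C * r%:C%C * ('i%C * expi t) +
     (E (sig (cl b) t) - E (sig (cl a) t)) * k t).
  congr (_ + _); apply: cint_eq => x /andP[x1 x2].
    rewrite 2!(fE (sig _ _)) /sig; field.
    by rewrite -nc_gt0 nc_real normr_gt0 gt_eqF// (lt_le_trans eps0).
  rewrite 2!(fE (sig _ _)) /sig !clE ?(le_trans ea ab) ?(le_trans ab b1)//.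
  rewrite /k rmorphB /zeta; field; exact: m0.
rewrite (@cintD _ a b (fun=> _)); [|exact: ccont_cst|by apply: ccontM => //; exact: ccontB].
rewrite (@cintD _ c d (fun t => _ * _)); last 2 first.
- apply: ccontM; first exact: ccont_cst.
  by apply: ccontM; [exact: ccont_cst|exact: ccont_expi].
- by apply: ccontM => //; exact: ccontB.
rewrite cint_cst// cintZ; last by apply: ccontM; [exact: ccont_cst|exact: ccont_expi].
rewrite cint_expi// /m /zeta; ring.
Qed.

Lemma J_bound a b c d (x : R) : eps <= a -> a <= b -> b <= 1 -> c <= d ->
  (forall s t, a <= s <= b -> c <= t <= d -> nc (E (sig s t)) <= x) ->
  nc (J a b c d) <= 4 * x * (eps^-1 * (b - a) + K * (d - c)).
Proof.
move=> ea ab b1 cd hx.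
have x0 : 0 <= x by apply: le_trans (nc_ge0 _) (hx a c _ _); rewrite !lexx ?ab ?cd.
rewrite J_affine//; apply: (le_trans (ncD _ _)); rewrite mulrDr; apply: lerD.
  have -> : 4 * x * (eps^-1 * (b - a)) = 2 * ((x + x) * eps^-1) * (b - a) by ring.
  apply: cint_bound => // [|s sab]; first by apply: ccontM => //; exact: ccontB.
  rewrite ncM ncV nc_real; apply: ler_pM; rewrite ?nc_ge0 ?invr_ge0//.
    have [s1 s2] := andP sab.
    rewrite (le_trans (ncB _ _))// clE ?(le_trans ea s1) ?(le_trans s2 b1)//.
    by apply: lerD; apply: hx; rewrite // ?lexx ?cd.
  have c0 : 0 < cl s by exact: lt_le_trans (cl_ge s).
  by rewrite (gtr0_norm c0) lef_pV2.
have -> : 4 * x * (K * (d - c)) = 2 * ((x + x) * K) * (d - c) by ring.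
apply: cint_bound => // [|t tcd]; first by apply: ccontM => //; exact: ccontB.
rewrite ncM; apply: ler_pM; rewrite ?nc_ge0//.
rewrite (le_trans (ncB _ _))// !clE ?(le_trans ea ab) ?(le_trans ab b1)//.
by apply: lerD; apply: hx; rewrite // ?lexx ?ab.
Qed.

End AffinePart.

Let J_eq0 : J eps 1 0 (2 * pi) = 0.
Proof.
apply: (rectangle_bisection (J := J)) => //.
- by rewrite mulr_ge0// pi_ge0.
- by move=> a b c d n _ an nb _ _ _ _; exact: J_additive_s.
- by move=> a b c d n _ _ _ _ cn nd _; exact: J_additive_t.
move=> p q /andP[p0 p1] _ e e0.
pose P := sig p q.
have [Q [cQ hQ]] : chol f P by apply: hf; apply: ncsig; rewrite p1 andbT (le_trans _ p0)// ltW.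
(* Here 32 is 4 from [J_bound], times 4 from [nc (sig s t - P) <= 4 * rho], times 2 from the side
   lengths [2 * rho]. The remainder [E] is of size [e' * rho] and the perimeter of size [rho], which
   gives the [rho ^+ 2] that bisection asks for. *)
pose e' := e / (32 * (eps^-1 + K)).
have eK0 : 0 < eps^-1 + K by rewrite addr_gt0// invr_gt0.
have e'0 : 0 < e' by rewrite divr_gt0// mulr_gt0.
have [del del0 hdel] := (ccont_atP _ _).1 cQ e' e'0.
exists (del / 4); first by rewrite divr_gt0.
move=> a b c d rho ea ab b1 c0 cd d1 rho0 rhod ha hb hc hd.
pose E w := (Q w - Q P) * (w - P).
have fE w : f w = (f P + Q P * (z - P)) + Q P * (w - z) + E w by rewrite hQ /E; ring.
have sigP s t : a <= s <= b -> c <= t <= d -> nc (E (sig s t)) <= e' * (4 * rho).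
  move=> /andP[s1 s2] /andP[t1 t2].
  have sp : `|s - p| <= rho.
    by move: ha hb; rewrite !ler_norml => /andP[? ?] /andP[? ?]; apply/andP; split; lra.
  have tq : `|t - q| <= rho.
    by move: hc hd; rewrite !ler_norml => /andP[? ?] /andP[? ?]; apply/andP; split; lra.
  have h : nc (sig s t - P) <= 4 * rho.
    have -> : sig s t - P = (s - p)%:C%C * m t + (p * r)%:C%C * (expi t - expi q).
      by rewrite /P /sig /m /zeta rmorphB rmorphM; ring.
    apply: (le_trans (ncD _ _)); rewrite !ncM !nc_real.
    have p00 : 0 < p by exact: lt_le_trans p0.
    have -> : `|p * r| = p * r by rewrite ger0_norm// mulr_ge0 // ltW.
    have pr1 : p * r <= 1 by rewrite mulr_ile1// ltW.
    have -> : 4 * rho = rho * 2 + 1 * (2 * rho) by ring.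
    apply: lerD; first by apply: ler_pM; rewrite ?nc_ge0.
    apply: ler_pM; [by rewrite mulr_ge0// ltW|exact: nc_ge0|exact: pr1|].
    by apply: (le_trans (expi_lip _ _)); rewrite ler_pM2l.
  rewrite /E ncM ler_pM ?nc_ge0// ltW//; apply: hdel.
  by apply: (le_lt_trans h); rewrite mulrC -ltr_pdivlMr.
apply: (le_trans (J_bound fE ea ab b1 cd sigP)).
have ba : b - a <= 2 * rho.
  move: ha hb; rewrite !ler_norml => /andP[h1 _] /andP[_ h2].
  by move: h1 h2; lra.
have dc : d - c <= 2 * rho.
  move: hc hd; rewrite !ler_norml => /andP[h1 _] /andP[_ h2].
  by move: h1 h2; lra.
have -> : e * rho ^+ 2 = 4 * (e' * (4 * rho)) * (eps^-1 * (2 * rho) + K * (2 * rho)).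
  rewrite -mulrDl /e'; move: (eps^-1 + K) eK0 => L L0; field.
  by rewrite gt_eqF.
apply: ler_wpM2l; first by rewrite mulr_ge0// (mulr_ge0 (ltW e'0))// mulr_ge0.
by apply: lerD; apply: ler_wpM2l => //; rewrite ltW// invr_gt0.
Qed.

Lemma circle_contract :
  cint 0 (2 * pi) (fun t => f (zeta t) * k t) =
  cint 0 (2 * pi) (fun t => f (sig eps t) * k t).
Proof.
apply/eqP; rewrite -subr_eq0 -cintB; last 2 first.
- by apply: ccontM => //; apply: hol_ccont_circle => //; exact: ltW.
- by apply: ccontM => //; have := @cft eps; rewrite clE.
rewrite -J_eq0 /J.
(* The sides [t = 0] and [t = 2 * pi] have the same image by periodicity and cancel; only the two
   circles remain. *)
have -> : cint eps 1 (fun s => (f (sig (cl s) 0) - f (sig (cl s) (2 * pi))) / (cl s)%:C%C) = 0.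
  rewrite (@cint_eq _ _ _ _ (fun=> 0)); first by rewrite cint_cst// mul0r.
  by move=> s _; rewrite /sig /m /zeta expi_2pi subrr mul0r.
rewrite add0r; apply/eqP/cint_eq => t _; rewrite !clE// -mulrBl.
by congr ((f _ - _) * _); rewrite /sig /m rmorph1; ring.
Qed.

End Rectangle.

(** As the inner circle shrinks to [z], continuity of [f] at [z] replaces [f] by [f z]. The integral
    of the kernel itself is left open here, which avoids winding numbers; [cmean_ker] finds it from
    the mean value property. *)
Lemma cauchy_kernel :
  cint 0 (2 * pi) (fun t => f (r%:C%C * expi t) * ('i%C * (r%:C%C * expi t) / (r%:C%C * expi t - z))) =
  f z * cint 0 (2 * pi) (fun t => 'i%C * (r%:C%C * expi t) / (r%:C%C * expi t - z)).
Proof.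
rewrite -/(cint 0 (2 * pi) (fun t => f (zeta t) * k t)) -/(cint 0 (2 * pi) k).
apply/eqP; rewrite -subr_eq0 -nc_eq0 eq_le nc_ge0 andbT; apply/ler_addgt0Pr => e e0.
rewrite add0r.
have pi0 : 0 < 2 * pi :> R by rewrite mulr_gt0// pi_gt0.
pose e' := e / (2 * K * (2 * pi)).
have e'0 : 0 < e' by rewrite divr_gt0// !mulr_gt0// pi_gt0.
have z1 : nc z < 1 by exact: lt_trans zr r1.
have [d d0 hd] := (ccont_atP _ _).1 (chol_continuous (hf z1)) e' e'0.
pose eps := Num.min 1 (d / 4).
have eps0 : 0 < eps by rewrite lt_min ltr01 divr_gt0.
have eps1 : eps <= 1 by rewrite ge_min lexx.
rewrite (circle_contract eps0 eps1) -cintZ// -cintB; last 2 first.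
- apply: ccontM => //; apply: hol_ccont => // [|t]; last by apply: ncsig; rewrite eps1 ltW.
  apply: ccontD; first exact: ccont_cst.
  by apply: ccontM; [exact: ccont_cst|exact: cm].
- by apply: ccontM => //; exact: ccont_cst.
have -> : e = 2 * (e' * K) * (2 * pi - 0).
  have -> : 2 * (e' * K) * (2 * pi - 0) = e' * (2 * K * (2 * pi)) by ring.
  by rewrite /e' divfK// gt_eqF// !mulr_gt0// pi_gt0.
apply: cint_bound => //; first exact: ltW.
  apply: ccontB; apply: ccontM => //; last exact: ccont_cst.
  apply: hol_ccont => // [|t]; last by apply: ncsig; rewrite eps1 ltW.
  apply: ccontD; first exact: ccont_cst.
  by apply: ccontM; [exact: ccont_cst|exact: cm].
move=> t _; rewrite -mulrBl ncM ler_pM ?nc_ge0// ltW//; apply: hd.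
rewrite /sig addrAC subrr add0r ncM nc_posreal ?(ltW eps0)//.
have e4 : eps <= d / 4 by rewrite ge_min lexx orbT.
apply: (@le_lt_trans _ _ (d / 4 * 2)).
  by apply: ler_pM; rewrite ?nc_ge0 ?(ltW eps0).
by move: d0; lra.
Qed.

End CauchyFormula.

Definition cmean (u : R -> C) : C := (2 * pi)^-1%:C%C * cint 0 (2 * pi) u.

Lemma cmean_cst k : cmean (fun=> k) = k.
Proof.
have pi0 : (2 * pi : R) != 0 by rewrite mulf_neq0// gt_eqF// pi_gt0.
rewrite /cmean cint_cst; last by rewrite mulr_ge0// pi_ge0.
by rewrite subr0 mulrCA -rmorphM mulVf// rmorph1 mulr1.
Qed.

Lemma cmean_eq u v : (forall t, u t = v t) -> cmean u = cmean v.
Proof. by move=> uv; rewrite /cmean (@cint_eq _ _ _ u v). Qed.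

Lemma cmeanD u v : ccont u -> ccont v -> cmean (fun t => u t + v t) = cmean u + cmean v.
Proof. by move=> cu cv; rewrite /cmean cintD// mulrDr. Qed.

Lemma cmeanB u v : ccont u -> ccont v -> cmean (fun t => u t - v t) = cmean u - cmean v.
Proof. by move=> cu cv; rewrite /cmean cintB// mulrBr. Qed.

Lemma cmeanZ k u : ccont u -> cmean (fun t => k * u t) = k * cmean u.
Proof. by move=> cu; rewrite /cmean cintZ// mulrCA. Qed.

Lemma cmeanJ u : ccont u -> cmean (fun t => (u t)^*%C) = (cmean u)^*%C.
Proof.
move=> cu; rewrite /cmean rmorphM; congr (_ * _); first exact/esym/conjc_real.
rewrite /cint /=; congr (_ +i* _)%C; first by apply: rint_eq => x _; rewrite ReJ.
rewrite -[RHS]mulN1r -rintZ; last exact: ccont_Im.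
by apply: rint_eq => x _; rewrite ImJ mulN1r.
Qed.

End Holomorphic.

(** * Cauchy's formula *)

Section CauchyConsequences.
Variable R : realType.
Local Notation C := R[i].
Local Notation nc := (@ComplexField.Normc.normc R).
Local Notation Re := (@complex.Re R).
Implicit Types (f g : C -> C) (z w : C) (r : R).

Definition circ (r t : R) : C := r%:C%C * expi t.

Lemma nc_circ r t : 0 <= r -> nc (circ r t) = r.
Proof. exact: nc_circle. Qed.

Lemma ccont_circ r : ccont (circ r).
Proof. exact: ccont_circle. Qed.

Lemma ccont_hol f r : hol f -> 0 <= r -> r < 1 -> ccont (fun t => f (circ r t)).
Proof. exact: hol_ccont_circle. Qed.

Definition rmean (u : R -> R) : R := (2 * pi)^-1 * rint 0 (2 * pi) u.

Let pi20 : 0 < 2 * pi :> R. Proof. by rewrite mulr_gt0// pi_gt0. Qed.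

Lemma rmean_cst k : rmean (fun=> k) = k.
Proof. by rewrite /rmean rint_cst ?(ltW pi20)// subr0 mulrCA mulVf ?mulr1// gt_eqF. Qed.

Lemma rmean_eq (u v : R -> R) : (forall t, u t = v t) -> rmean u = rmean v.
Proof. by move=> uv; rewrite /rmean (@rint_eq _ _ _ u v). Qed.

Lemma rmeanD (u v : R -> R) : continuous u -> continuous v ->
  rmean (fun t => u t + v t) = rmean u + rmean v.
Proof. by move=> cu cv; rewrite /rmean rintD// mulrDr. Qed.

Lemma rmeanB (u v : R -> R) : continuous u -> continuous v ->
  rmean (fun t => u t - v t) = rmean u - rmean v.
Proof. by move=> cu cv; rewrite /rmean rintB// mulrBr. Qed.

Lemma rmeanZ k (u : R -> R) : continuous u -> rmean (fun t => k * u t) = k * rmean u.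
Proof. by move=> cu; rewrite /rmean rintZ// mulrCA. Qed.

Lemma rmean_le (u v : R -> R) : continuous u -> continuous v ->
  (forall t, u t <= v t) -> rmean u <= rmean v.
Proof.
by move=> cu cv uv; rewrite /rmean ler_wpM2l ?invr_ge0 ?(ltW pi20)// rint_le.
Qed.

Lemma rmean_ge0 (u : R -> R) : (forall t, 0 <= u t) -> 0 <= rmean u.
Proof. by move=> u0; rewrite /rmean mulr_ge0 ?invr_ge0 ?(ltW pi20)// rint_ge0. Qed.

Lemma Re_cmean u : Re (cmean u) = rmean (fun t => Re (u t)).
Proof. by rewrite /cmean ReM /= mul0r subr0. Qed.

(** Rotating the mean onto the positive axis reduces the estimate to real integrals, without the
    factor 2 of [cint_bound]. *)
Lemma nc_cmean_le u (v : R -> R) : ccont u -> continuous v ->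
  (forall t, nc (u t) <= v t) -> nc (cmean u) <= rmean v.
Proof.
move=> cu cv uv; have [m0|m0] := eqVneq (cmean u) 0.
  by rewrite m0 nc0 rmean_ge0// => t; rewrite (le_trans (nc_ge0 _) (uv t)).
have n0 : 0 < nc (cmean u) by rewrite nc_gt0.
pose c := (nc (cmean u))^-1%:C%C * (cmean u)^*%C.
have nc1 : nc c = 1.
  by rewrite /c ncM ncJ nc_posreal ?invr_ge0 ?nc_ge0// mulVf// gt_eqF.
have -> : nc (cmean u) = Re (c * cmean u).
  rewrite /c -mulrA (mulrC (_^*%C)) -nc_sqrC -rmorphM/=.
  by rewrite expr2 mulrA mulVf ?mul1r// gt_eqF.
rewrite -cmeanZ// Re_cmean; apply: rmean_le => //.
  by apply: ccont_Re; apply: ccontM => //; exact: ccont_cst.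
by move=> t; apply: (le_trans (Re_le _)); rewrite ncM nc1 mul1r.
Qed.

Lemma nc_cmean_cst u (k : R) : ccont u -> (forall t, nc (u t) <= k) -> nc (cmean u) <= k.
Proof.
move=> cu uk; rewrite -[leRHS]rmean_cst; apply: nc_cmean_le => // t; exact: cvg_cst.
Qed.

Lemma mean_value f r : hol f -> 0 <= r -> r < 1 -> cmean (fun t => f (circ r t)) = f 0.
Proof.
move=> hf; rewrite le_eqVlt => /predU1P[<- _|r0 r1].
  rewrite -[RHS](cmean_cst (f 0)); apply: cmean_eq => t.
  by rewrite /circ rmorph0 mul0r.
have := @cauchy_kernel R f r 0 hf r1; rewrite nc0 => /(_ r0).
have kE t : 'i%C * (r%:C%C * expi t) / (r%:C%C * expi t - 0) = 'i%C :> C.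
  rewrite subr0 mulfK// -nc_gt0 ncM nc_expi mulr1 nc_real normr_gt0 gt_eqF//.
rewrite (@cint_eq _ _ _ _ (fun t => 'i%C * f (circ r t))); last first.
  by move=> t _; rewrite kE mulrC.
rewrite cintZ; last by apply: ccont_hol => //; exact: ltW.
rewrite (@cint_eq _ _ _ (fun t => 'i%C * _ / _) (fun=> 'i%C)); last by move=> t _; exact: kE.
rewrite cint_cst ?(ltW pi20)// subr0 => h.
have i0 : 'i%C != 0 :> C by rewrite -nc_gt0 /= expr0n/= add0r expr1n sqrtr1.
have {}h : cint 0 (2 * pi) (fun t => f (circ r t)) = f 0 * (2 * pi)%:C%C.
  by apply: (mulfI i0); rewrite h mulrCA.
by rewrite /cmean h mulrCA -rmorphM mulVf ?gt_eqF// rmorph1 mulr1.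
Qed.

Lemma circ_neq r t z : nc z < r -> circ r t - z != 0.
Proof.
move=> zr; have r0 : 0 <= r by exact: le_trans (nc_ge0 _) (ltW zr).
by rewrite -nc_gt0 (lt_le_trans _ (ncB_ge _ _))// nc_circ// subr_gt0.
Qed.

Lemma circ_nz r t : 0 < r -> circ r t != 0.
Proof. by move=> r0; rewrite -nc_gt0 nc_circ// ltW. Qed.

Lemma circJ r t : (circ r t)^*%C * circ r t = (r ^+ 2)%:C%C.
Proof.
rewrite mulrC -nc_sqrC; congr (_%:C)%C.
by rewrite /circ ncM nc_expi mulr1 nc_real real_normK// num_real.
Qed.

Lemma ccont_ker r z : nc z < r -> ccont (fun t => circ r t / (circ r t - z)).
Proof.
move=> zr; apply: ccontM; first exact: ccont_circ.
apply: ccontV => [|t]; last exact: circ_neq.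
by apply: ccontB; [exact: ccont_circ|exact: ccont_cst].
Qed.

(** On the circle the conjugate of the kernel is the restriction of [1 / (1 - conj z * w / r^2)],
    which is holomorphic in [w]; its mean is its value 1 at the centre. *)
Lemma cmean_ker r z : nc z < r -> cmean (fun t => circ r t / (circ r t - z)) = 1.
Proof.
move=> zr; have r0 : 0 < r by exact: le_lt_trans (nc_ge0 _) zr.
apply: (inv_inj (@conjcK R)); rewrite rmorph1 -cmeanJ; last exact: ccont_ker.
(* Any [x] strictly between [nc z / r] and 1 serves: [u * circ x t] does not depend on [x], while
   [nc u < 1] keeps [1 - u * w] free of zeros in the disk. *)
pose x := (1 + nc z / r) / 2.
have zr1 : nc z / r < 1 by rewrite ltr_pdivrMr// mul1r.
have zr0 : 0 <= nc z / r by rewrite divr_ge0 ?nc_ge0// ltW.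
have x0 : 0 < x by rewrite /x; lra.
have x1 : x < 1 by rewrite /x; lra.
have zx : nc z / r < x by rewrite /x; lra.
pose u := z^*%C * (r * x)^-1%:C%C.
have u1 : nc u < 1.
  have rx0 : 0 < r * x by exact: mulr_gt0.
  rewrite /u ncM ncJ nc_posreal; last by rewrite invr_ge0 ltW.
  by rewrite ltr_pdivrMr// mul1r mulrC -ltr_pdivrMr.
have hH : hol (fun w => (1 - u * w)^-1).
  apply: holV => [|w w1].
    apply: holB; first exact: hol_cst.
    by apply: holM; [exact: hol_cst|exact: hol_id].
  rewrite subr_eq0; apply/negP => /eqP/(congr1 nc); rewrite nc1 ncM => h.
  by have := nc_ge0 u; have := nc_ge0 w; nra.
have := mean_value hH (ltW x0) x1; rewrite mulr0 subr0 invr1 => <-.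
apply: cmean_eq => t.
have cz : circ r t != 0 by exact: circ_nz.
have czJ : (circ r t)^*%C != 0 by rewrite -nc_gt0 ncJ nc_gt0.
rewrite rmorphM fmorphV rmorphB -invf_div; congr (_^-1).
rewrite mulrBl divff//; congr (1 - _).
have -> : ((circ r t)^*%C)^-1 = circ r t * (r ^+ 2)^-1%:C%C.
  apply: (mulIf czJ); rewrite mulVf// mulrAC (mulrC (circ r t)) circJ -rmorphM.
  by rewrite mulfV ?rmorph1// expf_neq0// gt_eqF.
have -> : circ r t * (r ^+ 2)^-1%:C%C = r^-1%:C%C * expi t.
  rewrite /circ mulrAC -rmorphM; congr (_%:C%C * _).
  by field; rewrite gt_eqF.
have -> : u * circ x t = z^*%C * ((r * x)^-1 * x)%:C%C * expi t.
  by rewrite /u /circ -!mulrA; congr (_ * _); rewrite mulrA -rmorphM.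
have -> : (r * x)^-1 * x = r^-1 by field; rewrite !gt_eqF.
by rewrite mulrA.
Qed.

Lemma cauchy_formula f r z : hol f -> r < 1 -> nc z < r ->
  f z = cmean (fun t => f (circ r t) * (circ r t / (circ r t - z))).
Proof.
move=> hf r1 zr; have r0 : 0 <= r by exact: le_trans (nc_ge0 _) (ltW zr).
have := cauchy_kernel hf r1 zr.
rewrite (@cint_eq _ _ _ _ (fun t => 'i%C * (f (circ r t) * (circ r t / (circ r t - z))))); last first.
  by move=> t _; rewrite -/(circ r t); ring.
rewrite (@cint_eq _ _ _ (fun t => 'i%C * _ / _) (fun t => 'i%C * (circ r t / (circ r t - z)))); last first.
  by move=> t _; rewrite -/(circ r t); ring.
have c1 := ccont_ker zr; have c2 := ccont_hol hf r0 r1.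
rewrite !cintZ//; last exact: ccontM.
have i0 : 'i%C != 0 :> C by rewrite -nc_gt0 /= expr0n/= add0r expr1n sqrtr1.
rewrite mulrCA => /(mulfI i0) h; rewrite /cmean h mulrCA.
by have := cmean_ker zr; rewrite /cmean => ->; rewrite mulr1.
Qed.

(** The difference quotient of the Cauchy kernel is explicit and continuous. Only continuity of [u]
    enters, so this serves both for removable singularities and for locally uniform limits. *)
Lemma cauchy_transform_chol f (u : R -> C) r z : ccont u -> nc z < r ->
  (forall w, nc w < r -> f w = cmean (fun t => u t * (circ r t / (circ r t - w)))) ->
  chol f z.
Proof.
move=> cu zr fE; have r0 : 0 < r by exact: le_lt_trans (nc_ge0 _) zr.
pose k w t := u t * circ r t / (circ r t - w) / (circ r t - z).
have cinv w : nc w < r -> ccont (fun t => (circ r t - w)^-1).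
  move=> wr; apply: ccontV => [|t]; last exact: circ_neq.
  by apply: ccontB; [exact: ccont_circ|exact: ccont_cst].
have cuc : ccont (fun t => u t * circ r t) by apply: ccontM => //; exact: ccont_circ.
have ck w : nc w < r -> ccont (k w).
  by move=> wr; apply: ccontM; [apply: ccontM|]; do ?exact: cinv.
have d0 : 0 < (r - nc z) / 2 by rewrite divr_gt0// subr_gt0.
apply: (@chol_local _ _ (fun w => cmean (k w)) z _ d0); last first.
  move=> w wz; have wr : nc w < r.
    by have := ncD (w - z) z; rewrite subrK; lra.
  rewrite !fE// mulrC -cmeanZ; last exact: ck.
  rewrite -cmeanD; last 2 first.
  - by apply: ccontM => //; exact: ccont_ker.
  - by apply: ccontM; [exact: ccont_cst|exact: ck].
  apply: cmean_eq => t; rewrite /k; field.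
  by rewrite !circ_neq.
apply/ccont_atP => e e0.
pose v t := nc (u t * circ r t) * ((r - nc z) / 2)^-1 ^+ 3.
have cv : continuous v.
  apply: real_continuousM; first exact: ccont_nc.
  by move=> t; exact: cvg_cst.
have v0 : 0 <= rmean v.
  by apply: rmean_ge0 => t; rewrite mulr_ge0 ?nc_ge0// exprn_ge0// invr_ge0 ltW.
exists (Num.min ((r - nc z) / 2) (e / (rmean v + 1))).
  by rewrite lt_min d0 divr_gt0//; lra.
move=> w; rewrite lt_min => /andP[wz we].
have wr : nc w < r by have := ncD (w - z) z; rewrite subrK; lra.
rewrite -cmeanB; [|exact: ck|exact: ck].
apply: (@le_lt_trans _ _ (nc (w - z) * rmean v)); last first.
  have : nc (w - z) * (rmean v + 1) < e by rewrite -ltr_pdivlMr//; lra.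
  by have := nc_ge0 (w - z); nra.
rewrite -rmeanZ//; apply: nc_cmean_le.
- by apply: ccontB; exact: ck.
- by apply: real_continuousM => // t; exact: cvg_cst.
move=> t.
have -> : k w t - k z t = (w - z) * (u t * circ r t * ((circ r t - w)^-1 * ((circ r t - z)^-1 * (circ r t - z)^-1))).
  by rewrite /k; field; rewrite !circ_neq.
rewrite ncM ler_wpM2l ?nc_ge0// /v ncM ler_wpM2l ?nc_ge0//.
have hz : nc (circ r t - z)^-1 <= ((r - nc z) / 2)^-1.
  rewrite ncV lef_pV2 ?posrE ?nc_gt0 ?circ_neq//.
  by have := ncB_ge (circ r t) z; rewrite nc_circ ?(ltW r0)//; lra.
have hw : nc (circ r t - w)^-1 <= ((r - nc z) / 2)^-1.
  rewrite ncV lef_pV2 ?posrE ?nc_gt0 ?circ_neq//.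
  have := ncB_ge (circ r t) w; rewrite nc_circ ?(ltW r0)//.
  by have := ncD (w - z) z; rewrite subrK; lra.
rewrite !exprS expr0 mulr1 ncM (ncM _^-1).
by apply: ler_pM; rewrite ?mulr_ge0 ?nc_ge0//; apply: ler_pM; rewrite ?nc_ge0.
Qed.

(** Removability of the singularity of [(f z - f 0) / z]: off the origin the quotient is a Cauchy
    transform by Cauchy's formula, and at the origin both sides are continuous. *)
Lemma hol_divX f : hol f -> exists2 q, hol q & forall z, nc z < 1 -> f z = f 0 + z * q z.
Proof.
move=> hf; have := hf 0; rewrite nc0 => /(_ ltr01)[q [cq hq]].
exists q => [z z1|z _]; last by rewrite hq subr0 mulrC.
pose r := (1 + nc z) / 2.
have r0 : 0 < r by rewrite /r; have := nc_ge0 z; lra.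
have r1 : r < 1 by rewrite /r; lra.
have zr : nc z < r by rewrite /r; lra.
have cinv : ccont (fun t => (circ r t)^-1).
  by apply: ccontV => [|t]; [exact: ccont_circ|exact: circ_nz].
have cf := ccont_hol hf (ltW r0) r1.
apply: (@cauchy_transform_chol _ (fun t => f (circ r t) / circ r t) r) => //.
  exact: ccontM.
suff wn0 w : w != 0 -> nc w < r ->
    q w = cmean (fun t => f (circ r t) / circ r t * (circ r t / (circ r t - w))).
  move=> w wr; have [w0|w0] := eqVneq w 0; last exact: wn0.
  rewrite w0; apply/eqP; rewrite -subr_eq0 -nc_eq0 eq_le nc_ge0 andbT.
  apply/ler_addgt0Pr => e e0; rewrite add0r.
  pose T w := cmean (fun t => f (circ r t) / circ r t * (circ r t / (circ r t - w))).
  have cT : ccont_at T 0.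
    apply: chol_continuous; apply: (@cauchy_transform_chol _ (fun t => f (circ r t) / circ r t) r) => //.
      exact: ccontM.
    by rewrite nc0.
  have e20 : 0 < e / 2 by rewrite divr_gt0.
  have [d1 d10 h1] := (ccont_atP _ _).1 cT _ e20.
  have [d2 d20 h2] := (ccont_atP _ _).1 cq _ e20.
  pose d := Num.min (r / 2) (Num.min (d1 / 2) (d2 / 2)).
  have d0 : 0 < d.
    rewrite /d !lt_min; apply/and3P; split; exact: divr_gt0.
  have dr : nc d%:C%C < r.
    have : d <= r / 2 by rewrite /d ge_min lexx.
    by rewrite nc_posreal ?(ltW d0)//; lra.
  have dd1 : nc (d%:C%C - 0) < d1.
    have : d <= d1 / 2 by rewrite /d !ge_min lexx orbT.
    by rewrite subr0 nc_posreal ?(ltW d0)//; lra.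
  have dd2 : nc (d%:C%C - 0) < d2.
    have : d <= d2 / 2 by rewrite /d !ge_min lexx !orbT.
    by rewrite subr0 nc_posreal ?(ltW d0)//; lra.
  have dn0 : d%:C%C != 0 :> C by rewrite -nc_gt0 nc_posreal ?(ltW d0).
  have := h1 _ dd1; have := h2 _ dd2; rewrite (wn0 _ dn0 dr) -/(T _) -/(T 0).
  rewrite ncC => ? ?; rewrite -(subrKA (T d%:C%C)).
  by apply: (le_trans (ncD _ _)); lra.
move=> w0 wr.
have zero_r : nc 0 < r by rewrite nc0.
apply: (mulIf w0).
have -> : q w * w = f w - f 0 by rewrite hq subr0 addrC addKr.
rewrite (cauchy_formula hf r1 wr) (cauchy_formula hf r1 zero_r) -cmeanB; last 2 first.
- by apply: ccontM => //; exact: ccont_ker.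
- by apply: ccontM => //; exact: ccont_ker.
rewrite mulrC -cmeanZ; last first.
  by apply: ccontM; [exact: ccontM|exact: ccont_ker].
apply: cmean_eq => t; rewrite subr0; field.
by rewrite circ_neq// circ_nz.
Qed.

Definition hol_bounded f (k : R) := hol f /\ forall z, nc z < 1 -> nc (f z) <= k.

Lemma nc_ker r z t : nc z < r -> nc (circ r t / (circ r t - z)) <= r / (r - nc z).
Proof.
move=> zr; have r0 : 0 <= r by exact: le_trans (nc_ge0 _) (ltW zr).
rewrite ncM ncV nc_circ// ler_wpM2l// lef_pV2 ?posrE ?nc_gt0 ?circ_neq ?subr_gt0//.
by rewrite (le_trans _ (ncB_ge _ _))// nc_circ.
Qed.

Lemma nc_cauchy f r z (k : R) : hol f -> r < 1 -> nc z < r ->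
  (forall t, nc (f (circ r t)) <= k) -> nc (f z) <= k * (r / (r - nc z)).
Proof.
move=> hf r1 zr fk; have r0 : 0 <= r by exact: le_trans (nc_ge0 _) (ltW zr).
rewrite (cauchy_formula hf r1 zr); apply: nc_cmean_cst.
  by apply: ccontM; [exact: ccont_hol|exact: ccont_ker].
by move=> t; rewrite ncM; apply: ler_pM; rewrite ?nc_ge0//; exact: nc_ker.
Qed.

(* Applied to the powers of f, the Cauchy bound loses only a factor K^(1/n). *)
Lemma max_principle f r z (k : R) : hol f -> r < 1 -> nc z < r ->
  (forall t, nc (f (circ r t)) <= k) -> nc (f z) <= k.
Proof.
move=> hf r1 zr fk; pose K := r / (r - nc z).
have k0 : 0 <= k by exact: le_trans (nc_ge0 _) (fk 0).
have hn n : nc (f z) ^+ n <= k ^+ n * K.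
  rewrite -ncX; apply: (@nc_cauchy (fun w => f w ^+ n)) => //; first exact: holX.
  by move=> t; rewrite ncX lerXn2r ?nnegrE ?nc_ge0.
rewrite leNgt; apply/negP => kf.
have f0 : 0 < nc (f z) by exact: le_lt_trans kf.
pose x := k / nc (f z).
have x0 : 0 <= x by rewrite divr_ge0// ltW.
have x1 : x < 1 by rewrite ltr_pdivrMr// mul1r.
have h n : 1 <= x ^+ n * K.
  rewrite expr_div_n mulrAC ler_pdivlMr ?exprn_gt0// mul1r; exact: hn.
have : (fun n => x ^+ n * K) @ \oo --> (0 : R).
  rewrite -[X in _ --> X](mul0r K); apply: cvgMl; apply: cvg_expr.
  by rewrite ger0_norm.
move=> /cvgrPdist_lt/(_ 1 ltr01)[N _ /(_ N (leqnn N))] /=.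
rewrite sub0r normrN ger0_norm; last exact: le_trans (h N).
by rewrite ltNge h.
Qed.

Lemma hol_local_bound f r : hol f -> 0 <= r -> r < 1 ->
  exists2 k, 0 < k & forall z, nc z <= r -> nc (f z) <= k.
Proof.
move=> hf r0 r1; pose s := (1 + r) / 2.
have s0 : 0 < s by rewrite /s; lra.
have s1 : s < 1 by rewrite /s; lra.
have rs : r < s by rewrite /s; lra.
have cf := ccont_nc (ccont_hol hf (ltW s0) s1).
exists (rmean (fun t => nc (f (circ s t)) * (s / (s - r))) + 1).
  rewrite ltr_wpDl// rmean_ge0// => t.
  by rewrite mulr_ge0 ?nc_ge0// divr_ge0 ?subr_ge0 ?ltW.
move=> z zr; have zs : nc z < s by exact: le_lt_trans rs.
rewrite -[leLHS]addr0; apply: lerD => //.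
rewrite {1}(cauchy_formula hf s1 zs); apply: nc_cmean_le.
- by apply: ccontM; [apply: ccont_hol => //; exact: ltW|exact: ccont_ker].
- by apply: real_continuousM => // t; exact: cvg_cst.
move=> t; rewrite ncM ler_wpM2l ?nc_ge0// (le_trans (nc_ker _ zs))//.
rewrite ler_wpM2l ?(ltW s0)// lef_pV2 ?posrE ?subr_gt0//.
by rewrite lerB.
Qed.

Lemma hol_locally_lipschitz f r : hol f -> 0 <= r -> r < 1 -> exists2 k, 0 < k &
  forall z w, nc z <= r -> nc w <= r -> nc (f z - f w) <= k * nc (z - w).
Proof.
move=> hf r0 r1; pose s := (1 + r) / 2.
have s0 : 0 < s by rewrite /s; lra.
have s1 : s < 1 by rewrite /s; lra.
have rs : r < s by rewrite /s; lra.
have cf := ccont_nc (ccont_hol hf (ltW s0) s1).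
pose v t := nc (f (circ s t)) * (s / (s - r) ^+ 2).
have cv : continuous v by apply: real_continuousM => // t; exact: cvg_cst.
exists (rmean v + 1).
  rewrite ltr_wpDl// rmean_ge0// => t.
  by rewrite mulr_ge0 ?nc_ge0// divr_ge0 ?exprn_ge0 ?subr_ge0 ?ltW.
move=> z w zr wr; have zs : nc z < s by exact: le_lt_trans rs.
have ws : nc w < s by exact: le_lt_trans rs.
apply: (@le_trans _ _ (nc (z - w) * rmean v)); last first.
  by have := nc_ge0 (z - w); nra.
rewrite (cauchy_formula hf s1 zs) (cauchy_formula hf s1 ws) -rmeanZ// -cmeanB; last 2 first.
- by apply: ccontM; [apply: ccont_hol => //; exact: ltW|exact: ccont_ker].
- by apply: ccontM; [apply: ccont_hol => //; exact: ltW|exact: ccont_ker].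
apply: nc_cmean_le.
- by apply: ccontB; apply: ccontM; do ?[apply: ccont_hol => //; exact: ltW|exact: ccont_ker].
- by apply: real_continuousM => // t; exact: cvg_cst.
move=> t; have -> : f (circ s t) * (circ s t / (circ s t - z)) -
    f (circ s t) * (circ s t / (circ s t - w)) =
    (z - w) * (f (circ s t) * (circ s t / (circ s t - z) * (circ s t - w)^-1)).
  by field; rewrite !circ_neq.
rewrite ncM ler_wpM2l ?nc_ge0// /v ncM ler_wpM2l ?nc_ge0//.
have -> : s / (s - r) ^+ 2 = s / (s - r) * (s - r)^-1 by rewrite expr2 invfM mulrA.
rewrite ncM; apply: ler_pM; rewrite ?nc_ge0//.
  apply: (le_trans (nc_ker _ zs)); rewrite ler_wpM2l ?(ltW s0)//.
  by rewrite lef_pV2 ?posrE ?subr_gt0// lerB.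
rewrite ncV lef_pV2 ?posrE ?nc_gt0 ?subr_gt0 ?circ_neq//.
by have := ncB_ge (circ s t) w; rewrite nc_circ ?(ltW s0)//; lra.
Qed.

(** Weierstrass's theorem: Cauchy's formula survives uniform convergence on a circle, and a Cauchy
    transform is differentiable. *)
Lemma hol_limit (F : nat -> C -> C) f : (forall n, hol (F n)) ->
  (forall r, r < 1 -> exists e : nat -> R, e @ \oo --> (0 : R) /\
    forall n z, nc z <= r -> nc (F n z - f z) <= e n) -> hol f.
Proof.
move=> hF hlim z z1; pose r := (1 + nc z) / 2.
have r0 : 0 < r by rewrite /r; have := nc_ge0 z; lra.
have r1 : r < 1 by rewrite /r; lra.
have zr : nc z < r by rewrite /r; lra.
have [e [e0 he]] := hlim r r1.
have cF n : ccont (fun t => F n (circ r t)) by apply: ccont_hol => //; exact: ltW.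
have cf : ccont (fun t => f (circ r t)).
  constructor => t; apply/continuousR_ncP => x x0.
  have x30 : 0 < x / 3 by rewrite divr_gt0.
  move/cvgrPdist_lt: e0 => /(_ _ x30)[N _ /(_ N (leqnn N))] /=.
  rewrite sub0r normrN => /(le_lt_trans (ler_norm _)) eN.
  have [/(_ t)/continuousR_ncP/(_ _ x30)[d d0 hd]] := cF N.
  exists d => // s /hd h.
  have h1 := he N (circ r t); rewrite nc_circ ?(ltW r0)// lexx in h1.
  have h2 := he N (circ r s); rewrite nc_circ ?(ltW r0)// lexx in h2.
  have -> : f (circ r s) - f (circ r t) = (F N (circ r s) - F N (circ r t)) +
    ((F N (circ r t) - f (circ r t)) - (F N (circ r s) - f (circ r s))) by ring.
  apply: (le_lt_trans (ncD _ _)).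
  have := ncB (F N (circ r t) - f (circ r t)) (F N (circ r s) - f (circ r s)).
  by have := h1 isT; have := h2 isT; lra.
apply: (cauchy_transform_chol cf zr) => w wr.
apply: (@clim_unique R (fun n => F n w)).
  by apply: (squeeze0 _ e0) => n; rewrite nc_ge0 he// ltW.
apply: (@squeeze0 _ _ (fun n => e n * (r / (r - nc w)))); last first.
  by rewrite -[X in _ --> X](mul0r (r / (r - nc w))); exact: cvgMl.
move=> n; rewrite nc_ge0/= (cauchy_formula (hF n) r1 wr) -cmeanB; last 2 first.
- by apply: ccontM => //; exact: ccont_ker.
- by apply: ccontM => //; exact: ccont_ker.
apply: nc_cmean_cst.
  by apply: ccontB; apply: ccontM => //; exact: ccont_ker.
move=> t; rewrite -mulrBl ncM; apply: ler_pM; rewrite ?nc_ge0//; last exact: nc_ker.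
by apply: he; rewrite nc_circ// ltW.
Qed.

End CauchyConsequences.

(** * Moebius maps and the Schwarz lemma *)

Section SchwarzPick.
Variable R : realType.
Local Notation C := R[i].
Local Notation nc := (@ComplexField.Normc.normc R).
Implicit Types (f g : C -> C) (a b z w : C).

Lemma cjM z w : (z * w)^*%C = z^*%C * w^*%C. Proof. exact: rmorphM. Qed.
Lemma cjD z w : (z + w)^*%C = z^*%C + w^*%C. Proof. exact: rmorphD. Qed.
Lemma cjB z w : (z - w)^*%C = z^*%C - w^*%C. Proof. exact: rmorphB. Qed.
Lemma cjN z : (- z)^*%C = - z^*%C. Proof. exact: rmorphN. Qed.
Lemma cjV z : (z^-1)^*%C = (z^*%C)^-1. Proof. exact: fmorphV. Qed.
Lemma cjX z n : (z ^+ n)^*%C = z^*%C ^+ n. Proof. exact: rmorphXn. Qed.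
Lemma cjR (x : R) : x%:C%C^*%C = x%:C%C. Proof. exact: conjc_real. Qed.
Lemma cj1 : 1^*%C = 1 :> C. Proof. exact: rmorph1. Qed.
Definition cjE := (cjM, cjD, cjB, cjN, cjV, cjX, cjR, cj1, @conjcK R).
Lemma rcD (x y : R) : (x + y)%:C%C = x%:C%C + y%:C%C. Proof. exact: rmorphD. Qed.
Lemma rcB (x y : R) : (x - y)%:C%C = x%:C%C - y%:C%C. Proof. exact: rmorphB. Qed.
Lemma rcM (x y : R) : (x * y)%:C%C = x%:C%C * y%:C%C. Proof. exact: rmorphM. Qed.
Lemma rcX (x : R) n : (x ^+ n)%:C%C = x%:C%C ^+ n. Proof. exact: rmorphXn. Qed.
Lemma rcV (x : R) : x^-1%:C%C = (x%:C%C)^-1. Proof. exact: fmorphV. Qed.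
Lemma rc1 : 1%:C%C = 1 :> C. Proof. by []. Qed.

Definition mob a z : C := (z - a) / (1 - a^*%C * z).

Lemma nc_mob_id a z :
  nc (1 - a^*%C * z) ^+ 2 - nc (z - a) ^+ 2 = (1 - nc a ^+ 2) * (1 - nc z ^+ 2).
Proof. rewrite !nc_sqr !ReImE; ring. Qed.

Lemma mob_den a z : nc a < 1 -> nc z <= 1 -> 1 - a^*%C * z != 0.
Proof.
move=> a1 z1; rewrite subr_eq0; apply/negP => /eqP/(congr1 nc); rewrite nc1 ncM ncJ => h.
by have := nc_ge0 a; have := nc_ge0 z; nra.
Qed.

Lemma nc_mob a z : nc a < 1 -> nc z <= 1 ->
  1 - nc (mob a z) ^+ 2 = (1 - nc a ^+ 2) * (1 - nc z ^+ 2) / nc (1 - a^*%C * z) ^+ 2.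
Proof.
move=> a1 z1; rewrite /mob ncM ncV -nc_mob_id exprMn; field.
by rewrite nc_eq0 mob_den.
Qed.

Lemma sqr_lt1 (x : R) : 0 <= x -> (x ^+ 2 < 1) = (x < 1).
Proof. by move=> x0; rewrite expr_lt1. Qed.

Lemma nc_mob_le1 a z : nc a < 1 -> nc z <= 1 -> nc (mob a z) <= 1.
Proof.
move=> a1 z1; rewrite -(@expr_le1 _ 2)// ?nc_ge0// -subr_ge0 nc_mob//.
rewrite divr_ge0 ?exprn_ge0 ?nc_ge0// mulr_ge0 ?subr_ge0 ?expr_le1 ?nc_ge0//.
exact: ltW.
Qed.

Lemma nc_mob_lt1 a z : nc a < 1 -> nc z < 1 -> nc (mob a z) < 1.
Proof.
move=> a1 z1; rewrite -sqr_lt1 ?nc_ge0// -subr_gt0 nc_mob ?(ltW z1)//.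
by rewrite divr_gt0 ?exprn_gt0 ?nc_gt0 ?mob_den ?(ltW z1)// mulr_gt0 ?subr_gt0 ?sqr_lt1 ?nc_ge0.
Qed.

Lemma mobC a z : nc (mob a z) = nc (mob z a).
Proof.
rewrite /mob !ncM !ncV ncC; congr (_ * _^-1).
by rewrite -ncJ rmorphB rmorph1 rmorphM /= conjcK mulrC.
Qed.

Lemma mobK a z : nc a < 1 -> nc z < 1 -> mob (- a) (mob a z) = z.
Proof.
move=> a1 z1; have dz := mob_den a1 (ltW z1).
have daa : 1 - a^*%C * a != 0 by exact: (mob_den a1 (ltW a1)).
rewrite /mob rmorphN/=; field; rewrite dz ?andbT/=.
by apply: contra_neq daa => h; rewrite -[RHS]h; ring.
Qed.

Lemma mobNK a z : nc a < 1 -> nc z < 1 -> mob a (mob (- a) z) = z.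
Proof. by move=> a1 z1; have := @mobK (- a) z; rewrite opprK ncN; apply. Qed.

Lemma mob0 a : mob a 0 = - a. Proof. by rewrite /mob mulr0 subr0 divr1 sub0r. Qed.
Lemma moba a : mob a a = 0. Proof. by rewrite /mob subrr mul0r. Qed.

Lemma chol_mob a z : 1 - a^*%C * z != 0 -> chol (mob a) z.
Proof.
move=> h; apply: cholM; first by apply: cholB; [exact: chol_id|exact: chol_cst].
apply: cholV => //; apply: cholB; first exact: chol_cst.
by apply: cholM; [exact: chol_cst|exact: chol_id].
Qed.

Lemma hol_mob a : nc a < 1 -> hol (mob a).
Proof. by move=> a1 z z1; apply: chol_mob; apply: mob_den => //; exact: ltW. Qed.

Lemma hol_mob_comp a f : nc a < 1 -> hol f -> (forall z, nc z < 1 -> nc (f z) <= 1) ->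
  hol (fun z => mob a (f z)).
Proof.
move=> a1 hf f1 z z1; apply: chol_comp; first exact: hf.
by apply: chol_mob; apply: mob_den => //; exact: f1.
Qed.

Lemma schwarz f : hol_bounded f 1 -> f 0 = 0 ->
  exists2 q, hol_bounded q 1 & forall z, nc z < 1 -> f z = z * q z.
Proof.
move=> [hf f1] f0; have [q hq fq] := hol_divX hf.
exists q => [|z z1]; last by rewrite fq// f0 add0r.
split=> // z z1; apply/ler_addgt0Pr => e e0.
(* The first entry encloses [z]; the second makes dividing by [r] cost at most the factor
   [1 + e]. *)
pose r := Num.max ((1 + nc z) / 2) (1 + e)^-1.
have e1 : 0 < 1 + e by lra.
have zr : nc z < r by rewrite /r lt_max; apply/orP; left; lra.
have r1 : r < 1 by rewrite /r gt_max invf_lt1//; apply/andP; split; lra.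
have r0 : 0 < r by exact: le_lt_trans (nc_ge0 z) zr.
apply: (max_principle hq r1 zr) => t.
have ct : nc (circ r t) < 1 by rewrite nc_circ// ltW.
have := f1 _ ct; rewrite fq// f0 add0r ncM nc_circ ?(ltW r0)//.
have : (1 + e)^-1 <= r by rewrite /r le_max lexx orbT.
rewrite -(@ler_pM2l _ (1 + e))// divff ?gt_eqF// => h1 h2.
by have := nc_ge0 (q (circ r t)); nra.
Qed.

Let schwarz_pick0 f z w : hol_bounded f 1 -> nc z < 1 -> nc w < 1 -> nc (f w) < 1 ->
  nc (f z - f w) <= nc (mob w z) * nc (1 - (f w)^*%C * f z).
Proof.
move=> [hf f1] z1 w1 fw1.
have Nw1 : nc (- w) < 1 by rewrite ncN.
pose F u := mob (f w) (f (mob (- w) u)).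
have hF : hol_bounded F 1.
  split=> [|u u1].
    apply: hol_mob_comp => //; last by move=> u u1; exact/f1/nc_mob_lt1.
    by apply: hol_comp; [exact: hol_mob|move=> u u1; exact: nc_mob_lt1|exact: hf].
  by apply: nc_mob_le1 => //; exact/f1/nc_mob_lt1.
have F0 : F 0 = 0 by rewrite /F mob0 opprK moba.
have [q [_ q1] Fq] := schwarz hF F0.
have m1 := nc_mob_lt1 w1 z1.
have := Fq _ m1; rewrite /F mobK// /mob => /(congr1 (fun x => nc x)).
have d0 := mob_den fw1 (f1 _ z1).
rewrite ncM ncV [RHS]ncM => h; have -> : nc (f z - f w) = nc (mob w z) * nc (q (mob w z)) * nc (1 - (f w)^*%C * f z).
  by rewrite -h mulfVK// nc_eq0.
by rewrite ler_wpM2r ?nc_ge0// ler_piMr ?nc_ge0// q1.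
Qed.

(** Values on the unit circle are allowed, hence the product form: [1 - conj (f w) * f z] may
    vanish. The inequality for [(1 - n) * f], whose values lie in the open disk, passes to the
    limit. *)
Lemma schwarz_pick f z w : hol_bounded f 1 -> nc z < 1 -> nc w < 1 ->
  nc (f z - f w) <= nc (mob w z) * nc (1 - (f w)^*%C * f z).
Proof.
move=> [hf f1] z1 w1; apply/ler_addgt0Pr => e e0.
pose n := Num.min (1 / 2) (e / 4).
have n0 : 0 < n by rewrite /n lt_min; apply/andP; split; [lra|exact: divr_gt0].
have n1 : n <= 1 / 2 by rewrite /n ge_min lexx.
have ne : n <= e / 4 by rewrite /n ge_min lexx orbT.
have nC : nc (1 - n)%:C%C = 1 - n by rewrite nc_posreal//; lra.
pose F u := (1 - n)%:C%C * f u.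
have F1 u : nc u < 1 -> nc (F u) < 1.
  move=> /f1 h; rewrite /F ncM nC; have := nc_ge0 (f u); nra.
have hF : hol_bounded F 1.
  by split=> [|u /F1/ltW//]; apply: holM => //; exact: hol_cst.
have := schwarz_pick0 hF z1 w1 (F1 _ w1).
rewrite /F -mulrBr ncM nC cjM cjR.
have -> : 1 - (1 - n)%:C%C * (f w)^*%C * ((1 - n)%:C%C * f z) =
   (1 - (f w)^*%C * f z) + (1 - (1 - n) ^+ 2)%:C%C * ((f w)^*%C * f z).
  by rewrite !rcB rcX rcB rc1; ring.
set D := nc (f z - f w); set N := nc (1 - _); set rh := nc (mob w z).
move=> h.
have h2 : nc ((1 - (f w)^*%C * f z) + (1 - (1 - n) ^+ 2)%:C%C * ((f w)^*%C * f z)) <= N + 2 * n.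
  apply: (le_trans (ncD _ _)); rewrite lerD2l !ncM ncJ nc_posreal; last by nra.
  have a1 := f1 _ w1; have a2 := f1 _ z1.
  have : nc (f w) * nc (f z) <= 1 by rewrite mulr_ile1 ?nc_ge0.
  have : 0 <= nc (f w) * nc (f z) by rewrite mulr_ge0 ?nc_ge0.
  by move: (nc (f w) * nc (f z)) => x; nra.
have rh1 : rh <= 1 by rewrite ltW// nc_mob_lt1.
have rh0 : 0 <= rh by exact: nc_ge0.
have N0 : 0 <= N by exact: nc_ge0.
have D2 : D <= 2.
  by rewrite (le_trans (ncB _ _))//; have := f1 _ w1; have := f1 _ z1; lra.
have h3 : (1 - n) * D <= rh * (N + 2 * n) by apply: (le_trans h); rewrite ler_wpM2l.
have h4 : rh * n <= n by rewrite ler_piMl// ltW.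
have h5 : n * D <= n * 2 by rewrite ler_pM2l.
by move: h3; rewrite mulrBl mul1r mulrDr => h3; lra.
Qed.

(** The 8 is 4, from [nc (1 - w^*%C * z) <= 2], times 2, from [1 - x^2 <= 2 * (1 - x)]. *)
Lemma nc_mob_gap w z : nc w < 1 -> nc z < 1 ->
  (1 - nc w ^+ 2) * (1 - nc z ^+ 2) / 8 <= 1 - nc (mob w z).
Proof.
move=> w1 z1; have h := nc_mob w1 (ltW z1); have r1 := nc_mob_lt1 w1 z1.
have r0 := nc_ge0 (mob w z).
have d0 : 0 < nc (1 - w^*%C * z) by rewrite nc_gt0 mob_den// ltW.
have d2 : nc (1 - w^*%C * z) <= 2.
  rewrite (le_trans (ncB _ _))// nc1 ncM ncJ.
  by have := nc_ge0 w; have := nc_ge0 z; nra.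
have A0 : 0 <= (1 - nc w ^+ 2) * (1 - nc z ^+ 2).
  by rewrite mulr_ge0// subr_ge0 expr_le1 ?nc_ge0// ltW.
have : (1 - nc w ^+ 2) * (1 - nc z ^+ 2) / 4 <= 1 - nc (mob w z) ^+ 2.
  rewrite h ler_wpM2l// lef_pV2 ?posrE ?exprn_gt0//; nra.
by nra.
Qed.

(** The estimate behind every convergence argument. With [rh] the pseudo-hyperbolic distance, [D]
    the oscillation and [B] the defect at [w], Schwarz-Pick gives [D <= rh * (B + D)], that is
    [D * (1 - rh) <= B], and [nc_mob_gap] bounds [1 - rh] from below. *)
Lemma osc f z w : hol_bounded f 1 -> nc z < 1 -> nc w < 1 ->
  nc (f z - f w) <= 8 / ((1 - nc w ^+ 2) * (1 - nc z ^+ 2)) * (1 - nc (f w) ^+ 2).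
Proof.
move=> hf z1 w1; have := schwarz_pick hf z1 w1.
have [_ f1] := hf.
have gap := nc_mob_gap w1 z1.
set D := nc (f z - f w); set rh := nc (mob w z) in gap *.
have A0 : 0 < (1 - nc w ^+ 2) * (1 - nc z ^+ 2).
  by rewrite mulr_gt0// subr_gt0 sqr_lt1 ?nc_ge0.
have rh0 : 0 <= rh by exact: nc_ge0.
have rh1 : rh < 1 by rewrite /rh nc_mob_lt1.
have N : nc (1 - (f w)^*%C * f z) <= (1 - nc (f w) ^+ 2) + D.
  have -> : 1 - (f w)^*%C * f z = (1 - nc (f w) ^+ 2)%:C%C - (f w)^*%C * (f z - f w).
    by rewrite rcB rc1 nc_sqrC; ring.
  apply: (le_trans (ncB _ _)); rewrite nc_posreal; last first.
    by rewrite subr_ge0 expr_le1 ?nc_ge0// f1.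
  by rewrite lerD2l ncM ncJ -/D ler_piMl ?nc_ge0// f1.
have B0 : 0 <= 1 - nc (f w) ^+ 2 by rewrite subr_ge0 expr_le1 ?nc_ge0// f1.
have D0 : 0 <= D by exact: nc_ge0.
move: gap A0 N B0; set A := _ * (_ - _); set B := 1 - nc (f w) ^+ 2 => gap A0 N B0 h.
have {}h : D <= rh * (B + D) by apply: (le_trans h); rewrite ler_wpM2l.
have h2 : D * (1 - rh) <= B by nra.
rewrite mulrAC ler_pdivlMr// mulrC.
by nra.
Qed.

Lemma hol_unimodular_cst f w : hol_bounded f 1 -> nc w < 1 -> nc (f w) = 1 ->
  forall z, nc z < 1 -> f z = f w.
Proof.
move=> hf w1 fw z z1; have := osc hf z1 w1; rewrite fw expr1n subrr mulr0 => h.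
by apply/eqP; rewrite -subr_eq0 -nc_eq0 eq_le h nc_ge0.
Qed.

Lemma schwarz_pick_mob f z w : hol f -> (forall u, nc u < 1 -> nc (f u) < 1) ->
  nc z < 1 -> nc w < 1 -> nc (mob (f w) (f z)) <= nc (mob w z).
Proof.
move=> hf f1 z1 w1; have hb : hol_bounded f 1 by split=> // u /f1/ltW.
rewrite [X in X <= _]ncM ncV ler_pdivrMr; first exact: schwarz_pick.
by rewrite nc_gt0 mob_den ?f1// ltW// f1.
Qed.

End SchwarzPick.

(** * Weakly inner functions *)

Section WeaklyInner.
Variable R : realType.
Local Notation C := R[i].
Local Notation nc := (@ComplexField.Normc.normc R).
Local Notation Re := (@complex.Re R).
Implicit Types (f g Q : C -> C) (z w : C).

(** One sequence of radii stands for the limit [r -> 1]; the shift by two makes them all positive.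
    The same radii later bound the search for zeros. *)
Definition rn (n : nat) : R := 1 - (n.+2%:R)^-1.

Lemma rn_gt0 n : 0 < rn n.
Proof. by rewrite subr_gt0 invf_lt1// ltr1n. Qed.
Lemma rn_ge0 n : 0 <= rn n. Proof. exact: ltW (rn_gt0 n). Qed.
Lemma rn_lt1 n : rn n < 1.
Proof. by rewrite ltrBlDr ltrDl invr_gt0. Qed.
Lemma cvg_rn : rn @ \oo --> (1 : R).
Proof.
rewrite -[X in _ --> X]subr0; apply: cvgB; first exact: cvg_cst.
have := @cvg_harmonic R; rewrite -(cvg_shiftS (@harmonic R)).
by apply: cvg_trans; apply: near_eq_cvg; apply: nearW => n.
Qed.

Lemma nc_circ_lt1 n t : nc (circ (rn n) t) < 1.
Proof. by rewrite nc_circ ?rn_ge0// rn_lt1. Qed.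

Definition cm n (u : C -> C) := cmean (fun t => u (circ (rn n) t)).
Definition rm n (u : C -> R) := rmean (fun t => u (circ (rn n) t)).
Definition ccirc (u : C -> C) := forall n, ccont (fun t => u (circ (rn n) t)).

Lemma ccirc_hol f : hol f -> ccirc f.
Proof. by move=> hf n; apply: ccont_hol => //; [exact: rn_ge0|exact: rn_lt1]. Qed.
Lemma ccirc_cst k : ccirc (fun=> k). Proof. by move=> n; exact: ccont_cst. Qed.
Lemma ccircD f g : ccirc f -> ccirc g -> ccirc (fun z => f z + g z).
Proof. by move=> hf hg n; exact: ccontD. Qed.
Lemma ccircB f g : ccirc f -> ccirc g -> ccirc (fun z => f z - g z).
Proof. by move=> hf hg n; exact: ccontB. Qed.
Lemma ccircM f g : ccirc f -> ccirc g -> ccirc (fun z => f z * g z).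
Proof. by move=> hf hg n; exact: ccontM. Qed.
Lemma ccircJ f : ccirc f -> ccirc (fun z => (f z)^*%C).
Proof. by move=> hf n; exact: ccontJ. Qed.
Lemma ccircX f k : ccirc f -> ccirc (fun z => f z ^+ k).
Proof. by move=> hf n; exact: (ccontX _ (hf n)). Qed.
Lemma ccirc_sum (I : Type) (s : seq I) (F : I -> C -> C) :
  (forall i, ccirc (F i)) -> ccirc (fun z => \sum_(i <- s) F i z).
Proof.
move=> hF; elim: s => [|i s IH].
  by move=> n; under [X in ccont X]eq_fun do rewrite big_nil; exact: ccont_cst.
by move=> n; under [X in ccont X]eq_fun do rewrite big_cons; exact: (ccircD (hF i) IH).
Qed.
Lemma rcirc_nc2 f : ccirc f -> forall n, continuous (fun t => nc (f (circ (rn n) t)) ^+ 2).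
Proof.
move=> cf n; under [X in continuous X]eq_fun do rewrite expr2.
by apply: real_continuousM; exact: (ccont_nc (cf n)).
Qed.
Lemma rcirc_defect f : ccirc f ->
  forall n, continuous (fun t => 1 - nc (f (circ (rn n) t)) ^+ 2).
Proof.
move=> cf n; apply: real_continuousB; first by move=> t; exact: cvg_cst.
exact: rcirc_nc2.
Qed.

Definition defect f n := rm n (fun z => 1 - nc (f z) ^+ 2).

Definition selfmap f := hol f /\ forall z, nc z < 1 -> nc (f z) < 1.

Definition weakly_inner f := selfmap f /\ defect f @ \oo --> (0 : R).

Lemma selfmap_bounded f : selfmap f -> hol_bounded f 1.
Proof. by move=> [hf f1]; split=> // z /f1/ltW. Qed.

Lemma cm_hol f n : hol f -> cm n f = f 0.
Proof. by move=> hf; apply: mean_value => //; [exact: rn_ge0|exact: rn_lt1]. Qed.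

Lemma defectE f n : ccirc f -> defect f n = 1 - rm n (fun z => nc (f z) ^+ 2).
Proof.
move=> cf; rewrite /defect /rm rmeanB; last exact: rcirc_nc2.
  by rewrite rmean_cst.
by move=> t; exact: cvg_cst.
Qed.

Lemma defect_ge0 f n : (forall z, nc z < 1 -> nc (f z) <= 1) -> 0 <= defect f n.
Proof.
move=> f1; apply: rmean_ge0 => t; rewrite subr_ge0 expr_le1 ?nc_ge0// f1//.
exact: nc_circ_lt1.
Qed.

(** The cross term is twice the real part of [conj a * (z * q z)], holomorphic and zero at the
    origin, so its mean vanishes. *)
Lemma mean_square f q a r : hol f -> hol q -> 0 <= r -> r < 1 ->
  (forall z, nc z < 1 -> f z = a + z * q z) ->
  rmean (fun t => nc (f (circ r t)) ^+ 2) =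
  nc a ^+ 2 + r ^+ 2 * rmean (fun t => nc (q (circ r t)) ^+ 2).
Proof.
move=> hf hq r0 r1 fq.
have cq := ccont_hol hq r0 r1.
have cq2 : continuous (fun t => nc (q (circ r t)) ^+ 2).
  under [X in continuous X]eq_fun do rewrite expr2.
  by apply: real_continuousM; exact: ccont_nc.
pose H z := a^*%C * (z * q z).
have hH : hol H by apply: holM; [exact: hol_cst|apply: holM => //; exact: hol_id].
have cH := ccont_Re (ccont_hol hH r0 r1).
have c1 k : continuous (fun t : R => k : R) by move=> t; exact: cvg_cst.
rewrite (@rmean_eq _ _ (fun t => (nc a ^+ 2 + 2 * Re (H (circ r t))) +
   r ^+ 2 * nc (q (circ r t)) ^+ 2)); last first.
  move=> t; rewrite fq ?nc_circ//.
  have -> : r ^+ 2 * nc (q (circ r t)) ^+ 2 = nc (circ r t * q (circ r t)) ^+ 2.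
    by rewrite ncM nc_circ// exprMn.
  by rewrite /H !nc_sqr !ReImE; ring.
rewrite rmeanD; [|by apply: real_continuousD => //; exact: real_continuousM|exact: real_continuousM].
rewrite rmeanD//; last exact: real_continuousM.
rewrite rmean_cst !rmeanZ// -Re_cmean mean_value// /H mul0r mulr0/= mulr0 addr0.
by [].
Qed.

Lemma mean_square_ge f r : hol f -> 0 <= r -> r < 1 ->
  nc (f 0) ^+ 2 <= rmean (fun t => nc (f (circ r t)) ^+ 2).
Proof.
move=> hf r0 r1; have [q hq fq] := hol_divX hf.
rewrite (mean_square hf hq r0 r1 fq) lerDl mulr_ge0 ?exprn_ge0// rmean_ge0// => t.
by rewrite exprn_ge0// nc_ge0.
Qed.

(** The right-hand side is independent of the radius: a value at the origin controls the defect on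
    all circles simultaneously. *)
Lemma defect_le f n : hol f -> defect f n <= 1 - nc (f 0) ^+ 2.
Proof.
move=> hf; rewrite defectE; last exact: ccirc_hol.
by rewrite lerB// mean_square_ge ?rn_ge0 ?rn_lt1.
Qed.

Lemma hol_div_bound q (k : R) : 0 <= k -> hol q ->
  (forall z, nc z < 1 -> nc (z * q z) <= k) -> hol_bounded q k.
Proof.
move=> k0 hq hk; split=> // z z1; apply/ler_addgt0Pr => e e0.
have k10 : 0 < k + 1 by lra.
pose d := e / (k + 1); have d0 : 0 < d by rewrite divr_gt0.
pose r := Num.max ((1 + nc z) / 2) (1 + d)^-1.
have e1 : 0 < 1 + d by lra.
have zr : nc z < r by rewrite /r lt_max; apply/orP; left; lra.
have r1 : r < 1 by rewrite /r gt_max invf_lt1//; apply/andP; split; lra.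
have r0 : 0 < r by exact: le_lt_trans (nc_ge0 z) zr.
apply: (max_principle hq r1 zr) => t.
have ct : nc (circ r t) < 1 by rewrite nc_circ// ltW.
have := hk _ ct; rewrite ncM nc_circ ?(ltW r0)//.
have : (1 + d)^-1 <= r by rewrite /r le_max lexx orbT.
rewrite -(@ler_pM2l _ (1 + d))// divff ?gt_eqF// => h1 h2.
have ed : e = d * (k + 1) by rewrite /d divfK// gt_eqF.
by have := nc_ge0 (q (circ r t)); nra.
Qed.

(* Backward shift on Taylor coefficients. *)
Definition shiftX Q : C -> C :=
  xget Q [set q | hol q /\ forall z, nc z < 1 -> Q z = Q 0 + z * q z].

Lemma shiftXP Q : hol Q -> hol (shiftX Q) /\ forall z, nc z < 1 -> Q z = Q 0 + z * shiftX Q z.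
Proof.
move=> hQ; rewrite /shiftX; case: xgetP => [q -> //|h].
by have [q hq qE] := hol_divX hQ; have := h q; case.
Qed.

Lemma shiftX_bounded Q (k : R) : hol_bounded Q k -> hol_bounded (shiftX Q) (2 * k).
Proof.
move=> [hQ Qk]; have [hq qE] := shiftXP hQ.
have k0 : 0 <= k by apply: le_trans (nc_ge0 _) (Qk 0 _); rewrite nc0.
apply: hol_div_bound => //; first by rewrite mulr_ge0.
move=> z z1; have -> : z * shiftX Q z = Q z - Q 0 by rewrite {1}qE// addrC addKr.
rewrite (le_trans (ncB _ _))// mulr2n mulrDl mul1r lerD// Qk// nc0//.
Qed.

Definition coefX Q j : C := iter j shiftX Q 0.

Lemma coefXS Q j : coefX Q j.+1 = coefX (shiftX Q) j.
Proof. by rewrite /coefX iterSr. Qed.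

Lemma iter_shiftX_hol Q j : hol Q -> hol (iter j shiftX Q).
Proof. by move=> hQ; elim: j => //= j IH; have [] := shiftXP IH. Qed.

Lemma taylor Q N z : hol Q -> nc z < 1 ->
  Q z = \sum_(j < N) coefX Q j * z ^+ j + z ^+ N * iter N shiftX Q z.
Proof.
move=> hQ z1; elim: N => [|N IH]; first by rewrite big_ord0 add0r expr0 mul1r.
rewrite big_ord_recr/= {1}IH -addrA; congr (_ + _).
have [_ qE] := shiftXP (iter_shiftX_hol N hQ).
by rewrite qE// /coefX exprSr; ring.
Qed.

Lemma parseval Q N r : hol Q -> 0 <= r -> r < 1 ->
  rmean (fun t => nc (Q (circ r t)) ^+ 2) =
  \sum_(j < N) r ^+ (2 * j) * nc (coefX Q j) ^+ 2 +
  r ^+ (2 * N) * rmean (fun t => nc (iter N shiftX Q (circ r t)) ^+ 2).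
Proof.
move=> hQ r0 r1; elim: N => [|N IH].
  by rewrite big_ord0 add0r muln0 expr0 mul1r.
rewrite big_ord_recr/= {1}IH -addrA; congr (_ + _).
have hN := iter_shiftX_hol N hQ; have [hq qE] := shiftXP hN.
by rewrite (mean_square hN hq r0 r1 qE) mulnS exprD /coefX; ring.
Qed.

(** Cauchy's inequality, read off as a single term of Parseval's identity. *)
Lemma coefX_le Q (k r : R) j : hol_bounded Q k -> 0 <= r -> r < 1 ->
  r ^+ j * nc (coefX Q j) <= k.
Proof.
move=> [hQ Qk] r0 r1.
have k0 : 0 <= k by apply: le_trans (nc_ge0 _) (Qk 0 _); rewrite nc0.
rewrite -(@ler_pXn2r _ 2)// ?nnegrE ?mulr_ge0 ?exprn_ge0 ?nc_ge0//.
rewrite exprMn -exprM mulnC.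
have : rmean (fun t => nc (Q (circ r t)) ^+ 2) <= k ^+ 2.
  rewrite -[leRHS]rmean_cst; apply: rmean_le => [||t]; last first.
  - by rewrite lerXn2r ?nnegrE ?nc_ge0// Qk// nc_circ.
  - by move=> t; exact: cvg_cst.
  under [X in continuous X]eq_fun do rewrite expr2.
  by apply: real_continuousM; apply: ccont_nc; exact: ccont_hol.
apply: le_trans; rewrite (parseval j.+1 hQ r0 r1) big_ord_recr/= -addrA.
rewrite -[leLHS]add0r; apply: lerD.
  by apply: sumr_ge0 => i _; rewrite mulr_ge0 ?exprn_ge0 ?nc_ge0.
rewrite lerDl mulr_ge0 ?exprn_ge0// rmean_ge0// => t.
by rewrite exprn_ge0// nc_ge0.
Qed.

(** Parseval's inequality with finite sums and an error [e]. The coefficient bounds at radius [s']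
    keep the Taylor polynomials bounded on the circle of radius [s]; the maximum principle there
    bounds the [N]-th remainder by [K / s ^+ N], and [r < s] makes [r ^+ N] times it small. *)
Lemma parseval_le Q (k r : R) : hol_bounded Q k -> 0 <= r -> r < 1 -> forall e : R, 0 < e ->
  exists N, rmean (fun t => nc (Q (circ r t)) ^+ 2) - e <= \sum_(j < N) nc (coefX Q j) ^+ 2.
Proof.
move=> hQk r0 r1 e e0; have [hQ Qk] := hQk.
have k0 : 0 <= k by apply: le_trans (nc_ge0 _) (Qk 0 _); rewrite nc0.
pose s := (1 + r) / 2; pose s' := (1 + s) / 2.
have s0 : 0 < s by rewrite /s; lra.
have s1 : s < 1 by rewrite /s; lra.
have rs : r < s by rewrite /s; lra.
have s'0 : 0 < s' by rewrite /s'; lra.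
have s'1 : s' < 1 by rewrite /s'; lra.
have ss' : s < s' by rewrite /s'; lra.
pose x := s / s'; have x0 : 0 <= x by rewrite divr_ge0 ?ltW.
have x1 : x < 1 by rewrite ltr_pdivrMr// mul1r.
pose K := k + k / (1 - x).
have K0 : 0 <= K by rewrite addr_ge0// divr_ge0// subr_ge0 ltW.
have rem N z : nc z <= r -> nc (iter N shiftX Q z) <= K / s ^+ N.
  move=> zr; apply: (@max_principle _ _ s) => //; first exact: iter_shiftX_hol.
    exact: le_lt_trans rs.
  move=> t; rewrite ler_pdivlMr ?exprn_gt0// mulrC.
  have ct1 : nc (circ s t) < 1 by rewrite nc_circ// ltW.
  have -> : s ^+ N * nc (iter N shiftX Q (circ s t)) =
      nc (Q (circ s t) - \sum_(j < N) coefX Q j * circ s t ^+ j).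
    by rewrite {1}(taylor N hQ ct1) addrC addKr ncM ncX nc_circ// ltW.
  apply: (le_trans (ncB _ _)); apply: lerD; first exact: Qk.
  apply: (le_trans (nc_sum_le _ _ _)).
  apply: (@le_trans _ _ (\sum_(j < N) k * x ^+ j)).
    apply: ler_sum => j _; rewrite ncM ncX nc_circ ?(ltW s0)//.
    have := coefX_le j hQk (ltW s'0) s'1.
    have -> : x ^+ j = s ^+ j / s' ^+ j by rewrite -expr_div_n.
    rewrite mulrA ler_pdivlMr ?exprn_gt0// mulrAC => h.
    by rewrite ler_wpM2r ?exprn_ge0 ?(ltW s0)// mulrC.
  rewrite -mulr_sumr ler_wpM2l//.
  have xs := subrX1 x N.
  have x10 : 0 < 1 - x by lra.
  rewrite -[leRHS]div1r ler_pdivlMr//.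
  have -> : (\sum_(j < N) x ^+ j) * (1 - x) = 1 - x ^+ N.
    by rewrite -[RHS]opprB xs; ring.
  by rewrite lerBlDr lerDl exprn_ge0.
have rs1 : r / s < 1 by rewrite ltr_pdivrMr// mul1r.
have rs0 : 0 <= r / s by exact: (divr_ge0 r0 (ltW s0)).
have y1 : (r / s) ^+ 2 < 1 by rewrite expr_lt1.
have : (fun N => K ^+ 2 * ((r / s) ^+ 2) ^+ N) @ \oo --> (0 : R).
  rewrite -[X in _ --> X](mulr0 (K ^+ 2)); apply: cvgMr; apply: cvg_expr.
  by rewrite (ger0_norm (sqr_ge0 (r / s))).
move=> /cvgrPdist_lt/(_ _ e0)[N _ /(_ N (leqnn N))] /=.
rewrite sub0r normrN => /(le_lt_trans (ler_norm _)) hN.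
exists N; rewrite (parseval N hQ r0 r1) -addrA.
apply: (@le_trans _ _ (\sum_(j < N) r ^+ (2 * j) * nc (coefX Q j) ^+ 2 + 0)); last first.
  rewrite addr0; apply: ler_sum => j _.
  by rewrite ler_piMl ?exprn_ge0 ?nc_ge0// exprn_ile1// ltW.
rewrite lerD2l subr_le0 (le_trans _ (ltW hN))//.
have -> : K ^+ 2 * ((r / s) ^+ 2) ^+ N = r ^+ (2 * N) * (K / s ^+ N) ^+ 2.
  by move: (s) s0 => S S0; rewrite -exprM (mulnC 2) exprM !exprMn !exprVn -!exprM; ring.
rewrite ler_wpM2l ?exprn_ge0// -[leRHS]rmean_cst; apply: rmean_le => [||t].
- under [X in continuous X]eq_fun do rewrite expr2.
  by apply: real_continuousM; apply: ccont_nc; apply: ccont_hol => //; exact: iter_shiftX_hol.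
- by move=> t; exact: cvg_cst.
rewrite lerXn2r ?nnegrE ?nc_ge0 ?divr_ge0 ?exprn_ge0 ?(ltW s0)//.
by apply: rem; rewrite nc_circ.
Qed.

End WeaklyInner.

(** * Composition of weakly inner functions *)

Section Composition.
Variable R : realType.
Local Notation C := R[i].
Local Notation nc := (@ComplexField.Normc.normc R).
Local Notation Re := (@complex.Re R).
Local Notation Im := (@complex.Im R).
Implicit Types (f g Q : C -> C) (z w : C).

Lemma cm_eq n (u v : C -> C) : (forall z, nc z < 1 -> u z = v z) -> cm n u = cm n v.
Proof. by move=> uv; apply: cmean_eq => t; apply: uv; exact: nc_circ_lt1. Qed.
Lemma cmD n u v : ccirc u -> ccirc v -> cm n (fun z => u z + v z) = cm n u + cm n v.
Proof. by move=> cu cv; apply: cmeanD. Qed.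
Lemma cmB n u v : ccirc u -> ccirc v -> cm n (fun z => u z - v z) = cm n u - cm n v.
Proof. by move=> cu cv; apply: cmeanB. Qed.
Lemma cmZ n k u : ccirc u -> cm n (fun z => k * u z) = k * cm n u.
Proof. by move=> cu; apply: cmeanZ. Qed.
Lemma cmJ n u : ccirc u -> cm n (fun z => (u z)^*%C) = (cm n u)^*%C.
Proof. by move=> cu; apply: cmeanJ. Qed.
Lemma cm_cst n (k : C) : cm n (fun=> k) = k.
Proof. exact: cmean_cst. Qed.
Lemma cm_sum n N (k : nat -> C) (u : nat -> C -> C) : (forall j, ccirc (u j)) ->
  cm n (fun z => \sum_(j < N) k j * u j z) = \sum_(j < N) k j * cm n (u j).
Proof.
move=> cu; elim: N => [|N IH].
  rewrite big_ord0 -[RHS](cm_cst n 0); apply: cm_eq => z _; by rewrite big_ord0.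
rewrite big_ord_recr/= -IH -cmZ// -cmD//; last 2 first.
- apply: ccirc_sum => j; apply: ccircM => //; exact: ccirc_cst.
- by apply: ccircM => //; exact: ccirc_cst.
by apply: cm_eq => z _; rewrite big_ord_recr.
Qed.

Lemma clim_eq (u v : nat -> C) l : (forall n, u n = v n) -> clim u l -> clim v l.
Proof. by move=> /funext ->. Qed.

Lemma clim_sum N (u : nat -> nat -> C) (l : nat -> C) : (forall j, (j < N)%N -> clim (u j) (l j)) ->
  clim (fun n => \sum_(j < N) u j n) (\sum_(j < N) l j).
Proof.
elim: N => [|N IH] h.
  by rewrite big_ord0; apply: clim_eq (clim_cst 0) => n; rewrite big_ord0.
rewrite big_ord_recr/=; apply: clim_eq (climD (IH _) (h N _)) => // [n|j jN].
  by rewrite big_ord_recr.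
exact/h/ltnW.
Qed.

Section Fixed.
Variable phi : C -> C.
Hypothesis wphi : weakly_inner phi.
Let hphi : hol phi. Proof. by case: wphi => -[]. Qed.
Let phi1 z : nc z < 1 -> nc (phi z) < 1. Proof. by case: wphi => -[_ h] _; exact: h. Qed.
Let c := phi 0.
Let c1 : nc c < 1. Proof. by apply: phi1; rewrite nc0. Qed.

(** For unimodular boundary values of [phi], the image of normalised arc length has the Poisson
    density [(1 - |c|^2) / |1 - conj c * w|^2]. Multiplying by the denominator leaves arc length, so
    the means of [U j Q] should tend to [1 - |c|^2] times the [j]-th Taylor coefficient of [Q];
    [limL] records such a limit. *)
Let U j Q z : C := (1 - c^*%C * phi z) * (1 - c * (phi z)^*%C) * Q (phi z) * (phi z)^*%C ^+ j.

Let cphi : ccirc phi. Proof. exact: ccirc_hol. Qed.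
Let cphiJ : ccirc (fun z => (phi z)^*%C). Proof. exact: ccircJ. Qed.
Let hQphi Q : hol Q -> hol (fun z => Q (phi z)).
Proof. by move=> hQ; exact: hol_comp. Qed.
Let hk : hol (fun z => 1 - c^*%C * phi z).
Proof. by apply: holB; [exact: hol_cst|apply: holM => //; exact: hol_cst]. Qed.
Let cU j Q : hol Q -> ccirc (U j Q).
Proof.
move=> hQ; apply: ccircM; last exact: ccircX.
apply: ccircM; last by apply: ccirc_hol; exact: hQphi.
apply: ccircM; first exact: ccirc_hol.
by apply: ccircB; [exact: ccirc_cst|apply: ccircM => //; exact: ccirc_cst].
Qed.

Let nck z : nc z < 1 -> nc (1 - c^*%C * phi z) <= 2.
Proof.
move=> /phi1 h; rewrite (le_trans (ncB _ _))// nc1 ncM ncJ.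
have : nc c * nc (phi z) <= 1 by rewrite mulr_ile1 ?nc_ge0// ltW.
lra.
Qed.

Let ncU j Q k z : hol_bounded Q k -> nc z < 1 -> nc (U j Q z) <= 4 * k.
Proof.
move=> [_ Qk] z1; have p1 := phi1 z1; rewrite /U !ncM.
have -> : nc (1 - c * (phi z)^*%C) = nc (1 - c^*%C * phi z).
  by rewrite -ncJ cjB cjM conjcK cj1.
have h1 := nck z1; have h2 := Qk _ p1.
have h3 : nc ((phi z)^*%C ^+ j) <= 1 by rewrite ncX ncJ exprn_ile1 ?nc_ge0// ltW.
have -> : 4 * k = 2 * 2 * k * 1 by ring.
by do 3! (apply: ler_pM; rewrite ?mulr_ge0 ?nc_ge0//).
Qed.

(** In the limit [phi] times its conjugate may be replaced by 1 under the mean: the error is a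
    bounded function times a defect tending to 0. *)
Let err E (K : R) : ccirc E -> (forall z, nc z < 1 -> nc (E z) <= K) ->
  clim (fun n => cm n (fun z => (1 - nc (phi z) ^+ 2)%:C%C * E z)) 0.
Proof.
move=> cE EK; apply: (@squeeze0 _ _ (fun n => K * defect phi n)); last first.
  rewrite -[X in _ --> X](mulr0 K); apply: cvgMr; by case: wphi.
move=> n; rewrite nc_ge0 andTb subr0 /defect /rm -rmeanZ; last exact: rcirc_defect.
rewrite /cm; apply: nc_cmean_le.
- apply: ccontM; last exact: cE.
  by apply: ccont_real; exact: rcirc_defect.
- by apply: real_continuousM; [move=> t; exact: cvg_cst|exact: rcirc_defect].
move=> t; have ct := nc_circ_lt1 n t.
have d0 : 0 <= 1 - nc (phi (circ (rn R n) t)) ^+ 2.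
  by rewrite subr_ge0 expr_le1 ?nc_ge0// ltW// phi1.
by rewrite ncM nc_posreal// mulrC ler_wpM2r// EK.
Qed.

Let cdef : ccirc (fun z => (1 - nc (phi z) ^+ 2)%:C%C).
Proof. by move=> n; apply: ccont_real; exact: rcirc_defect. Qed.

Let limL j Q l := clim (fun n => cm n (U j Q)) ((1 - nc c ^+ 2)%:C%C * l).

(** After replacing [|phi|^2] by 1, [U 0 Q] is the holomorphic [H] minus a multiple of
    [conj (phi - c)]. The latter has mean 0, and [H 0 = (1 - |c|^2) * (Q c - c * q c) = (1 - |c|^2)
    * Q 0]. *)
Let limL0 Q k : hol_bounded Q k -> limL 0 Q (Q 0).
Proof.
move=> hQk; have [hQ Qk] := hQk; have [hq qE] := shiftXP hQ; have [_ qk] := shiftX_bounded hQk.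
pose q := shiftX Q.
pose H z := (1 - c^*%C * phi z) * (Q (phi z) - c * q (phi z)).
pose E z := c * (Q 0 * c^*%C - (1 - c^*%C * phi z) * q (phi z)).
have hH : hol H.
  apply: holM => //; apply: holB; first exact: hQphi.
  by apply: holM; [exact: hol_cst|exact: hQphi].
have hE : hol E.
  apply: holM; first exact: hol_cst.
  by apply: holB; [exact: hol_cst|apply: holM => //; exact: hQphi].
have cE := ccirc_hol hE.
have EK z : nc z < 1 -> nc (E z) <= 1 * (k + 2 * (2 * k)).
  move=> z1; have p1 := phi1 z1; rewrite /E ncM; apply: ler_pM; rewrite ?nc_ge0 ?(ltW c1)//.
  apply: (le_trans (ncB _ _)); apply: lerD.
    rewrite ncM ncJ -[leRHS]mulr1; apply: ler_pM; rewrite ?nc_ge0 ?(ltW c1)// Qk//.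
    by rewrite nc0.
  by rewrite ncM; apply: ler_pM; rewrite ?nc_ge0 ?nck// qk.
have e0 := err cE EK.
rewrite /limL; have -> : (1 - nc c ^+ 2)%:C%C * Q 0 = (1 - nc c ^+ 2)%:C%C * Q 0 - 0 by rewrite subr0.
apply: clim_eq (climB (clim_cst _) e0) => n.
have cX : ccirc (fun z => c * Q 0 * ((phi z)^*%C - c^*%C)).
  by apply: ccircM; [exact: ccirc_cst|apply: ccircB => //; exact: ccirc_cst].
rewrite [RHS](@cm_eq n _ (fun z => (H z - c * Q 0 * ((phi z)^*%C - c^*%C)) -
    (1 - nc (phi z) ^+ 2)%:C%C * E z)).
  rewrite [RHS]cmB; [|by apply: ccircB => //; exact: ccirc_hol|exact: ccircM].
  rewrite cmB//; last exact: ccirc_hol.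
  rewrite cmZ; last by apply: ccircB => //; exact: ccirc_cst.
  rewrite cmB//; last exact: ccirc_cst.
  rewrite cmJ// cm_cst (cm_hol n hH) (cm_hol n hphi) -/c subrr mulr0 subr0 /H -/c.
  congr (_ - _); rewrite (qE c)// -/q rcB nc_sqrC rc1; ring.
move=> z z1; rewrite /U /H /E expr0 mulr1 rcB nc_sqrC rc1.
rewrite (qE (phi z)) ?phi1// -/q; ring.
Qed.

(** In [z * q z] one factor [phi] cancels one conjugate, up to [err]. The constant [a] multiplies
    the conjugate of [U 0] at a positive power of [z], whose mean tends to 0 by [limL0]. *)
Let limLS j Q q a k k' l : hol_bounded Q k -> hol_bounded q k' ->
  (forall z, nc z < 1 -> Q z = a + z * q z) -> limL j q l -> limL j.+1 Q l.
Proof.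
move=> [hQ Qk] hqk qE Lq; have [hq _] := hqk.
have hX : hol_bounded (fun z : C => z ^+ j.+1) 1.
  split=> [|z z1]; first by apply: holX; exact: hol_id.
  by rewrite ncX exprn_ile1 ?nc_ge0// ltW.
have L0 := limL0 hX; rewrite /limL expr0n/= mulr0 in L0.
have e0 := err (cU j hq) (fun z => ncU j hqk (z := z)).
rewrite /limL; have -> : (1 - nc c ^+ 2)%:C%C * l = a * 0^*%C + (1 - nc c ^+ 2)%:C%C * l - 0.
  by rewrite conjc0 mulr0 add0r subr0.
apply: clim_eq (climB (climD (climM (clim_cst a) (climJ L0)) Lq) e0) => n.
have cX := cU 0 hX.1.
rewrite [RHS](@cm_eq n _ (fun z => (a * (U 0 (fun z => z ^+ j.+1) z)^*%C + U j q z) -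
   (1 - nc (phi z) ^+ 2)%:C%C * U j q z)).
  rewrite [RHS]cmB; last 2 first.
  - apply: ccircD; last exact: cU.
    by apply: ccircM; [exact: ccirc_cst|exact: ccircJ].
  - by apply: ccircM => //; exact: cU.
  congr (_ - _); rewrite cmD; last 2 first.
  - by apply: ccircM; [exact: ccirc_cst|exact: ccircJ].
  - exact: cU.
  by congr (_ + _); rewrite cmZ; [rewrite cmJ|exact: ccircJ].
move=> z z1; rewrite /U qE ?phi1// !cjE rcB nc_sqrC rc1 !exprSr ?expr0; ring.
Qed.

Let limL_coef j Q k : hol_bounded Q k -> limL j Q (coefX Q j).
Proof.
elim: j Q k => [|j IH] Q k hQk; first exact: limL0 hQk.
have hs := shiftX_bounded hQk; have [_ qE] := shiftXP hQk.1.
by rewrite coefXS; exact: limLS hQk hs qE (IH _ _ hs).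
Qed.

Let limL_high j N G k : hol_bounded G k -> (j < N)%N -> limL j (fun z => z ^+ N * G z) 0.
Proof.
move=> hGk; have hb M : hol_bounded (fun z => z ^+ M * G z) k.
  split=> [|z z1].
    by apply: holM; [apply: holX; exact: hol_id|exact: hGk.1].
  rewrite ncM ncX; have [_ Gk] := hGk.
  have : nc z ^+ M <= 1 by rewrite exprn_ile1 ?nc_ge0// ltW.
  have := Gk _ z1; have := nc_ge0 (G z); have : 0 <= nc z ^+ M by rewrite exprn_ge0// nc_ge0.
  by nra.
elim: j N => [|j IH] [//|N] jN.
  by have := limL0 (hb N.+1); rewrite expr0n/= mul0r.
apply: (limLS (a := 0) (hb N.+1) (hb N)) => [z z1|]; first by rewrite add0r exprS mulrA.
exact: IH.
Qed.

(** A lower bound on the mean of [|u|^2], for [u = f \o phi], comes from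
    [|u|^2 >= 2 Re (u * conj V) - |V|^2] with a test function [V] built from a Taylor polynomial of
    [F]. The mean of the right-hand side tends to [S N], and [S N >= 1 - e] for a suitable [N],
    because [(1 - |c|^2) |F|^2] is [|f|^2] times the Poisson kernel and [f] is weakly inner. *)
Lemma weakly_inner_comp f : weakly_inner f -> weakly_inner (fun z => f (phi z)).
Proof.
move=> [[hf f1] df]; have hfp : hol (fun z => f (phi z)) by exact: hol_comp.
split; first by split=> // z z1; exact/f1/phi1.
pose K1 : R := ((1 - nc c)^-1) ^+ 2.
have c10 : 0 < 1 - nc c by rewrite subr_gt0.
pose F z := f z / (1 - c^*%C * z).
have den z : nc z < 1 -> 1 - c^*%C * z != 0 by move=> z1; apply: mob_den => //; exact: ltW.
have denV z : nc z < 1 -> nc (1 - c^*%C * z)^-1 <= (1 - nc c)^-1.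
  move=> z1; rewrite ncV lef_pV2 ?posrE ?nc_gt0 ?den//.
  apply: le_trans (ncB_ge _ _); rewrite nc1 ncM ncJ lerB// ler_piMr ?nc_ge0//.
  exact: ltW.
have hker : hol (fun z => (1 - c^*%C * z)^-1).
  apply: holV => //; apply: holB; first exact: hol_cst.
  by apply: holM; [exact: hol_cst|exact: hol_id].
have hF : hol_bounded F (1 - nc c)^-1.
  split=> [|z z1]; first exact: holM.
  rewrite ncM -[leRHS]mul1r; apply: ler_pM; rewrite ?nc_ge0 ?(ltW (f1 _ z1))//.
  exact: denV.
have hFE z : nc z < 1 -> f z = (1 - c^*%C * z) * F z.
  by move=> z1; rewrite /F mulrC divfK// den.
pose S N : R := (1 - nc c ^+ 2) * \sum_(j < N) nc (coefX F j) ^+ 2.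
have SN (e : R) : 0 < e -> exists N, 1 - e <= S N.
  move=> e0.
  have step n : 1 - (1 - rn R n ^+ 2) * K1 - K1 * defect f n <=
      (1 - nc c ^+ 2) * rm n (fun z => nc (F z) ^+ 2).
    (* [Re (H z)] is [(1 - |c|^2 |z|^2) / |1 - conj c * z|^2], with mean [H 0 = 1]. Comparing its
       numerator with [1 - |c|^2] costs the term in [1 - rn R n ^+ 2]. *)
    pose H z := (1 + c^*%C * z) * (1 - c^*%C * z)^-1.
    have hH : hol H.
      apply: holM => //; apply: holD; first exact: hol_cst.
      by apply: holM; [exact: hol_cst|exact: hol_id].
    have cc k : continuous (fun t : R => k : R) by move=> t; exact: cvg_cst.
    have cH := ccont_Re (ccirc_hol hH n).
    have cf := @rcirc_defect _ _ (ccirc_hol hf) n.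
    have cF := @rcirc_nc2 _ _ (ccirc_hol hF.1) n.
    have -> : 1 - (1 - rn R n ^+ 2) * K1 - K1 * defect f n =
      rm n (fun z => Re (H z) - (1 - rn R n ^+ 2) * K1 - K1 * (1 - nc (f z) ^+ 2)).
      rewrite /rm rmeanB; [|by apply: real_continuousB|exact: real_continuousM].
      rewrite rmeanB// rmean_cst -Re_cmean mean_value ?rn_ge0 ?rn_lt1//.
      by rewrite rmeanZ// /H mulr0 addr0 subr0 invr1 mulr1.
    rewrite /rm -rmeanZ//; apply: rmean_le.
    - by apply: real_continuousB; [apply: real_continuousB|exact: real_continuousM].
    - exact: real_continuousM.
    move=> t; have z1 := nc_circ_lt1 n t.
    have zr : nc (circ (rn R n) t) = rn R n by rewrite nc_circ ?rn_ge0.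
    move: (circ (rn R n) t) z1 zr => z z1 zr.
    have dz := den _ z1; pose d := nc (1 - c^*%C * z)^-1 ^+ 2.
    have d0 : 0 <= d by rewrite exprn_ge0// nc_ge0.
    have dK : d <= K1.
      by rewrite /d /K1 lerXn2r ?nnegrE ?nc_ge0 ?denV// invr_ge0 ltW.
    have -> : Re (H z) = (1 - nc c ^+ 2 * rn R n ^+ 2) * d.
      have -> : H z = d%:C%C * ((1 + c^*%C * z) * (1 - c * z^*%C)).
        rewrite /d nc_sqrC /H !cjE; field.
        have -> : 1 - c * z^*%C = (1 - c^*%C * z)^*%C by rewrite !cjE.
        by rewrite dz -nc_gt0 ncJ nc_gt0 dz.
      rewrite -zr !nc_sqr ReM/= mul0r subr0 mulrC !ReImE; ring.
    have -> : nc (F z) ^+ 2 = nc (f z) ^+ 2 * d by rewrite /F ncM exprMn.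
    have r21 : 0 <= 1 - rn R n ^+ 2 by rewrite subr_ge0 expr_le1 ?rn_ge0// ltW// rn_lt1.
    have cc2 : 0 <= nc c ^+ 2 <= 1 by rewrite exprn_ge0 ?nc_ge0//= expr_le1 ?nc_ge0// ltW.
    have ff2 : 0 <= 1 - nc (f z) ^+ 2 by rewrite subr_ge0 expr_le1 ?nc_ge0// ltW// f1.
    move: (nc c ^+ 2) (rn R n ^+ 2) (nc (f z) ^+ 2) d r21 cc2 ff2 d0 dK.
    move=> a b x y h1 /andP[h2 h3] h4 h5 h6.
    have g1 : a * (1 - b) * y <= (1 - b) * K1.
      rewrite -mulrA -[leRHS]mul1r; apply: ler_pM => //; first by rewrite mulr_ge0.
      by rewrite ler_wpM2l.
    have g2 : (1 - a) * (1 - x) * y <= K1 * (1 - x).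
      rewrite mulrAC; apply: ler_wpM2r => //.
      rewrite -[leRHS]mul1r; apply: ler_pM => //; first by rewrite subr_ge0.
      by rewrite lerBlDr lerDl.
    have -> : (1 - a) * (x * y) = (1 - a * b) * y - a * (1 - b) * y - (1 - a) * (1 - x) * y by ring.
    lra.
  have lim1 : (fun n => 1 - (1 - rn R n ^+ 2) * K1 - K1 * defect f n) @ \oo --> (1 : R).
    rewrite [X in _ --> X](_ : 1 = 1 - (1 - 1 ^+ 2) * K1 - K1 * 0); last first.
      by rewrite expr1n subrr mul0r mulr0 !subr0.
    apply: cvgB; last by apply: cvgM; [exact: cvg_cst|exact: df].
    apply: cvgB; first exact: cvg_cst.
    apply: cvgM; last exact: cvg_cst.
    apply: cvgB; first exact: cvg_cst.
    under eq_fun do rewrite expr2; rewrite expr2.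
    by apply: cvgM; exact: cvg_rn.
  have e20 : 0 < e / 2 by rewrite divr_gt0.
  move/cvgrPdist_lt: lim1 => /(_ _ e20)[n _ /(_ n (leqnn n))] /=.
  move=> /(le_lt_trans (ler_norm _)) hn.
  have cc1 : 0 < 1 - nc c ^+ 2 by rewrite subr_gt0 sqr_lt1 ?nc_ge0.
  have [N hN] := parseval_le hF (rn_ge0 R n) (rn_lt1 R n) (e := e / 2) e20.
  exists N; have st := step n; rewrite /S.
  have : (1 - nc c ^+ 2) * (rm n (fun z => nc (F z) ^+ 2) - e / 2) <=
      (1 - nc c ^+ 2) * \sum_(j < N) nc (coefX F j) ^+ 2 by rewrite ler_pM2l.
  have : (1 - nc c ^+ 2) * (e / 2) <= e / 2.
    by rewrite ler_piMl ?(ltW e20)// gerBl exprn_ge0// nc_ge0.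
  by rewrite mulrBr; lra.
have low N : exists2 X : nat -> C, clim X (S N)%:C%C &
    forall n, Re (X n) <= rm n (fun z => nc (f (phi z)) ^+ 2).
  have [kG hG] : exists kG, hol_bounded (iter N (@shiftX R) F) kG.
    elim: N => [|N [kG hG]]; first by eexists; exact: hF.
    by eexists; exact: (shiftX_bounded hG).
  pose G := iter N (@shiftX R) F.
  (* By Taylor's formula [F + z^N G = 2 F - P], so [W] is [2 u * conj V - |V|^2]. The terms with
     [z^N G] have vanishing coefficients of order below [N] and contribute nothing in the limit. *)
  pose W z := \sum_(j < N) (coefX F j)^*%C * (U j F z + U j (fun z => z ^+ N * G z) z).
  have hNG : hol (fun z => z ^+ N * G z).
    by apply: holM; [apply: holX; exact: hol_id|exact: hG.1].
  have cUj j : ccirc (fun z => U j F z + U j (fun z => z ^+ N * G z) z).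
    by apply: ccircD; apply: cU => //; exact: hF.1.
  exists (fun n => cm n W).
    have -> : (S N)%:C%C = \sum_(j < N) (coefX F j)^*%C *
        ((1 - nc c ^+ 2)%:C%C * coefX F j + (1 - nc c ^+ 2)%:C%C * 0).
      rewrite /S rcM (rmorph_sum (real_complex R)) mulr_sumr/=.
      by apply: eq_bigr => j _; rewrite nc_sqrC mulr0 addr0; ring.
    apply: (@clim_eq (fun n => \sum_(j < N) (coefX F j)^*%C *
        (cm n (U j F) + cm n (U j (fun z => z ^+ N * G z))))).
      move=> n; rewrite [RHS](@cm_sum n N (fun j => (coefX F j)^*%C)
        (fun j z => U j F z + U j (fun z => z ^+ N * G z) z))//; apply: eq_bigr => j _; congr (_ * _).
      by rewrite cmD//; apply: cU => //; exact: hF.1.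
    apply: (@clim_sum N (fun j n => (coefX F j)^*%C *
        (cm n (U j F) + cm n (U j (fun z => z ^+ N * G z))))
      (fun j => (coefX F j)^*%C *
        ((1 - nc c ^+ 2)%:C%C * coefX F j + (1 - nc c ^+ 2)%:C%C * 0))) => j jN.
    apply: climM; first exact: clim_cst.
    by apply: climD; [exact: limL_coef hF|exact: limL_high hG jN].
  move=> n; rewrite /cm Re_cmean; apply: rmean_le.
  - apply: ccont_Re; apply: (@ccirc_sum R _ (index_enum 'I_N) (fun (j : 'I_N) z =>
      (coefX F j)^*%C * (U j F z + U j (fun z => z ^+ N * G z) z))) => j.
    by apply: ccircM => //; exact: ccirc_cst.
  - exact: (@rcirc_nc2 _ _ (ccirc_hol hfp) n).
  move=> t; have z1 := nc_circ_lt1 n t; move: (circ _ _) z1 => z z1.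
  have p1 := phi1 z1.
  pose P := \sum_(j < N) coefX F j * phi z ^+ j.
  pose V := (1 - c^*%C * phi z) * P; pose u := f (phi z).
  have -> : W z = u * V^*%C + u * V^*%C - V * V^*%C.
    have PE : phi z ^+ N * G (phi z) = F (phi z) - P.
      by rewrite (taylor N hF.1 p1) -/P addrAC subrr add0r.
    have PJ : P^*%C = \sum_(j < N) (coefX F j)^*%C * (phi z)^*%C ^+ j.
      rewrite /P (rmorph_sum (@conjc R)); apply: eq_bigr => j _.
      by rewrite -cjX -cjM.
    have -> : W z = (1 - c^*%C * phi z) * (1 - c * (phi z)^*%C) * (F (phi z) + (F (phi z) - P)) * P^*%C.
      rewrite PJ mulr_sumr; apply: eq_bigr => j _; rewrite /U PE; ring.
    rewrite /u /V hFE// !cjE; ring.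
  rewrite -/u; move: (u) (V) => u' V'; rewrite nc_sqr !ReImE.
  move: (Re u') (Im u') (Re V') (Im V') => a b x y.
  by have := sqr_ge0 (a - x); have := sqr_ge0 (b - y); nra.
apply/cvgrPdist_lt => e e0; have e20 : 0 < e / 2 by rewrite divr_gt0.
have [N hN] := SN _ e20; have [X XS hX] := low N.
have [n0 hn0] := (climP _ _).1 XS _ e20.
exists n0 => // n /= /hn0 Xn.
rewrite sub0r normrN ger0_norm; last by apply: defect_ge0 => z z1; exact/ltW/f1/phi1.
rewrite defectE; last exact: ccirc_hol.
have := hX n; have := le_lt_trans (nc_Re _) Xn; rewrite ReB/= ltr_norml => /andP[]; lra.
Qed.

End Fixed.

End Composition.

(** * Inner functions are weakly inner; Moebius maps and iterates *)

Section InnerWeaklyInner.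
Variable R : realType.
Local Notation C := R[i].
Local Notation nc := (@ComplexField.Normc.normc R).
Local Notation mu := (@lebesgue_measure R).
Implicit Types (f g phi : C -> C) (z w : C).

Lemma radial_limit_clim f t L :
  (fun r : R => (f ((r%:C)%C * expi t) : C^o)) @ (1 : R)^'- --> (L : C^o) ->
  clim (fun n => f (circ (rn R n) t)) L.
Proof.
move=> /cvgrPdist_lt h; apply/climP => e e0.
have e0' : 0 < e%:C%C :> C by rewrite -[0]/(0%:C%C) ltcR.
have := h _ e0'; rewrite /at_left /within/= => /nbhs_ballP[d d0 hd].
have := @cvg_rn R; move/cvgrPdist_lt => /(_ _ d0)[N _ hN].
exists N => n Nn; have := hd (rn R n); rewrite -ball_normE/= => /(_ (hN _ Nn) (rn_lt1 R n)).
by rewrite normE ltcR ncC.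
Qed.

Lemma inner_weakly_inner phi : inner phi -> weakly_inner phi.
Proof.
move=> [[hphi phi1] hae].
have sphi : selfmap phi.
  split; first exact: holo_on_diskP.
  by move=> z z1; apply/in_diskE/phi1/in_diskE.
split => //; have cphi := ccirc_hol sphi.1.
pose F n (t : R) : R := 1 - nc (phi (circ (rn R n) t)) ^+ 2.
have cF n : continuous (F n) by exact: (@rcirc_defect _ _ cphi n).
have F01 n t : 0 <= F n t <= 1.
  have := nc_ge0 (phi (circ (rn R n) t)); have := sphi.2 _ (nc_circ_lt1 n t).
  by rewrite /F; move: (nc _) => x x1 x0; apply/andP; split; nra.
have mD : measurable (`[0, 2 * pi]%classic : set R) by [].
have [| | | | |_ _ lim0] := @dominated_convergence _ _ R mu _ mD
    (fun n t => (F n t)%:E) (fun=> 0%E) (fun=> 1%E).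
- by move=> n; exact: (measurable_int mu (@continuous_integrable R 0 (2 * pi) _ (cF n))).
- exact: measurable_cst.
- case: hae => N [mN N0 sN]; exists N; split => // t ht; apply: sN => hrad; apply: ht => _.
  case: hrad => L [L1 hL].
  have h := radial_limit_clim hL.
  have ncL : nc L = 1 by move: L1; rewrite normE => -[].
  have := clim_nc h; rewrite ncL => h1.
  apply: cvg_EFin; first by apply: nearW.
  rewrite /comp/= [X in _ --> X](_ : 0 = 1 - 1 * 1); last by rewrite mulr1 subrr.
  under eq_fun do rewrite /F expr2.
  apply: cvgB; first exact: cvg_cst.
  exact: cvgM.
- by apply: (@continuous_integrable R 0 (2 * pi) (fun=> 1)) => t; exact: cvg_cst.
- by apply: aeW => t n _; rewrite /= lee_fin ger0_norm; case/andP: (F01 n t).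
have {}lim0 : (fun n => rint 0 (2 * pi) (F n)) @ \oo --> (0 : R).
  rewrite integral0 in lim0.
  exact: (fine_cvg lim0).
rewrite /defect /rm /rmean -[X in _ --> X](mulr0 (2 * pi)^-1).
exact: cvgM (cvg_cst _) lim0.
Qed.

Lemma weakly_inner_le f g (K : R) : selfmap g -> weakly_inner f ->
  (forall z, nc z < 1 -> 1 - nc (g z) ^+ 2 <= K * (1 - nc (f z) ^+ 2)) -> weakly_inner g.
Proof.
move=> sg [sf df] h; split=> //.
apply: (@squeeze0 _ _ (fun n => K * defect f n)); last first.
  by rewrite -[X in _ --> X](mulr0 K); exact: cvgM (cvg_cst _) df.
have cf := @rcirc_defect _ _ (ccirc_hol sf.1); have cg := @rcirc_defect _ _ (ccirc_hol sg.1).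
move=> n; rewrite defect_ge0 ?andTb; last by move=> z /sg.2/ltW.
rewrite /defect /rm -rmeanZ//; apply: rmean_le => //.
  by apply: real_continuousM => // t; exact: cvg_cst.
by move=> t; apply: h; exact: nc_circ_lt1.
Qed.

Lemma mob_defect_le a z : nc a < 1 -> nc z < 1 ->
  1 - nc (mob a z) ^+ 2 <= (1 - nc a)^-1 ^+ 2 * (1 - nc z ^+ 2).
Proof.
move=> a1 z1; rewrite nc_mob ?(ltW z1)//.
have d0 : 0 < 1 - nc a by rewrite subr_gt0.
have z2 : 0 <= 1 - nc z ^+ 2 by rewrite subr_ge0 expr_le1 ?nc_ge0// ltW.
rewrite mulrAC ler_wpM2r//.
have dz : 1 - nc a <= nc (1 - a^*%C * z).
  apply: le_trans (ncB_ge _ _); rewrite nc1 ncM ncJ lerB// ler_piMr ?nc_ge0//.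
  exact: ltW.
have h : (nc (1 - a^*%C * z) ^+ 2)^-1 <= (1 - nc a)^-1 ^+ 2.
  rewrite -exprVn lerXn2r ?nnegrE ?invr_ge0 ?nc_ge0 ?(ltW d0)//.
  by rewrite lef_pV2 ?posrE// (lt_le_trans d0).
apply: le_trans h; rewrite ler_piMl ?invr_ge0 ?exprn_ge0 ?nc_ge0//.
by rewrite gerBl exprn_ge0// nc_ge0.
Qed.

Lemma selfmap_mob a f : nc a < 1 -> selfmap f -> selfmap (fun z => mob a (f z)).
Proof.
move=> a1 [hf f1]; split=> [|z z1]; last by apply: nc_mob_lt1 => //; exact: f1.
by apply: hol_mob_comp => // z /f1/ltW.
Qed.

Lemma weakly_inner_mob a f : nc a < 1 -> weakly_inner f -> weakly_inner (fun z => mob a (f z)).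
Proof.
move=> a1 wf; apply: (weakly_inner_le _ wf) => [|z z1].
  by apply: selfmap_mob => //; case: wf.
by apply: mob_defect_le => //; case: wf => -[_ h] _; exact: h.
Qed.

Lemma weakly_inner_rot k f : nc k = 1 -> weakly_inner f -> weakly_inner (fun z => k * f z).
Proof.
move=> k1 wf; apply: (@weakly_inner_le f _ 1) => // [|z z1].
  case: wf => -[hf f1] _; split=> [|z z1]; last by rewrite ncM k1 mul1r f1.
  by apply: holM => //; exact: hol_cst.
by rewrite ncM k1 !mul1r.
Qed.

Lemma weakly_inner_id : weakly_inner (fun z : C => z).
Proof.
split; first by split => //; exact: hol_id.
have h n : 1 - rn R n ^+ 2 = defect id n.
  rewrite /defect /rm -[LHS]rmean_cst; apply: rmean_eq => t.
  by rewrite nc_circ ?rn_ge0.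
have -> : defect (fun z : C => z) = (fun n => 1 - rn R n ^+ 2) by apply: funext => n; rewrite h.
rewrite [X in _ --> X](_ : 0 = 1 - 1 * 1); last by rewrite mulr1 subrr.
under eq_fun do rewrite expr2.
apply: cvgB; first exact: cvg_cst.
by apply: cvgM; exact: cvg_rn.
Qed.

Lemma weakly_inner_iter phi n : weakly_inner phi -> weakly_inner (iter n phi).
Proof.
move=> wphi; elim: n => [|n IH]; first exact: weakly_inner_id.
have -> : iter n.+1 phi = (fun z => iter n phi (phi z)) by apply: funext => z; rewrite iterSr.
exact: weakly_inner_comp.
Qed.

(** Invariance of the pseudo-hyperbolic distance with the unimodular factor kept explicit: that
    factor is the rotation between consecutive normalisations of the iterates. *)
Lemma mob_mob a b u : nc a < 1 -> nc b < 1 -> nc u < 1 ->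
  mob (mob a b) (mob a u) = (1 - a * b^*%C) / (1 - a^*%C * b) * mob b u.
Proof.
move=> a1 b1 u1.
have d1 := mob_den a1 (ltW b1); have d2 := mob_den a1 (ltW u1).
have d3 := mob_den b1 (ltW u1); have d4 : 1 - a * b^*%C != 0.
  by have := mob_den b1 (ltW a1); rewrite mulrC.
have d5 := mob_den (nc_mob_lt1 a1 b1) (ltW (nc_mob_lt1 a1 u1)).
have d6 : 1 - a^*%C * a != 0 by exact: mob_den (ltW a1).
move: d5; rewrite /mob !cjE => d5; field.
rewrite d1 d2 d3 d4 /=.
apply: contra_neq d5 => h; apply: (mulfI (mulf_neq0 d4 d2)); rewrite mulr0 -[RHS]h.
by field; rewrite d2 d4.
Qed.

Lemma mob_rot k a u : nc k = 1 -> mob (k * a) (k * u) = k * mob a u.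
Proof.
move=> k1; rewrite /mob -mulrBr cjM.
have -> : k^*%C * a^*%C * (k * u) = (k * k^*%C) * (a^*%C * u) by ring.
by rewrite -nc_sqrC k1 expr1n mul1r mulrA.
Qed.

End InnerWeaklyInner.

(** * The linear model *)

Section LinearModel.
Variable R : realType.
Local Notation C := R[i].
Local Notation nc := (@ComplexField.Normc.normc R).
Variables (phi : C -> C) (z0 : C) (l : R).
Hypotheses (wphi : weakly_inner phi) (z01 : nc z0 < 1) (l0 : 0 < l).
Let w n := iter n phi z0.
Let e n := nc (mob (w n) (w n.+1)).
Hypothesis el : e @ \oo --> l.

Let hphi : hol phi. Proof. by case: wphi => -[]. Qed.
Let phi1 z : nc z < 1 -> nc (phi z) < 1. Proof. by case: wphi => -[_ h] _; exact: h. Qed.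
Let iter1 n z : nc z < 1 -> nc (iter n phi z) < 1.
Proof. by move=> z1; elim: n => //= n; exact: phi1. Qed.
Let w1 n : nc (w n) < 1. Proof. exact: iter1. Qed.

Let e_dec n : e n.+1 <= e n.
Proof. exact: (schwarz_pick_mob hphi phi1 (w1 n.+1) (w1 n)). Qed.

Let e_ge n : l <= e n.
Proof.
have dec k : e (n + k)%N <= e n.
  by elim: k => [|k IH]; rewrite ?addn0// addnS (le_trans (e_dec _)).
have <- := cvg_lim (@Rhausdorff R) el; apply: limr_le; first exact: (cvgP _ el).
near=> m; have nm : (n <= m)%N by near: m; exact: nbhs_infty_ge.
by rewrite -(subnKC nm).
Unshelve. all: by end_near. Qed.
Let e_le0 n : e n <= e 0%N.
Proof. by elim: n => // n IH; rewrite (le_trans (e_dec _)). Qed.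
Let e_gt0 n : 0 < e n. Proof. exact: lt_le_trans (e_ge n). Qed.
Let e_lt1 n : e n < 1. Proof. exact: nc_mob_lt1. Qed.
Let l1 : l < 1. Proof. exact: le_lt_trans (e_ge 0) (e_lt1 0). Qed.
Let nce n : nc (e n)%:C%C = e n. Proof. exact/nc_posreal/ltW. Qed.

(** The rotation makes [M n] send [w n.+1] to the positive number [e n]. Hence all renormalised
    iterates take convergent values at the one point [x0], which pins down their rotations. *)
Let m n : C := (e n)^-1%:C%C * (mob (w n) (w n.+1))^*%C.
Let nm n : nc (m n) = 1.
Proof.
rewrite /m ncM ncJ -/(e n) nc_posreal; last by rewrite invr_ge0 ltW.
by rewrite mulVf// gt_eqF.
Qed.
Let mJ n : m n * (m n)^*%C = 1. Proof. by rewrite -nc_sqrC nm expr1n. Qed.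

Let M n u := m n * mob (w n) u.
Let Mi n u := mob (- w n) ((m n)^*%C * u).
Let M1 n u : nc u < 1 -> nc (M n u) < 1.
Proof. by move=> u1; rewrite /M ncM nm mul1r nc_mob_lt1. Qed.
Let Mi1 n u : nc u < 1 -> nc (Mi n u) < 1.
Proof. by move=> u1; apply: nc_mob_lt1; rewrite ?ncN// ncM ncJ nm mul1r. Qed.
Let MK n u : nc u < 1 -> Mi n (M n u) = u.
Proof.
move=> u1; rewrite /M /Mi mulrA (mulrC _^*%C) mJ mul1r mobK//.
Qed.
Let hM n : hol (M n).
Proof. by apply: holM; [exact: hol_cst|exact: hol_mob]. Qed.
Let hMi n : hol (Mi n).
Proof.
apply: (@hol_comp R (fun u => (m n)^*%C * u)) => [|u u1|].
- by apply: holM; [exact: hol_cst|exact: hol_id].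
- by rewrite ncM ncJ nm mul1r.
- by apply: hol_mob; rewrite ncN.
Qed.

Let Me n : M n (w n.+1) = (e n)%:C%C.
Proof.
rewrite /M /m -mulrA (mulrC _^*%C) -nc_sqrC -/(e n) -rcM; congr (_%:C)%C.
by rewrite expr2 mulrA mulVf ?mul1r// gt_eqF.
Qed.

Let g n z := M n (iter n phi z).
(** This is [phi] read in the charts [M n] and [M n.+1]. It fixes 0, so Schwarz's lemma factors it
    as [z * q n z], and the iterates satisfy [g n.+1 = g n * q n (g n)], a product recursion. *)
Let h n u := M n.+1 (phi (Mi n u)).
Let sg n : selfmap (g n).
Proof.
split=> [|z z1]; last exact/M1/iter1.
by apply: hol_comp; [case: (weakly_inner_iter n wphi) => -[]|move=> z; exact: iter1|exact: hM].
Qed.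
Let sh n : selfmap (h n).
Proof.
split=> [|z z1]; last exact/M1/phi1/Mi1.
apply: (hol_comp (f := fun u => phi (Mi n u))) => [|u u1|]; last exact: hM.
  by apply: hol_comp; [exact: hMi|move=> u; exact: Mi1|exact: hphi].
exact/phi1/Mi1.
Qed.
Let h0 n : h n 0 = 0.
Proof. by rewrite /h /Mi mulr0 mob0 opprK /M -[phi (w n)]/(w n.+1) moba mulr0. Qed.
Let gS n z : nc z < 1 -> g n.+1 z = h n (g n z).
Proof. by move=> z1; rewrite /g /h MK//; exact: iter1. Qed.

Let hq n : exists q, hol_bounded q 1 /\ forall z, nc z < 1 -> h n z = z * q z.
Proof. by have [q hq hE] := schwarz (selfmap_bounded (sh n)) (h0 n); exists q. Qed.
Let q n := projT1 (cid (hq n)).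
Let qb n : hol_bounded (q n) 1.
Proof. by rewrite /q; case: cid => /= ? []. Qed.
Let qE n z : nc z < 1 -> h n z = z * q n z.
Proof. by rewrite /q; case: cid => /= ? [_ hE]; exact: hE. Qed.
Let gSq n z : nc z < 1 -> g n.+1 z = g n z * q n (g n z).
Proof. by move=> z1; rewrite gS// qE//; exact: (sg n).2. Qed.

Let x0 := w 1.
Let gx0 n : g n x0 = (e n)%:C%C.
Proof. by rewrite /g /x0 /w -iterD addn1 Me. Qed.
Let qe n : q n (e n)%:C%C = (e n.+1 / e n)%:C%C.
Proof.
have := gSq n (w1 1); rewrite -/x0 !gx0 => hE.
have e0 : (e n)%:C%C != 0 :> C by rewrite -nc_gt0 nce.
by apply: (mulfI e0); rewrite -hE -rcM mulrCA mulfV ?mulr1// gt_eqF.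
Qed.

Let d n := (e n - e n.+1) / l.
Let d0 n : 0 <= d n. Proof. by rewrite divr_ge0 ?subr_ge0// ltW. Qed.
Let qe_near n : 1 - e n.+1 / e n <= d n.
Proof.
have -> : 1 - e n.+1 / e n = (e n - e n.+1) / e n.
  by rewrite mulrBl mulfV// gt_eqF.
by rewrite ler_wpM2l ?subr_ge0// lef_pV2 ?posrE.
Qed.
Let qe01 n : 0 <= e n.+1 / e n <= 1.
Proof.
apply/andP; split; first exact: (divr_ge0 (ltW (e_gt0 _)) (ltW (e_gt0 _))).
by rewrite ler_pdivrMr// mul1r.
Qed.

(** At [x] the function is within [d n] of 1, and [osc] spreads this over the disk; 16 is the 8 of
    [osc] times 2, from [1 - y^2 <= 2 * (1 - y)]. Since [d n] is a multiple of [e n - e n.+1], the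
    bounds are summable in [n]. *)
Let near1 f z x n : hol_bounded f 1 -> nc z < 1 -> nc x < 1 -> f x = (e n.+1 / e n)%:C%C ->
  nc (f z - 1) <= (1 + 16 / ((1 - nc x ^+ 2) * (1 - nc z ^+ 2))) * d n.
Proof.
move=> hf z1 x1 fx.
have A0 : 0 < (1 - nc x ^+ 2) * (1 - nc z ^+ 2).
  by rewrite mulr_gt0// subr_gt0 sqr_lt1 ?nc_ge0.
have /andP[y0 y1] := qe01 n.
have os := osc hf z1 x1; rewrite fx nc_posreal// in os.
have -> : f z - 1 = (f z - (e n.+1 / e n)%:C%C) - (1 - e n.+1 / e n)%:C%C by rewrite rcB rc1; ring.
apply: (le_trans (ncB _ _)); rewrite mulrDl mul1r addrC nc_posreal ?subr_ge0//.
apply: lerD; first exact: qe_near.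
apply: (le_trans os).
have -> : 16 / ((1 - nc x ^+ 2) * (1 - nc z ^+ 2)) * d n =
  8 / ((1 - nc x ^+ 2) * (1 - nc z ^+ 2)) * (2 * d n) by ring.
rewrite ler_wpM2l ?divr_ge0 ?(ltW A0)//.
by move: (qe_near n) y0 y1; move: (e n.+1 / e n) (d n) => y dn; nra.
Qed.

Let Kz z := (1 + 16 / ((1 - nc x0 ^+ 2) * (1 - nc z ^+ 2))) / l.
Let Kz0 z : nc z < 1 -> 0 <= Kz z.
Proof.
move=> z1; have A0 : 0 < (1 - nc x0 ^+ 2) * (1 - nc z ^+ 2).
  by rewrite mulr_gt0// subr_gt0 sqr_lt1 ?nc_ge0 ?(w1 1).
by rewrite divr_ge0 ?(ltW l0)// addr_ge0// divr_ge0// ltW.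
Qed.

Let qg_near n z : nc z < 1 -> nc (q n (g n z) - 1) <= Kz z * (e n - e n.+1).
Proof.
move=> z1; have hqg : hol_bounded (fun z => q n (g n z)) 1.
  split=> [|u u1]; last by apply: (qb n).2; exact: (sg n).2.
  by apply: hol_comp; [exact: (sg n).1|exact: (sg n).2|exact: (qb n).1].
have := @near1 _ z x0 n hqg z1 (w1 1); rewrite gx0 => /(_ (qe n)).
by rewrite /d /Kz mulrA mulrAC.
Qed.

Let g_step n z : nc z < 1 -> nc (g n.+1 z - g n z) <= Kz z * e n - Kz z * e n.+1.
Proof.
move=> z1; rewrite gSq// -mulrBr.
have -> : g n z * q n (g n z) - g n z = g n z * (q n (g n z) - 1) by ring.
rewrite ncM -[leRHS]mul1r; apply: ler_pM; rewrite ?nc_ge0//; last exact: qg_near.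
exact/ltW/(sg n).2.
Qed.

Let g_lim z : exists a, nc z < 1 -> clim (g ^~ z) a /\ forall n, nc (a - g n z) <= Kz z * (e n - l).
Proof.
have [z1|_] := boolP (nc z < 1); last by exists 0.
have vl : (fun n => Kz z * e n) @ \oo --> Kz z * l by exact: cvgM (cvg_cst _) el.
have [a ha hb] := clim_telescope (fun n => g_step n z1) vl.
by exists a => _; split=> // n; rewrite mulrBr.
Qed.

Definition lim_model z := projT1 (cid (g_lim z)).
Let G := lim_model.
Let G_clim z : nc z < 1 -> clim (g ^~ z) (G z).
Proof. by move=> z1; rewrite /G /lim_model; case: cid => /= a /(_ z1)[]. Qed.
Let G_near z n : nc z < 1 -> nc (G z - g n z) <= Kz z * (e n - l).
Proof. by move=> z1; rewrite /G /lim_model; case: cid => /= a /(_ z1)[]. Qed.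

Let Kz_le z r : nc z <= r -> r < 1 -> Kz z <= Kz r%:C%C.
Proof.
move=> zr r1; have r0 : 0 <= r by exact: le_trans (nc_ge0 _) zr.
have A0 : 0 < 1 - nc x0 ^+ 2 by rewrite subr_gt0 sqr_lt1 ?nc_ge0 ?(w1 1).
rewrite /Kz ler_wpM2r ?invr_ge0 ?(ltW l0)// lerD2l ler_wpM2l//.
rewrite nc_posreal// lef_pV2 ?posrE ?mulr_gt0// ?subr_gt0 ?sqr_lt1 ?nc_ge0//; last exact: le_lt_trans r1.
by rewrite ler_pM2l// lerB// lerXn2r ?nnegrE ?nc_ge0.
Qed.

Let el0 n : 0 <= e n - l. Proof. by rewrite subr_ge0. Qed.
Let el_cvg (K : R) : (fun n => K * (e n - l)) @ \oo --> (0 : R).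
Proof.
rewrite -[X in _ --> X](mulr0 K); apply: cvgM; first exact: cvg_cst.
exact/subr_cvg0.
Qed.

Let hG : hol G.
Proof.
apply: (@hol_limit R g) => [n|r r1]; first exact: (sg n).1.
exists (fun n => Kz r%:C%C * (e n - l)); split; first exact: el_cvg.
move=> n z zr; have z1 : nc z < 1 by exact: le_lt_trans r1.
by rewrite ncC (le_trans (G_near n z1))// ler_wpM2r// Kz_le.
Qed.

Let sG : selfmap G.
Proof.
split; first exact: hG.
have Gb : hol_bounded G 1.
  split; first exact: hG.
  by move=> z z1; apply: (clim_le (G_clim z1)) => n; exact/ltW/(sg n).2.
move=> z z1; rewrite lt_neqAle Gb.2// andbT; apply/eqP => Gz.
(* Each [g n] vanishes at [z0], hence so does [G], which rules out a unimodular constant. *)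
have := hol_unimodular_cst Gb z1 Gz z01.
have -> : G z0 = 0.
  apply: clim_unique (G_clim z01) _.
  by apply: clim_eq (clim_cst 0) => n; rewrite /g /M moba mulr0.
by move=> h00; move: Gz; rewrite -h00 nc0 => /eqP; rewrite eq_sym oner_eq0.
Qed.

Let wg n : weakly_inner (g n).
Proof. by apply: weakly_inner_rot => //; apply: weakly_inner_mob => //; exact: weakly_inner_iter. Qed.

Let zero1 : nc (0 : C) < 1. Proof. by rewrite nc0. Qed.

(** The factorisation splits the defect through [1 - x^2 y^2 <= (1 - x^2) + (1 - y^2)]; the defect
    of [q n (g n)] is bounded by its value at the origin, whatever the circle, and these bounds
    telescope. *)
Let defect_step n k : defect (g n.+1) k <= defect (g n) k + 2 * Kz 0 * (e n - e n.+1).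
Proof.
pose qg z := q n (g n z).
have hqg : hol qg by apply: hol_comp; [exact: (sg n).1|exact: (sg n).2|exact: (qb n).1].
apply: (@le_trans _ _ (defect (g n) k + defect qg k)); last first.
  rewrite lerD2l; apply: (le_trans (defect_le _ hqg)).
  have : 1 - nc (qg 0) <= Kz 0 * (e n - e n.+1).
    by apply: le_trans (qg_near n zero1); rewrite ncC -{1}(nc1 R) ncB_ge.
  have : nc (qg 0) <= 1 by apply: (qb n).2; exact: (sg n).2.
  have := nc_ge0 (qg 0); rewrite -mulrA; move: (nc _) (Kz 0 * _) => x y; nra.
have c1 := @rcirc_defect _ _ (ccirc_hol (sg n).1) k.
have c2 := @rcirc_defect _ _ (ccirc_hol (sg n.+1).1) k.
have c3 := @rcirc_defect _ _ (ccirc_hol hqg) k.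
rewrite /defect /rm -rmeanD//; apply: rmean_le => //; first exact: real_continuousD.
move=> t; have t1 := nc_circ_lt1 k t; rewrite gSq// ncM -/(qg _) exprMn.
have : nc (qg (circ (rn R k) t)) <= 1 by apply: (qb n).2; exact: (sg n).2.
have := (sg n).2 _ t1; have := nc_ge0 (qg (circ (rn R k) t)).
have := nc_ge0 (g n (circ (rn R k) t)).
move: (nc (g _ _)) (nc (qg _)) => x y x00 y00 x1 y1.
have hx : x ^+ 2 <= 1 by nra.
have hy : y ^+ 2 <= 1 by nra.
by move: (sqr_ge0 x) (sqr_ge0 y) hx hy; move: (x ^+ 2) (y ^+ 2); intros; nra.
Qed.

(** Locally uniform limits can lose weak innerness, as the powers of [z] show. Here the loss in
    [bnd] is uniform in [k], so [n] may be fixed first and [k] sent to infinity afterwards. *)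
Let wG : weakly_inner G.
Proof.
split; first exact: sG.
have bnd n k : defect G k <= defect (g n) k + 2 * Kz 0 * (e n - l).
  have step j : defect (g (n + j)%N) k <= defect (g n) k + 2 * Kz 0 * (e n - l).
    have : defect (g (n + j)%N) k <= defect (g n) k + 2 * Kz 0 * (e n - e (n + j)%N).
      elim: j => [|j IH]; first by rewrite addn0 subrr mulr0 addr0.
      rewrite addnS (le_trans (defect_step _ _))//.
      by rewrite (le_trans (lerD IH (lexx _)))// -addrA -mulrDr lerD2l addrA subrK.
    move=> hh; apply: (le_trans hh); rewrite lerD2l; apply: ler_wpM2l.
      by rewrite mulr_ge0// Kz0.
    by rewrite lerD2l lerN2.
  apply/ler_addgt0Pr => x x00.
  pose K := Kz (rn R k)%:C%C.
  have x20 : 0 < x / 2 by rewrite divr_gt0.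
  have := el_cvg K => /cvgrPdist_lt/(_ _ x20)[N _ hN].
  have := hN (n + N)%N; rewrite /= leq_addl => /(_ isT); rewrite sub0r normrN.
  move=> /(le_lt_trans (ler_norm _)) hK.
  suff : defect G k <= defect (g (n + N)%N) k + x by have := step N; lra.
  have c1 := @rcirc_defect _ _ (ccirc_hol (sg (n + N)%N).1) k.
  have c2 := @rcirc_defect _ _ (ccirc_hol hG) k.
  have cx : continuous (fun _ : R => x) by move=> t; exact: cvg_cst.
  rewrite /defect /rm -[X in _ <= _ + X]rmean_cst -rmeanD//; apply: rmean_le => //.
    exact: real_continuousD.
  move=> t; have t1 := nc_circ_lt1 k t.
  have := G_near (n + N)%N t1.
  have KK : Kz (circ (rn R k) t) <= K.
    by apply: Kz_le; rewrite ?rn_lt1// nc_circ ?rn_ge0.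
  have : Kz (circ (rn R k) t) * (e (n + N)%N - l) <= K * (e (n + N)%N - l) by rewrite ler_wpM2r.
  have := ncB_ge (g (n + N)%N (circ (rn R k) t)) (G (circ (rn R k) t)); rewrite ncC.
  have := (sg (n + N)%N).2 _ t1; have := sG.2 _ t1.
  have := nc_ge0 (G (circ (rn R k) t)); have := nc_ge0 (g (n + N)%N (circ (rn R k) t)).
  move: (nc (g _ _)) (nc (G _)) (nc (G _ - g _ _)) => a b c a0 b0 b1 a1 h1 h2 h3.
  have h4 : a - b <= x / 2 by lra.
  by nra.
apply/cvgrPdist_lt => x x00; have x20 : 0 < x / 2 by rewrite divr_gt0.
have /cvgrPdist_lt/(_ _ x20)[N _ /(_ N (leqnn N))] := el_cvg (2 * Kz 0).
rewrite /= sub0r normrN => /(le_lt_trans (ler_norm _)) hN.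
have [_ /cvgrPdist_lt/(_ _ x20)[k0 _ hk0]] := wg N.
exists k0 => // k /= /hk0; rewrite /= sub0r normrN => /(le_lt_trans (ler_norm _)) hk.
rewrite sub0r normrN ger0_norm; last by apply: defect_ge0 => z /sG.2/ltW.
by apply: (le_lt_trans (bnd N k)); lra.
Qed.

Let lam n : C := m n * ((1 - w n * (w n.+1)^*%C) / (1 - (w n)^*%C * w n.+1)) * (m n.+1)^*%C.
Let nlam n : nc (lam n) = 1.
Proof.
rewrite /lam ncM ncJ nm mulr1 (ncM (m n)) nm mul1r ncM ncV.
have -> : 1 - w n * (w n.+1)^*%C = (1 - (w n)^*%C * w n.+1)^*%C by rewrite !cjE.
by rewrite ncJ mulfV// nc_eq0 mob_den// ltW.
Qed.

(* M_n and M_(n+1) differ by a Moebius map sending 0 to e_n. *)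
Let M_mob n u : nc u < 1 -> mob (e n)%:C%C (M n u) = lam n * M n.+1 u.
Proof.
move=> u1; rewrite -Me /M mob_rot// mob_mob// /lam.
have := mJ n.+1; move: (m n.+1) (m n) => a b aJ.
rewrite -!mulrA; congr (_ * _); rewrite !mulrA.
by rewrite -[in RHS](mulrA _ a^*%C) (mulrC a^*%C) aJ mulr1 mulrAC.
Qed.

(** At the points [iter n.+1 phi x0] the map [M n.+1] takes the value [e n.+1], bounded away from 0,
    so [M_mob] expresses [lam n] through convergent quantities. *)
Let lam_lim : exists2 L, nc L = 1 & clim lam L.
Proof.
have x01 : nc x0 < 1 := w1 1.
have px01 := phi1 x01.
have E n : lam n = mob (e n)%:C%C (g n (phi x0)) / (e n.+1)%:C%C.
  have e0 : (e n.+1)%:C%C != 0 :> C by rewrite -nc_gt0 nce.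
  apply: (mulIf e0); rewrite divfK// -gx0 /g -M_mob ?iter1//.
  by rewrite -iterS iterSr.
have cE : clim lam (mob l%:C%C (G (phi x0)) / l%:C%C).
  have ce : clim (fun n => (e n)%:C%C) l%:C%C by exact: clim_real.
  apply: (@clim_eq R (fun n => mob (e n)%:C%C (g n (phi x0)) / (e n.+1)%:C%C)) => [n|].
    by rewrite E.
  apply: climM; last first.
    apply: climV; first by rewrite -nc_gt0 nc_posreal ?(ltW l0).
    exact: (clim_shift ce).
  have cg := G_clim px01.
  apply: climM; first exact: climB.
  apply: climV; last first.
    apply: climB; first exact: clim_cst.
    by apply: climM => //; exact: climJ.
  apply: mob_den; first by rewrite nc_posreal ?(ltW l0).
  exact/ltW/sG.2.
eexists; last exact: cE.
have := clim_nc cE; under eq_fun do rewrite nlam.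
by move=> hc; apply: (@cvg_unique _ (@Rhausdorff R) _ _ _ _ hc); exact: cvg_cst.
Qed.

Let semiconj L z : clim lam L -> nc z < 1 -> mob l%:C%C (G (phi z)) = L * G z.
Proof.
move=> cL z1; have pz1 := phi1 z1.
have ce : clim (fun n => (e n)%:C%C) l%:C%C by exact: clim_real.
apply: (@clim_unique R (fun n => mob (e n)%:C%C (g n (phi z)))).
  have cg := G_clim pz1.
  apply: climM; first exact: climB.
  apply: climV; last first.
    apply: climB; first exact: clim_cst.
    by apply: climM => //; exact: climJ.
  apply: mob_den; first by rewrite nc_posreal ?(ltW l0).
  exact/ltW/sG.2.
apply: clim_eq (climM cL (clim_shift (G_clim z1))) => n.
by rewrite /g -M_mob ?iter1// -iterSr.
Qed.

(* If the limiting Moebius map had a fixed point in the disk, its fixed point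
   equation would be a locally uniform limit of fixed point equations for
   conjugates of phi, which have no solution. *)
Let not_elliptic L p : clim lam L -> (forall z, nc z < 1 -> phi z != z) -> nc p < 1 ->
  L * p + l%:C%C - p * (1 + l%:C%C * L * p) != 0.
Proof.
move=> cL nofix p1; apply/eqP => Dp0.
pose hh n u := lam n * (u * q n u).
(* The fixed point equation of [M n \o phi \o Mi n] with denominators cleared; [Dl] is its limit. *)
pose D n u := hh n u + (e n)%:C%C - u * (1 + (e n)%:C%C * hh n u).
pose Dl u := L * u + l%:C%C - u * (1 + l%:C%C * L * u).
have nL : nc L = 1.
  have := clim_nc cL; under eq_fun do rewrite nlam.
  by move=> hc; apply: (@cvg_unique _ (@Rhausdorff R) _ _ _ _ hc); exact: cvg_cst.
have hD n : hol (D n).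
  have hhh : hol (hh n).
    apply: holM; first exact: hol_cst.
    by apply: holM; [exact: hol_id|exact: (qb n).1].
  apply: holB; first by apply: holD => //; exact: hol_cst.
  apply: holM; first exact: hol_id.
  apply: holD; first exact: hol_cst.
  by apply: holM => //; exact: hol_cst.
have D_neq0 n u : nc u < 1 -> D n u != 0.
  move=> u1; apply/eqP => Du.
  have v1 : nc (Mi n u) < 1 by exact: Mi1.
  have pv1 := phi1 v1.
  pose y := M n (phi (Mi n u)).
  have y1 : nc y < 1 by exact: M1.
  have yE : mob (e n)%:C%C y = hh n u.
    by rewrite /hh -qE// /h -M_mob.
  have e1 : nc (e n)%:C%C < 1 by rewrite nce.
  have dy := mob_den e1 (ltW y1).
  have : y = u.
    have hy : (y - (e n)%:C%C) = hh n u * (1 - (e n)%:C%C * y).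
      by rewrite -yE /mob cjR in dy *; rewrite divfK.
    have hu1 : nc (hh n u) < 1 by rewrite -yE nc_mob_lt1.
    have dh : 1 + (e n)%:C%C * hh n u != 0.
      have := @mob_den R (- (e n)%:C%C) (hh n u); rewrite ncN cjN cjR mulNr opprK; apply => //.
      exact: ltW.
    apply: (mulIf dh).
    have -> : u * (1 + (e n)%:C%C * hh n u) = hh n u + (e n)%:C%C.
      by apply/eqP; rewrite -subr_eq0 -oppr_eq0 opprB; exact/eqP.
    have -> : y * (1 + (e n)%:C%C * hh n u) = (y - (e n)%:C%C) + (e n)%:C%C + y * ((e n)%:C%C * hh n u) by ring.
    by rewrite hy; ring.
  move=> yu; have := nofix _ v1; rewrite -{2}yu /y MK// eqxx.
  by [].
have p0 : p != 0.
  apply/eqP => p00; move: Dp0; rewrite p00 !mulr0 mul0r subr0 add0r => /eqP.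
  by rewrite -nc_eq0 nc_posreal ?(ltW l0)// gt_eqF.
have L0 : L != 0 by rewrite -nc_gt0 nL.
(* The roots of the quadratic [Dl] have product [- L^-1], so the companion of [p] is [- (L * p)^-1],
   outside the closed disk. This gives a lower bound for [Dl] on a circle around the origin
   enclosing [p]. *)
have fac u : Dl u = - (l%:C%C * L) * (u - p) * (u + (L * p)^-1).
  have LE : L - 1 = l%:C%C * L * p - l%:C%C / p.
    apply: (mulIf p0); rewrite [RHS]mulrBl divfK//.
    by apply/eqP; rewrite -subr_eq0; apply/eqP; rewrite -Dp0; ring.
  have -> : Dl u = - (l%:C%C * L) * u ^+ 2 + (L - 1) * u + l%:C%C by rewrite /Dl; ring.
  by rewrite LE; field; rewrite p0 L0.
pose r := (1 + nc p) / 2.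
have r0 : 0 < r by rewrite /r; have := nc_ge0 p; lra.
have r1 : r < 1 by rewrite /r; lra.
have pr : nc p < r by rewrite /r; lra.
pose del := l * (r - nc p) * (1 - r).
have del0 : 0 < del by rewrite !mulr_gt0// subr_gt0.
have Dl_ge t : del <= nc (Dl (circ r t)).
  have ncr : nc (circ r t) = r by rewrite nc_circ// ltW.
  rewrite fac !ncM ncN ncM nL mulr1 nc_posreal ?(ltW l0)//.
  apply: ler_pM; rewrite ?mulr_ge0 ?(ltW l0) ?subr_ge0 ?(ltW pr) ?(ltW r1)//.
    by rewrite ler_pM2l//; have := ncB_ge (circ r t) p; rewrite ncr.
  have : nc (L * p)^-1 - nc (circ r t) <= nc (circ r t + (L * p)^-1).
    by have := ncB_ge (L * p)^-1 (- circ r t); rewrite ncN opprK (addrC (L * p)^-1).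
  apply: le_trans; rewrite ncr lerB// ncV ncM nL mul1r -[leLHS]invr1.
  by rewrite lef_pV2 ?posrE ?nc_gt0// ltW.
have [K Kq] : exists K : R, forall n u, nc u <= r -> nc (q n u - 1) <= K * d n.
  exists (1 + 16 / ((1 - e 0%N ^+ 2) * (1 - r ^+ 2))) => n u ur.
  have u1 : nc u < 1 by exact: le_lt_trans r1.
  have en1 : nc (e n)%:C%C < 1 by rewrite nce.
  apply: (le_trans (near1 (qb n) u1 en1 (qe n))).
  rewrite ler_wpM2r// lerD2l ler_wpM2l// lef_pV2 ?posrE ?mulr_gt0 ?subr_gt0 ?sqr_lt1 ?nc_ge0 ?(ltW r0) ?(ltW (e_gt0 0))//.
  apply: ler_pM; rewrite ?subr_ge0 ?expr_le1 ?(ltW r0) ?(ltW r1) ?(ltW (e_gt0 0)) ?(ltW (e_lt1 0))//.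
    by rewrite nce lerB// lerXn2r ?nnegrE ?(ltW (e_gt0 _)).
  by rewrite lerB// lerXn2r ?nnegrE ?nc_ge0 ?(ltW r0).
have dlim : (fun n => K * d n) @ \oo --> (0 : R).
  rewrite -[X in _ --> X](mulr0 K); apply: cvgM; first exact: cvg_cst.
  rewrite [X in _ --> X](_ : 0 = (l - l) / l); last by rewrite subrr mul0r.
  apply: cvgM; last exact: cvg_cst.
  apply: cvgB; first exact: el.
  by have := el; rewrite -(cvg_shiftS e).
pose err n := 2 * (nc (lam n - L) + K * d n) + 2 * (e n - l).
have errlim : err @ \oo --> (0 : R).
  rewrite [X in _ --> X](_ : 0 = 2 * (0 + 0) + 0); last by rewrite !addr0 mulr0.
  apply: cvgD; last exact: el_cvg.
  apply: cvgM; first exact: cvg_cst.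
  by apply: cvgD; [exact: cL|exact: dlim].
have Dn n u : nc u <= r -> nc (D n u - Dl u) <= err n.
  move=> ur; have u1 : nc u < 1 by exact: le_lt_trans r1.
  have hhE : nc (hh n u - L * u) <= nc (lam n - L) + K * d n.
    have -> : hh n u - L * u = u * ((lam n - L) + lam n * (q n u - 1)) by rewrite /hh; ring.
    rewrite ncM -[leRHS]mul1r; apply: ler_pM; rewrite ?nc_ge0 ?(ltW u1)//.
    by apply: (le_trans (ncD _ _)); rewrite lerD2l ncM nlam mul1r Kq.
  have -> : D n u - Dl u = (1 - u * (e n)%:C%C) * (hh n u - L * u) + (e n - l)%:C%C * (1 - u * (L * u)).
    by rewrite /D /Dl rcB; ring.
  apply: (le_trans (ncD _ _)); apply: lerD.
    rewrite ncM; apply: ler_pM; rewrite ?nc_ge0//.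
    rewrite (le_trans (ncB _ _))// nc1 ncM nce.
    by have := e_lt1 n; have := e_gt0 n; have := nc_ge0 u; nra.
  rewrite ncM nc_posreal// mulrC ler_wpM2r//.
  rewrite (le_trans (ncB _ _))// nc1 !ncM nL.
  by have := nc_ge0 u; nra.
pose x := del / 4; have x00 : 0 < x by rewrite divr_gt0.
have /cvgrPdist_lt/(_ _ x00)[N _ /(_ N (leqnn N))] := errlim.
rewrite /= sub0r normrN => /(le_lt_trans (ler_norm _)) hN.
(* Hurwitz's argument: the maximum principle for [1 / D N] bounds [D N p] below by [del / 2],
   whereas [D N p] is close to [Dl p = 0]. *)
have hinv : hol (fun u => (D N u)^-1) by apply: holV => // u; exact: D_neq0.
have : nc (D N p)^-1 <= (del / 2)^-1.
  apply: (max_principle hinv r1 pr) => t.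
  have ctr : nc (circ r t) <= r by rewrite nc_circ// ltW.
  have ct1 : nc (circ r t) < 1 by exact: le_lt_trans r1.
  rewrite ncV lef_pV2 ?posrE ?nc_gt0 ?D_neq0// ?divr_gt0//.
  have := Dl_ge t; have := Dn N _ ctr; have := ncB_ge (Dl (circ r t)) (D N (circ r t)).
  by rewrite (ncC (Dl _)) /x in hN *; lra.
rewrite ncV lef_pV2 ?posrE ?nc_gt0 ?D_neq0// ?divr_gt0// => hdel.
have := Dn N p (ltW pr); have -> : Dl p = 0 by [].
by rewrite subr0 /x in hN *; lra.
Qed.

Lemma linear_model : exists G L, [/\ weakly_inner G, nc L = 1, l < 1,
  (forall z, nc z < 1 -> mob l%:C%C (G (phi z)) = L * G z) &
  ((forall z, nc z < 1 -> phi z != z) -> forall p, nc p < 1 ->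
    L * p + l%:C%C - p * (1 + l%:C%C * L * p) != 0)].
Proof.
have [L nL cL] := lam_lim; exists G, L; split => //.
  by move=> z; exact: semiconj.
by move=> nofix p; exact: not_elliptic.
Qed.

End LinearModel.

(** * A criterion for Blaschke products *)

Section BlaschkeCriterion.
Variable R : realType.
Local Notation C := R[i].
Local Notation nc := (@ComplexField.Normc.normc R).
Local Notation Re := (@complex.Re R).
Local Notation Im := (@complex.Im R).
Implicit Types (f F : C -> C) (z w a : C).

Lemma continuous_ln_nc (u : R -> C) : ccont u -> (forall t, u t != 0) ->
  continuous (fun t => ln (nc (u t))).
Proof.
move=> cu u0 t; apply: (@continuous_comp R R R (fun t => nc (u t)) (@ln R)).
  exact: (ccont_nc cu).
by apply: continuous_ln; rewrite nc_gt0.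
Qed.

Lemma ln_le_sqr (x : R) : 0 < x -> ln x <= (x ^+ 2 - 1) / 2.
Proof.
move=> x0; have x20 : 0 < x ^+ 2 by rewrite exprn_gt0.
have : ln (x ^+ 2) <= x ^+ 2 - 1.
  by rewrite -{1}(subrK 1 (x ^+ 2)) addrC le_ln1Dx//; lra.
by rewrite lnXn// mulr2n; lra.
Qed.

Lemma nc_cscale (s : R) z : 0 <= s <= 1 -> nc (s%:C%C * z) <= nc z.
Proof.
by move=> /andP[s0 s1]; rewrite ncM nc_posreal// ler_piMl ?nc_ge0.
Qed.

(* One half of Jensen's formula; the increments of the radial means of ln|F| are
   controlled to second order since F(s'z)/F(sz) has mean value 1. *)
Lemma mean_ln_zero_free F r : hol F -> (forall z, nc z < 1 -> F z != 0) -> 0 <= r -> r < 1 ->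
  rmean (fun t => ln (nc (F (circ r t)))) <= ln (nc (F 0)).
Proof.
move=> hF F0 r0 r1.
have hV := holV hF F0.
have [B B0 FB] := hol_local_bound hV r0 r1.
have [K K0 FK] := hol_locally_lipschitz hF r0 r1.
pose E (s : R) := rmean (fun t => ln (nc (F (s%:C%C * circ r t)))).
have s01 (s : R) t : 0 <= s <= 1 -> nc (s%:C%C * circ r t) <= r.
  by move=> s01; apply: (le_trans (nc_cscale _ s01)); rewrite nc_circ.
have hFs (s : R) : 0 <= s <= 1 -> hol (fun z => F (s%:C%C * z)).
  move=> s1; apply: (hol_comp (f := fun z => s%:C%C * z)) => // [|z z1].
    by apply: holM; [exact: hol_cst|exact: hol_id].
  exact: le_lt_trans (nc_cscale _ s1) z1.
have Fs0 (s : R) z : 0 <= s <= 1 -> nc z < 1 -> F (s%:C%C * z) != 0.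
  by move=> s1 z1; apply: F0; exact: le_lt_trans (nc_cscale _ s1) z1.
have ccs (k : R) : continuous (fun _ : R => k) by move=> t; exact: cvg_cst.
have step (s s' : R) : 0 <= s <= 1 -> 0 <= s' <= 1 ->
    E s' - E s <= (K * B) ^+ 2 / 2 * (s' - s) ^+ 2.
  move=> s1 s'1.
  pose X z := F (s'%:C%C * z) * (F (s%:C%C * z))^-1.
  have hX : hol X.
    by apply: holM; [exact: hFs|apply: holV => [|z z1]; [exact: hFs|exact: Fs0]].
  have circ1 t : nc (circ r t) < 1 by rewrite nc_circ.
  have X0 z : nc z < 1 -> X z != 0.
    by move=> z1; rewrite mulf_neq0 ?invr_eq0 ?Fs0.
  have cX := ccont_hol hX r0 r1.
  have cX1 : ccont (fun t => X (circ r t) - 1) by apply: ccontB => //; exact: ccont_cst.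
  have cX2 : continuous (fun t => nc (X (circ r t) - 1) ^+ 2).
    under [Y in continuous Y]eq_fun do rewrite expr2.
    by apply: real_continuousM; exact: ccont_nc.
  have -> : E s' - E s = rmean (fun t => ln (nc (X (circ r t)))).
    rewrite /E -rmeanB.
    - apply: rmean_eq => t; rewrite /X ncM ncV -ln_div ?posrE ?nc_gt0 ?Fs0//.
    - apply: continuous_ln_nc => [|t]; last exact: Fs0.
      exact: (ccont_hol (hFs _ s'1) r0 r1).
    - apply: continuous_ln_nc => [|t]; last exact: Fs0.
      exact: (ccont_hol (hFs _ s1) r0 r1).
  apply: (@le_trans _ _ (rmean (fun t => Re (X (circ r t) - 1) + 2^-1 * nc (X (circ r t) - 1) ^+ 2))).
    apply: rmean_le => [||t].
    - by apply: continuous_ln_nc => // t; exact: X0.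
    - by apply: real_continuousD; [exact: ccont_Re|exact: real_continuousM].
    apply: (le_trans (ln_le_sqr _)); first by rewrite nc_gt0 X0.
    move: (X _) => Y; rewrite !nc_sqr !ReImE; move: (Re Y) (Im Y) => x y.
    have -> : (x ^+ 2 + y ^+ 2 - 1) / 2 = x - 1 + 2^-1 * ((x - 1) ^+ 2 + (y - 0) ^+ 2) by field.
    exact: lexx.
  rewrite rmeanD; [|exact: ccont_Re|exact: real_continuousM].
  rewrite -Re_cmean cmeanB//; last exact: ccont_cst.
  rewrite cmean_cst mean_value// {1}/X !mulr0 mulfV ?F0 ?nc0// subrr/= add0r.
  rewrite rmeanZ// -[leRHS]rmean_cst -rmeanZ//; apply: rmean_le => //; first exact: real_continuousM.
  move=> t.
  have h : nc (X (circ r t) - 1) <= K * B * `|s' - s|.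
    have -> : X (circ r t) - 1 = (F (s'%:C%C * circ r t) - F (s%:C%C * circ r t)) / F (s%:C%C * circ r t).
      by rewrite /X mulrBl divff// Fs0.
    rewrite ncM.
    have h1 := FB _ (s01 s t s1).
    have h2 := FK _ _ (s01 s' t s'1) (s01 s t s1).
    have h3 : nc (s'%:C%C * circ r t - s%:C%C * circ r t) <= `|s' - s|.
      by rewrite -mulrBl -rcB ncM nc_real nc_circ// ler_piMr// ltW.
    rewrite mulrAC; apply: ler_pM; rewrite ?nc_ge0//.
    by apply: (le_trans h2); rewrite ler_pM2l.
  have : nc (X (circ r t) - 1) ^+ 2 <= (K * B * `|s' - s|) ^+ 2.
    by rewrite lerXn2r ?nnegrE ?nc_ge0// !mulr_ge0// ltW.
  rewrite exprMn real_normK ?num_real//; lra.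
have -> : rmean (fun t => ln (nc (F (circ r t)))) = E 1.
  by apply: rmean_eq => t; rewrite mul1r.
have -> : ln (nc (F 0)) = E 0.
  rewrite /E -[LHS]rmean_cst; apply: rmean_eq => t; by rewrite mul0r.
pose A := (K * B) ^+ 2 / 2.
have A0 : 0 <= A by rewrite divr_ge0// sqr_ge0.
have tel N : E 1 - E 0 <= A * N.+1%:R^-1.
  pose s j : R := j%:R / N.+1%:R.
  have N0 : (0 : R) < N.+1%:R by [].
  have sj j : (j <= N.+1)%N -> 0 <= s j <= 1.
    by move=> jN; rewrite /s divr_ge0//= ler_pdivrMr// mul1r ler_nat.
  have ind j : (j <= N.+1)%N -> E (s j) - E 0 <= A * (j%:R / N.+1%:R ^+ 2).
    elim: j => [|j IH] jN.
      by rewrite /s mul0r subrr mul0r mulr0.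
    have h := step _ _ (sj _ (ltnW jN)) (sj _ jN).
    have e1 : s j.+1 - s j = N.+1%:R^-1.
      by rewrite /s -mulrBl -natr1 addrAC subrr add0r mul1r.
    rewrite e1 exprVn -/A in h.
    have -> : A * (j.+1%:R / N.+1%:R ^+ 2) = A * (j%:R / N.+1%:R ^+ 2) + A * (N.+1%:R ^+ 2)^-1.
      by rewrite -natr1; ring.
    rewrite -(subrKA (E (s j))) addrC; apply: lerD h; exact: IH (ltnW jN).
  have Nn0 : (N.+1%:R : R) != 0 by rewrite pnatr_eq0.
  have sN : s N.+1 = 1 by exact: divff.
  have e2 : N.+1%:R / N.+1%:R ^+ 2 = N.+1%:R^-1 :> R by rewrite expr2 invfM mulrA divff// mul1r.
  by have := ind N.+1 (leqnn _); rewrite sN e2.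
rewrite -subr_le0; apply/ler_addgt0Pr => x x0; rewrite add0r.
have : (fun n => A * @harmonic R n) @ \oo --> (0 : R).
  by rewrite -[X in _ --> X](mulr0 A); exact: cvgM (cvg_cst _) cvg_harmonic.
move=> /cvgrPdist_lt/(_ _ x0)[N _ /(_ N (leqnn N))] /=.
rewrite sub0r normrN => /(le_lt_trans (ler_norm _)) h.
exact: le_trans (tel N) (ltW h).
Qed.

Lemma bfE a z : a != 0 -> blaschke_factor (Some a) z = - ((nc a)%:C%C / a) * mob a z.
Proof.
move=> a0; rewrite /blaschke_factor (negbTE a0) /mob normE -[Num.conj a]/(a^*%C).
by rewrite -(opprB z a) !mulNr mulrN.
Qed.

Lemma nc_phase a : a != 0 -> nc ((nc a)%:C%C / a) = 1.
Proof. by move=> a0; rewrite ncM ncV nc_posreal ?nc_ge0// mulfV// nc_eq0. Qed.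

Lemma divide_zero F a : hol_bounded F 1 -> nc a < 1 -> a != 0 -> F a = 0 ->
  exists2 F1, hol_bounded F1 1 & forall z, nc z < 1 -> F z = blaschke_factor (Some a) z * F1 z.
Proof.
move=> [hF F1] a1 a0 Fa; have Na1 : nc (- a) < 1 by rewrite ncN.
have hb : hol_bounded (fun u => F (mob (- a) u)) 1.
  split=> [|u u1]; last exact/F1/nc_mob_lt1.
  by apply: hol_comp; [exact: hol_mob|move=> u; exact: nc_mob_lt1|exact: hF].
have [|q [hq q1] qE] := schwarz hb; first by rewrite mob0 opprK.
pose k := - ((nc a)%:C%C / a).
have k1 : nc k = 1 by rewrite /k ncN nc_phase.
have k0 : k != 0 by rewrite -nc_gt0 k1.
exists (fun z => k^-1 * q (mob a z)).
  split=> [|z z1].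
    apply: holM; first exact: hol_cst.
    by apply: hol_comp; [exact: hol_mob|move=> u; exact: nc_mob_lt1|exact: hq].
  by rewrite ncM ncV k1 invr1 mul1r q1// nc_mob_lt1.
move=> z z1; rewrite bfE// -/k mulrACA mulfV// mul1r -qE ?nc_mob_lt1//.
by rewrite mobK.
Qed.

Definition admissible F := hol_bounded F 1 /\ F 0 != 0.

(** The last clause forces a zero to be divided out whenever the closed disk of radius [rn R n]
    contains one. Which zero is taken is immaterial: if zeros persisted in a smaller disk, the
    moduli of those removed would violate the Blaschke condition. *)
Definition split_zero n F (p : option C * (C -> C)) :=
  [/\ admissible p.2, (forall z, nc z < 1 -> F z = blaschke_factor p.1 z * p.2 z),
      (forall x, p.1 = Some x -> nc x < 1 /\ x != 0) &
      ((exists z, nc z <= rn R n /\ F z = 0) -> exists x, p.1 = Some x /\ nc x <= rn R n)].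

Lemma split_zero_ex n F : admissible F -> exists p, split_zero n F p.
Proof.
move=> [hF F0]; have [[a [ar Fa]]|no] := pselect (exists z, nc z <= rn R n /\ F z = 0); last first.
  by exists (None, F); split => //= z z1; rewrite mul1r.
have a1 : nc a < 1 by exact: le_lt_trans (rn_lt1 R n).
have a0 : a != 0 by apply/eqP => a00; move: Fa F0; rewrite a00 => ->; rewrite eqxx.
have [F1 hF1 FE] := divide_zero hF a1 a0 Fa.
exists (Some a, F1); split => //=.
- split => //; apply: contra_neq F0 => h; by rewrite FE ?nc0// h mulr0.
- by move=> x [<-].
- by move=> _; exists a.
Qed.

Section Enumeration.
Variable F : C -> C.
Hypothesis aF : admissible F.

Let next n F := xget (None, F) [set p | split_zero n F p].
Let Fs := fix Fs n := if n is k.+1 then (next k (Fs k)).2 else F.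
Let a n := (next n (Fs n)).1.
Let Fs_adm n : admissible (Fs n).
Proof.
elim: n => [//|n IH] /=; have [p hp] := split_zero_ex n IH.
by rewrite /next; case: xgetP => [x -> []//|/(_ p)/(_ hp)].
Qed.
Let sp n : split_zero n (Fs n) (a n, Fs n.+1).
Proof.
have [p hp] := split_zero_ex n (Fs_adm n).
rewrite /a /=; set x := next _ _; have -> : (x.1, x.2) = x by case: (x).
by rewrite /x /next; case: xgetP => [y -> //|/(_ p)/(_ hp)].
Qed.

Let al n : R := if a n is Some x then nc x else 1.
Let al01 n : 0 < al n <= 1.
Proof.
rewrite /al; case E: (a n) => [x|]; last by rewrite ltr01 lexx.
by have [_ _ /(_ x E)[x1 x0] _] := sp n; rewrite nc_gt0 x0 ltW.
Qed.

Let bf0 n : blaschke_factor (a n) 0 = (al n)%:C%C.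
Proof.
rewrite /al; case E: (a n) => [x|//].
have [_ _ /(_ x E)[x1 x0] _] := sp n; rewrite bfE// mob0 mulrNN divfK//.
Qed.

Let ncbf n z : nc z < 1 -> nc (blaschke_factor (a n) z) <= 1.
Proof.
move=> z1; case E: (a n) => [x|]; last by rewrite /blaschke_factor nc1.
have [_ _ /(_ x E)[x1 x0] _] := sp n.
by rewrite bfE// ncM ncN nc_phase// mul1r nc_mob_le1// ltW.
Qed.

Let P n z := \prod_(i < n) blaschke_factor (a i) z.
Let FP n z : nc z < 1 -> F z = P n z * Fs n z.
Proof.
move=> z1; elim: n => [|n IH]; first by rewrite /P big_ord0 mul1r.
rewrite IH /P big_ord_recr/= -mulrA; congr (_ * _).
by have [_ /(_ _ z1)] := sp n.
Qed.
Let ncP n z : nc z < 1 -> nc (P n z) <= 1.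
Proof.
move=> z1; rewrite /P nc_prod; apply: prodr_ile1 => i _.
by rewrite nc_ge0 ncbf.
Qed.
Let zero1 : nc (0 : C) < 1. Proof. by rewrite nc0. Qed.

Let f0 := nc (F 0).
Let f00 : 0 < f0. Proof. by rewrite nc_gt0; case: aF. Qed.
Let T n := \sum_(i < n) (1 - al i).

(** The Blaschke condition: [al i <= expR (al i - 1)] turns the lower bound [f0] on the product of
    the moduli at the origin into an upper bound on the sum. *)
Let T_bound n : T n <= - ln f0.
Proof.
have h : f0 <= expR (- T n).
  apply: (@le_trans _ _ (nc (P n 0))).
    rewrite /f0 (FP n zero1) ncM ler_piMr ?nc_ge0//.
    by case: (Fs_adm n) => -[_ h] _; exact: h.
  rewrite /P /T nc_prod; elim: n => [|n IH]; first by rewrite !big_ord0 oppr0 expR0.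
  rewrite !big_ord_recr/= opprD expRD; apply: ler_pM => //.
  - by apply: prodr_ge0 => i _; exact: nc_ge0.
  - exact: nc_ge0.
  have /andP[a0 _] := al01 n.
  rewrite bf0 nc_posreal ?(ltW a0)// opprB; apply: le_trans (expR_ge1Dx _); lra.
by move: h; rewrite -ler_ln ?posrE ?expR_gt0// expRK lerNr.
Qed.

Let T_series : T = series (fun n => 1 - al n).
Proof. by apply: funext => n; rewrite /T /series/= big_mkord. Qed.

Let T_cvg : cvgn T.
Proof.
apply: nondecreasing_is_cvgn.
  apply/nondecreasing_seqP => n; rewrite /T big_ord_recr/= lerDl subr_ge0.
  by have /andP[] := al01 n.
by exists (- ln f0) => _ [n _ <-]; exact: T_bound.
Qed.

(* Otherwise 1 - |a_n| >= 1/(n+2) for all large n, and the harmonic series diverges. *)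
Let zero_free_eventually rho : rho < 1 -> exists n, forall z, nc z < rho -> Fs n z != 0.
Proof.
move=> rho1; apply: contrapT => hno.
have hz n : exists z, nc z < rho /\ Fs n z = 0.
  apply: contrapT => h; apply: hno; exists n => z zr; apply/eqP => Fz.
  by apply: h; exists z.
have [n1 hn1] : exists n1, forall n, (n1 <= n)%N -> rho <= rn R n.
  have r0 : 0 < 1 - rho by rewrite subr_gt0.
  have /cvgrPdist_lt/(_ _ r0)[n1 _ h] := @cvg_rn R.
  exists n1 => n /h /= /(le_lt_trans (ler_norm _)); lra.
have al_le n : (n1 <= n)%N -> (n.+2%:R)^-1 <= 1 - al n.
  move=> n1n; have [_ _ _ hs] := sp n.
  have [|x [ax xr]] := hs.
    by have [z [zr Fz]] := hz n; exists z; split => //; apply: ltW; exact: lt_le_trans (hn1 _ n1n).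
  by rewrite /al; rewrite /= in ax; rewrite ax lerBrDr addrC -lerBrDr.
(* Within [8^-1] of the limit, [T M] and [T (M + M)] differ by less than [1 / 4], whereas [M] terms
   of size at least [1 / (2 M + 1)] add up to at least [1 / 3]. *)
have /cvgrPdist_lt/(_ (8^-1) _)[|N _ hN] := T_cvg; first by [].
pose M := (maxn (maxn N n1) 1)%N.
have MN : (N <= M)%N by rewrite /M !leq_max leqnn.
have Mn1 : (n1 <= M)%N by rewrite /M !leq_max leqnn orbT.
have M1 : (1 <= M)%N by rewrite /M leq_max leqnn orbT.
have h1 := hN M MN; have h2 := hN (M + M)%N (leq_trans MN (leq_addr _ _)).
have low : (3^-1 : R) <= T (M + M)%N - T M.
  have -> : T (M + M)%N - T M = \sum_(i < M) (1 - al (M + i)%N).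
    by rewrite /T big_split_ord/= addrAC subrr add0r.
  apply: (@le_trans _ _ (\sum_(i < M) ((M + M).+1%:R)^-1)).
    rewrite sumr_const card_ord -[leRHS]mulr_natl ler_pdivlMr//.
    have : (1 : R) <= M%:R by rewrite ler1n.
    have -> : ((M + M).+1%:R : R) = M%:R + M%:R + 1 by rewrite -natr1 natrD.
    by lra.
  apply: ler_sum => i _; apply: le_trans (al_le _ (leq_trans Mn1 (leq_addr _ _))).
  by rewrite lef_pV2 ?posrE// ler_nat !ltnS -addnS leq_add2l.
move: h1 h2 low; rewrite /= !ltr_norml => /andP[? ?] /andP[? ?] ?; lra.
Qed.

Let Fs_mono n m z : nc z < 1 -> (n <= m)%N -> nc (Fs n z) <= nc (Fs m z).
Proof.
move=> z1 /subnKC <-; elim: (m - n)%N => [|k IH]; first by rewrite addn0.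
apply: (le_trans IH); rewrite addnS; have [_ /(_ _ z1) -> _ _] := sp (n + k)%N.
by rewrite ncM ler_piMl ?nc_ge0 ?ncbf.
Qed.

(** Smallness of the circular mean of [- ln |F|] as a lower integral: it is tested on nonnegative
    continuous minorants, so integrability of the logarithm at zeros of [F] is not at issue. *)
Hypothesis small_mean : forall x : R, 0 < x -> exists2 r, 0 <= r < 1 &
  forall v : R -> R, continuous v -> (forall t, 0 <= v t) ->
    (forall t, F (circ r t) != 0 -> v t <= - ln (nc (F (circ r t)))) -> rmean v <= x.

(** Once the zeros in a disk are divided out, [mean_ln_zero_free], rescaled to that disk, bounds
    [- ln |Fs n0 0|] by the mean of [- ln |Fs n0|]. This is at most [- ln |F|] pointwise, since
    dividing by Blaschke factors increases the modulus. *)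
Let Fs_lim : (fun n => nc (Fs n 0)) @ \oo --> (1 : R).
Proof.
apply/cvgrPdist_lt => x x0.
have Fs1 n : nc (Fs n 0) <= 1 by case: (Fs_adm n) => -[_ h] _; exact: h.
have x20 : 0 < x / 2 by rewrite divr_gt0.
have [r /andP[r0 r1] hv] := small_mean x20.
pose rho := (1 + r) / 2.
have rho0 : 0 < rho by rewrite /rho; lra.
have rho1 : rho < 1 by rewrite /rho; lra.
have rrho : r < rho by rewrite /rho; lra.
have [n0 hn0] := zero_free_eventually rho1.
have [[hFs bFs] _] := Fs_adm n0.
have rr1 : r / rho < 1 by rewrite ltr_pdivrMr// mul1r.
have rr0 : 0 <= r / rho by exact: (divr_ge0 r0 (ltW rho0)).
have sc z : nc z < 1 -> nc (rho%:C%C * z) < rho.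
  by move=> z1; rewrite ncM nc_posreal ?(ltW rho0)// gtr_pMr.
have circE t : rho%:C%C * circ (r / rho) t = circ r t.
  rewrite /circ mulrA -rcM; congr (_%:C%C * _).
  by rewrite mulrC divfK// gt_eqF.
have hH : hol (fun z => Fs n0 (rho%:C%C * z)).
  apply: (hol_comp (f := fun z => rho%:C%C * z)) => // [|z z1].
    by apply: holM; [exact: hol_cst|exact: hol_id].
  exact: lt_trans (sc _ z1) rho1.
have := @mean_ln_zero_free _ (r / rho) hH (fun z hz => hn0 _ (sc _ hz)) rr0 rr1.
rewrite mulr0 (@rmean_eq _ _ (fun t => ln (nc (Fs n0 (circ r t))))); last first.
  by move=> t; rewrite circE.
have Fc t : Fs n0 (circ r t) != 0 by apply: hn0; rewrite nc_circ.
have cl : continuous (fun t => ln (nc (Fs n0 (circ r t)))).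
  by apply: continuous_ln_nc => //; exact: ccont_hol.
have cN : continuous (fun t => -1 * ln (nc (Fs n0 (circ r t)))).
  by apply: real_continuousM => // t; exact: cvg_cst.
have := hv _ cN; rewrite rmeanZ// => hv1 hm.
have {}hv1 : -1 * rmean (fun t => ln (nc (Fs n0 (circ r t)))) <= x / 2.
  apply: hv1 => [t|t Ft].
    by rewrite mulN1r oppr_ge0 ln_le0// bFs// nc_circ.
  rewrite mulN1r lerN2 ler_ln ?posrE ?nc_gt0//.
  by apply: (@Fs_mono 0 n0) => //; rewrite nc_circ.
exists n0 => // n /= n0n.
rewrite ger0_norm ?subr_ge0//.
have h0 : nc (Fs n0 0) <= nc (Fs n 0) by exact: Fs_mono.
have p0 : 0 < nc (Fs n0 0) by rewrite nc_gt0 hn0// nc0.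
have : 1 + ln (nc (Fs n0 0)) <= nc (Fs n0 0).
  by rewrite -{2}(lnK p0) expR_ge1Dx.
lra.
Qed.

Lemma blaschke_criterion : blaschke_product F.
Proof.
pose c := F 0 / f0%:C%C.
have f0C : f0%:C%C != 0 :> C by rewrite -nc_gt0 nc_posreal ?(ltW f00).
have c1 : nc c = 1 by rewrite /c ncM ncV nc_posreal ?(ltW f00)// mulfV// gt_eqF.
have P0 n : P n 0 = (\prod_(i < n) al i)%:C%C.
  rewrite /P (rmorph_prod (real_complex R)); apply: eq_bigr => i _; exact: bf0.
have Fs0 n : Fs n 0 = c * (nc (Fs n 0))%:C%C.
  have := FP n zero1; rewrite P0 => hF.
  have pa : 0 < \prod_(i < n) al i by apply: prodr_gt0 => i _; case/andP: (al01 i).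
  have pC : (\prod_(i < n) al i)%:C%C != 0 :> C by rewrite -nc_gt0 nc_posreal ?(ltW pa).
  have f0E : f0 = (\prod_(i < n) al i) * nc (Fs n 0).
    by rewrite /f0 hF ncM nc_posreal ?(ltW pa).
  have Fn0 : (nc (Fs n 0))%:C%C != 0 :> C.
    by rewrite -nc_gt0 nc_posreal ?nc_ge0// nc_gt0; case: (Fs_adm n).
  by rewrite /c f0E rcM hF; field; rewrite pC Fn0.
exists c, a; split; [|split; [|split]].
- by rewrite normE c1.
- by move=> n x ax; apply/in_diskE; have [_ _ /(_ x ax)[]] := sp n.
- rewrite (_ : (fun n => _) = (fun n => 1 - al n)); first by rewrite -T_series.
  apply: funext => n; rewrite /al; case: (a n) => [x|]; last by rewrite subrr.
  by rewrite normE ReB.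
move=> z /in_diskE z1; apply/clim_cvgP.
(* The quotients [Fs n] tend to the constant [c]: at the origin by [Fs_lim], since they all share
   the phase [c] there, and elsewhere by [osc]. *)
apply: (@squeeze0 _ _ (fun n => (8 / ((1 - nc (0 : C) ^+ 2) * (1 - nc z ^+ 2)) * (1 + nc (Fs n 0)) + 1) *
    (1 - nc (Fs n 0)))); last first.
  rewrite [X in _ --> X](_ : 0 = (8 / ((1 - nc (0 : C) ^+ 2) * (1 - nc z ^+ 2)) * (1 + 1) + 1) * (1 - 1)); last first.
    by rewrite subrr mulr0.
  apply: cvgM; last by apply: cvgB; [exact: cvg_cst|exact: Fs_lim].
  apply: cvgD; last exact: cvg_cst.
  apply: cvgM; first exact: cvg_cst.
  by apply: cvgD; [exact: cvg_cst|exact: Fs_lim].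
move=> n; rewrite nc_ge0 andTb -/(P n z).
have -> : c * P n z - F z = P n z * ((c - Fs n 0) - (Fs n z - Fs n 0)).
  by rewrite (FP n z1); ring.
rewrite ncM -[leRHS]mul1r; apply: ler_pM; rewrite ?nc_ge0 ?ncP//.
have [hFsb _] := Fs_adm n.
have Fs1 : nc (Fs n 0) <= 1 by apply: hFsb.2.
apply: (le_trans (ncB _ _)); rewrite mulrDl mul1r addrC; apply: lerD.
  apply: (le_trans (osc hFsb z1 zero1)); rewrite -[leRHS]mulrA.
  by have -> : 1 - nc (Fs n 0) ^+ 2 = (1 + nc (Fs n 0)) * (1 - nc (Fs n 0)) by ring.
have -> : c - Fs n 0 = c * (1 - nc (Fs n 0))%:C%C by rewrite {1}Fs0 rcB rc1; ring.
by rewrite ncM c1 mul1r nc_posreal// subr_ge0.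
Qed.

End Enumeration.
End BlaschkeCriterion.

(** * Frostman shifts *)

Section Frostman.
Variable R : realType.
Local Notation mu := (@lebesgue_measure R).

(* A dyadic majorant of the logarithmic singularity, equal to +oo at the origin. *)
Definition dyadic_ball (x : R) (k : nat) : set R := ball x (2 * (2^-1) ^+ k).
Definition logmaj (u : R) : \bar R := (\sum_(k <oo) (\1_(dyadic_ball 0 k) u)%:E)%E.

Let dr0 k : (0 : R) <= 2 * (2^-1) ^+ k.
Proof. by rewrite mulr_ge0// exprn_ge0// invr_ge0. Qed.

Lemma measurable_dyadic x k : measurable (dyadic_ball x k).
Proof. exact: measurable_ball. Qed.

Lemma logmaj_ge0 u : (0 <= logmaj u)%E.
Proof. by apply: nneseries_ge0 => k _ _; rewrite lee_fin. Qed.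

Lemma measurable_logmaj : measurable_fun setT logmaj.
Proof.
apply: (ge0_emeasurable_sum (P := xpredT))  => // k _.
by apply/measurable_EFinP; apply: measurable_indic; exact: measurable_dyadic.
Qed.

Let partial_le u n : (\sum_(0 <= k < n) (\1_(dyadic_ball 0 k) u)%:E <= logmaj u)%E.
Proof. by apply: nneseries_lim_ge => k _ _; rewrite lee_fin. Qed.

Lemma dyadicE x k u : (\1_(dyadic_ball x k) u : R) = (`|x - u| < 2 * (2^-1) ^+ k)%R%:R.
Proof.
rewrite indicE /dyadic_ball -ball_normE; congr (nat_of_bool _)%:R.
by apply/idP/idP => [|h]; rewrite inE.
Qed.

Lemma logmaj_ge_nat u n : (forall k, (k < n)%N -> `|u| < 2 * (2^-1) ^+ k) ->
  (n%:R%:E <= logmaj u)%E.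
Proof.
move=> h; apply: le_trans (partial_le u n); rewrite big_mkord.
rewrite (eq_bigr (fun=> 1%E)); last by move=> k _; rewrite dyadicE sub0r normrN h.
by rewrite sumEFin lee_fin sumr_const card_ord.
Qed.

Lemma logmaj_ge1 u : `|u| < 2 -> (1 <= logmaj u)%E.
Proof. by move=> u2; apply: (@logmaj_ge_nat u 1) => -[|//] _; rewrite expr0 mulr1. Qed.

Lemma logmaj0 : logmaj 0 = +oo%E.
Proof.
apply/eqyP => A A0; apply: le_trans (@logmaj_ge_nat 0 (Num.bound A) _).
  by rewrite lee_fin ltW// archi_boundP// ltW.
by move=> k _; rewrite normr0 mulr_gt0// exprn_gt0// invr_gt0.
Qed.

Lemma ln2_le1 : ln 2 <= 1 :> R.
Proof. by have := @le_ln1Dx R 1; rewrite -natr1; apply; lra. Qed.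

Lemma logmaj_ge_ln u : u != 0 -> ((ln 2 - ln `|u|)%:E <= logmaj u)%E.
Proof.
move=> u0; have nu0 : 0 < `|u| by rewrite normr_gt0.
have [u2|u2] := leP 2 `|u|.
  apply: le_trans (logmaj_ge0 u); rewrite lee_fin subr_le0 ler_ln ?posrE//.
have ex : exists k, 2 * (2^-1) ^+ k <= `|u|.
  have /cvgrPdist_lt /(_ (`|u|/2) ltac:(lra))[N _ hN] :
      (fun n => (2^-1 : R) ^+ n) @ \oo --> (0:R).
    by apply: cvg_expr; rewrite ger0_norm ?invr_ge0//; lra.
  exists N; have := hN N (leqnn N); rewrite sub0r normrN ger0_norm ?exprn_ge0 ?invr_ge0//; lra.
have [m um hm] := ex_minnP ex.
have h k : (k < m)%N -> `|u| < 2 * (2^-1) ^+ k.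
  by move=> km; rewrite ltNge; apply/negP => /hm; rewrite leqNgt km.
apply: le_trans (logmaj_ge_nat h); rewrite lee_fin.
have : ln (2 * (2^-1) ^+ m) <= ln `|u|.
  by rewrite ler_ln ?posrE// mulr_gt0// exprn_gt0// invr_gt0.
rewrite lnM ?posrE ?exprn_gt0 ?invr_gt0// lnXn ?invr_gt0// lnV ?posrE// mulNrn.
have : (ln 2 : R) *+ m <= m%:R by exact: (ler_wMn2r m ln2_le1).
move=> a b; lra.
Qed.

(** The [k]-th dyadic ball has length [4 * (2^-1) ^+ k], and these add up to at most 8, wherever the
    centre is. *)
Lemma integral_logmaj x : (\int[mu]_a logmaj (x - a) <= 8%:E)%E.
Proof.
have -> : (fun a => logmaj (x - a)) =
    (fun a => \sum_(k <oo) (\1_(dyadic_ball x k) a)%:E)%E.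
  apply/funext => a; apply: eq_eseriesr => k _.
  by rewrite !dyadicE sub0r normrN.
rewrite integral_nneseries//; last first.
  move=> k; apply/measurable_EFinP; apply: measurable_indic; exact: measurable_dyadic.
apply: lime_le.
  by apply: is_cvg_nneseries => k _ _; apply: integral_ge0 => a _; rewrite lee_fin.
apply: nearW => n; rewrite big_mkord.
have E k : (\int[mu]_a (\1_(dyadic_ball x k) a)%:E = (4 * (2^-1) ^+ k)%:E)%E.
  rewrite integral_indic ?setIT//; last exact: measurable_dyadic.
  etransitivity; first exact: (lebesgue_measure_ball x (dr0 k)).
  by congr _%:E; ring.
rewrite (eq_bigr (fun k : 'I_n => (4 * (2^-1) ^+ k)%:E)); last by move=> k _; exact: E.
rewrite sumEFin lee_fin -mulr_sumr.
have -> : \sum_(i < n) (2^-1 : R) ^+ i = 2 - 2 * (2^-1) ^+ n.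
  elim: n => [|n IH]; first by rewrite big_ord0 expr0; lra.
  rewrite big_ord_recr/= IH exprS; lra.
have : (0 : R) <= 2^-1 ^+ n by rewrite exprn_ge0// invr_ge0.
lra.
Qed.

Section Selection.
Variables (w x : nat -> nat -> R -> R) (w0 x0 : nat -> R).
Hypothesis mw : forall n j, measurable_fun setT (w n j).
Hypothesis mx : forall n j, measurable_fun setT (x n j).
Hypothesis w_ge0 : forall n j t, 0 <= w n j t.
Hypothesis w0_ge0 : forall j, 0 <= w0 j.
Hypothesis w0_fin : (\sum_(j <oo) (w0 j)%:E < +oo)%E.
Hypothesis w_small : forall e : R, 0 < e ->
  exists n, (\sum_(j <oo) \int[mu]_t (w n j t)%:E <= e%:E)%E.

Let f n (p : R * R) : \bar R :=
  (\sum_(j <oo) (w n j p.2)%:E * logmaj (x n j p.2 - p.1))%E.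

Let term_ge0 n j a t : (0 <= (w n j t)%:E * logmaj (x n j t - a))%E.
Proof. by rewrite mule_ge0 ?lee_fin// logmaj_ge0. Qed.

Let f_ge0 n p : (0 <= f n p)%E.
Proof. by apply: nneseries_ge0 => k _ _; exact: term_ge0. Qed.

Let measurable_term n j :
  measurable_fun setT (fun p : R * R => (w n j p.2)%:E * logmaj (x n j p.2 - p.1))%E.
Proof.
apply: emeasurable_funM.
  apply/measurable_EFinP.
  by apply: (measurableT_comp (f := w n j) (g := snd)).
apply: (measurableT_comp measurable_logmaj).
apply: measurable_funB; last exact: measurable_fst.
by apply: (measurableT_comp (f := x n j) (g := snd)).
Qed.

Let measurable_f n : measurable_fun setT (f n).
Proof.
by apply: (ge0_emeasurable_sum (P := xpredT)).
Qed.

Let L n a : \bar R := (\int[mu]_t f n (a, t))%E.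

Let measurable_L n : measurable_fun setT (L n).
Proof. exact: (measurable_fun_fubini_tonelli_F (m2 := mu) (f n) (measurable_f n) (f_ge0 n)). Qed.

Let L_ge0 n a : (0 <= L n a)%E.
Proof. by apply: integral_ge0. Qed.

Let measurable_shift u : measurable_fun setT (fun a : R => logmaj (u - a)).
Proof.
apply: (measurableT_comp measurable_logmaj).
by apply: measurable_funB.
Qed.

Let int_series (v y : nat -> R) : (forall j, 0 <= v j) ->
  (\int[mu]_a (\sum_(j <oo) (v j)%:E * logmaj (y j - a)) <= 8%:E * \sum_(j <oo) (v j)%:E)%E.
Proof.
move=> v0; rewrite integral_nneseries//; last 2 first.
- by move=> j; apply: emeasurable_funM; [exact: measurable_cst|exact: measurable_shift].
- by move=> j a _; rewrite mule_ge0 ?lee_fin// logmaj_ge0.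
rewrite -nneseriesZl//; last by move=> j _; rewrite lee_fin.
apply: lee_nneseries => [j _ _|j _].
  by apply: integral_ge0 => a _; rewrite mule_ge0 ?lee_fin// logmaj_ge0.
rewrite ge0_integralZl_EFin//; last 2 first.
- by move=> a _; exact: logmaj_ge0.
- exact: measurable_shift.
by rewrite muleC lee_wpmul2r ?lee_fin// integral_logmaj.
Qed.

Let int_L n : (\int[mu]_a L n a <= 8%:E * \sum_(j <oo) \int[mu]_t (w n j t)%:E)%E.
Proof.
rewrite /L (fubini_tonelli (m1 := mu) (m2 := mu) (f n) (measurable_f n) (f_ge0 n)).
rewrite -integral_nneseries//; last 2 first.
- by move=> j; apply/measurable_EFinP; exact: mw.
- by move=> j t _; rewrite lee_fin.
have sge0 t : (0 <= \sum_(j <oo) (w n j t)%:E)%E.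
  by apply: nneseries_ge0 => k _ _; rewrite lee_fin.
have ms : measurable_fun setT (fun t => \sum_(j <oo) (w n j t)%:E)%E.
  apply: (ge0_emeasurable_sum (P := xpredT)) => [k t _ _|k _].
    by rewrite lee_fin.
  exact/measurable_EFinP.
rewrite -ge0_integralZl_EFin//.
apply: ge0_le_integral => //.
- by move=> t _; apply: integral_ge0.
- exact: (measurable_fun_fubini_tonelli_G (m1 := mu) (f n) (measurable_f n) (f_ge0 n)).
- by apply: emeasurable_funM => //; exact: measurable_cst.
by move=> t _; have h := int_series (fun j => x n j t) (w_ge0 n ^~ t); apply: le_trans h _.
Qed.

Let K0 a : \bar R := (\sum_(j <oo) (w0 j)%:E * logmaj (x0 j - a))%E.

(* A finite integral over an interval of positive length leaves a point where the
   integrand is finite. *)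
Lemma frostman_selection : exists a : R, [/\ `|a| <= 2^-1,
  (\sum_(j <oo) (w0 j)%:E * logmaj (x0 j - a) < +oo)%E &
  forall e : R, 0 < e -> exists n,
    (\int[mu]_t (\sum_(j <oo) (w n j t)%:E * logmaj (x n j t - a)) <= e%:E)%E].
Proof.
have ex i : exists n, (\int[mu]_a L n a <= ((2^-1) ^+ i)%:E)%E.
  have e0 : (0 : R) < (2^-1) ^+ i / 8 by rewrite divr_gt0// exprn_gt0// invr_gt0.
  have [n hn] := w_small e0; exists n; apply: le_trans (int_L n) _.
  apply: le_trans (lee_wpmul2l _ hn) _; first by rewrite lee_fin.
  by rewrite -EFinM lee_fin mulrC divfK.
have [m hm] := choice ex.
(* All requirements on [a] are packed into one integrable function: finiteness of [T a] gives that
   of [K0 a], and, the terms being nonnegative, forces some [L (m i) a] below any given [e]. *)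
pose T a : \bar R := (K0 a + \sum_(i <oo) L (m i) a)%E.
have K0_ge0 a : (0 <= K0 a)%E.
  by apply: nneseries_ge0 => k _ _; rewrite mule_ge0 ?lee_fin// logmaj_ge0.
have SL_ge0 a : (0 <= \sum_(i <oo) L (m i) a)%E.
  by apply: nneseries_ge0 => k _ _; exact: L_ge0.
have mK0 : measurable_fun setT K0.
  apply: (ge0_emeasurable_sum (P := xpredT)) => [k t _ _|k _].
    by rewrite mule_ge0 ?lee_fin// logmaj_ge0.
  by apply: emeasurable_funM; [exact: measurable_cst|exact: measurable_shift].
have mSL : measurable_fun setT (fun a => \sum_(i <oo) L (m i) a)%E.
  by apply: (ge0_emeasurable_sum (P := xpredT)) => // k t _ _; exact: L_ge0.
have T_ge0 a : (0 <= T a)%E by rewrite adde_ge0.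
have mT : measurable_fun setT T by exact: emeasurable_funD.
have intT : (\int[mu]_a T a < +oo)%E.
  have e1 := int_series x0 w0_ge0.
  rewrite /T (ge0_integralD mu measurableT (fun a _ => K0_ge0 a) mK0
    (fun a _ => SL_ge0 a) mSL).
  apply: lte_add_pinfty.
    apply: le_lt_trans e1 _.
    by rewrite lte_mul_pinfty// lee_fin.
  rewrite (integral_nneseries mu measurableT (fun i => measurable_L (m i))
    (fun i a _ => L_ge0 (m i) a)).
  apply: (@le_lt_trans _ _ 2%:E); last by rewrite ltry.
  apply: lime_le.
    by apply: is_cvg_nneseries => k _ _; apply: integral_ge0 => a _; exact: L_ge0.
  apply: nearW => n; rewrite big_mkord.
  apply: (@le_trans _ _ (\sum_(i < n) ((2^-1) ^+ i)%:E)%E).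
    by apply: lee_sum => i _; exact: hm.
  rewrite sumEFin lee_fin.
  have -> : \sum_(i < n) (2^-1 : R) ^+ i = 2 - 2 * (2^-1) ^+ n.
    elim: n => [|n IH]; first by rewrite big_ord0 expr0; lra.
    rewrite big_ord_recr/= IH exprS; lra.
  have : (0 : R) <= 2^-1 ^+ n by rewrite exprn_ge0// invr_ge0.
  lra.
have [a [aI Ta]] : exists a, `|a| <= 2^-1 /\ (T a < +oo)%E.
  apply: contrapT => H.
  have HT (a : R) : - 2^-1 <= a <= 2^-1 -> T a = +oo%E.
    move=> /andP[a1 a2]; apply/eqP; rewrite -leye_eq leNgt.
    by apply/negP => h; apply: H; exists a; rewrite ler_norml a1 a2.
  suff : (+oo <= \int[mu]_a T a)%E by rewrite leNgt intT.
  pose I : set (measurableTypeR R) := `[- (2^-1 : R), 2^-1 : R].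
  have mI : measurable I by exact: measurable_itv.
  have h := ge0_subset_integral mu mI measurableT mT (fun a _ => T_ge0 a) (@subsetT _ I).
  apply: le_trans h.
  rewrite (eq_integral (cst +oo%E)); last first.
    by move=> a; rewrite inE /I/= in_itv/= => /HT.
  have muI : mu I = (2^-1 - - 2^-1)%:E.
    have := @lebesgue_measure_itv R `[- (2^-1 : R), 2^-1 : R]%R.
    by rewrite /= lte_fin ifT ?EFinB//; lra.
  rewrite integral_cst// [X in (_ <= _ * X)%E](_ : _ = (2^-1 - - 2^-1)%:E); last exact: muI.
  by rewrite gt0_mulye// lte_fin; lra.
exists a; split => //.
  by apply: le_lt_trans Ta; rewrite leeDl.
move=> e e0; apply: contrapT => H.
have big i : (e%:E <= L (m i) a)%E.
  by rewrite leNgt; apply/negP => /ltW h; apply: H; exists (m i).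
suff Too : T a = +oo%E by rewrite Too in Ta.
apply/eqyP => A A0.
apply: (@le_trans _ _ (\sum_(i <oo) L (m i) a)%E); last by rewrite leeDr.
pose N := Num.bound (A / e).
apply: (@le_trans _ _ (\sum_(0 <= i < N) L (m i) a)%E); last first.
  by apply: nneseries_lim_ge => k _ _; exact: L_ge0.
rewrite big_mkord.
apply: (@le_trans _ _ (\sum_(i < N) e%:E)%E); last by apply: lee_sum => i _.
rewrite sumEFin lee_fin sumr_const card_ord -mulr_natl -ler_pdivrMr//.
by rewrite ltW// archi_boundP// divr_ge0 ?ltW.
Qed.

End Selection.
End Frostman.

(** * Logarithmic bounds and the product of Frostman shifts *)

Section Product.
Variable R : realType.
Local Notation C := R[i].
Local Notation nc := (@ComplexField.Normc.normc R).
Local Notation Re := (@complex.Re R).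
Local Notation mu := (@lebesgue_measure R).

Section Kernel.
Variable a : R.
Hypothesis a_le : `|a| <= 2^-1.
Local Notation ac := (a%:C%C : C).

Lemma nc_ac : nc ac <= 2^-1. Proof. by rewrite nc_real. Qed.
Lemma nc_ac_lt1 : nc ac < 1. Proof. by have := nc_ac; lra. Qed.

Lemma mob_den_ge (z : C) : nc z <= 1 -> 2^-1 <= nc (1 - ac^*%C * z).
Proof.
move=> z1; have h := ncB_ge 1 (ac^*%C * z); rewrite ncM ncJ nc1 in h.
have : nc ac * nc z <= 2^-1 * 1 by apply: ler_pM; rewrite ?nc_ge0// nc_ac.
by move: h; move: (nc _) => x; lra.
Qed.

Lemma mob_den_le (z : C) : nc z <= 1 -> nc (1 - ac^*%C * z) <= 2.
Proof.
move=> z1; apply: le_trans (ncB _ _) _; rewrite ncM ncJ nc1.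
have : nc ac * nc z <= 2^-1 * 1 by apply: ler_pM; rewrite ?nc_ge0// nc_ac.
by lra.
Qed.

Lemma mob_defect4 (z : C) : nc z <= 1 -> 1 - nc (mob ac z) ^+ 2 <= 4 * (1 - nc z ^+ 2).
Proof.
move=> z1; rewrite nc_mob ?nc_ac_lt1//.
have h := mob_den_ge z1; move: h; move: (nc (1 - _)) => x hx.
have x0 : 0 < x ^+ 2 by rewrite exprn_gt0//; lra.
have z2 : nc z ^+ 2 <= 1 by rewrite exprn_ile1// nc_ge0.
rewrite ler_pdivrMr//.
have A : 0 <= nc ac ^+ 2 by rewrite exprn_ge0// nc_ge0.
have B : 2^-1 ^+ 2 <= x ^+ 2 by rewrite lerXn2r ?nnegrE//; lra.
move: z2 A B; rewrite (_ : (2^-1 : R) ^+ 2 = 4^-1); last by rewrite exprVn -natrX.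
move: (nc z ^+ 2) (nc ac ^+ 2) (x ^+ 2) => p q y p1 q0 y4.
have : 0 <= (1 - p) * (4 * y - 1) by apply: mulr_ge0; lra.
have : 0 <= (1 - p) * q by apply: mulr_ge0; lra.
by lra.
Qed.

(** Here [|z - a| >= 3/4 - 1/2], and [ln (1/x) <= (1/x^2 - 1) / 2] replaces the logarithm by the
    defect; 8 is [4^2 / 2]. *)
Lemma ln_mob_far (z : C) : nc z < 1 -> 3 / 4 <= nc z ->
  - ln (nc (mob ac z)) <= 8 * (1 - nc z ^+ 2).
Proof.
move=> z1 z34.
have d : 4^-1 <= nc (z - ac).
  have := ncB_ge z ac; have := nc_ac; move: (nc (z - _)) => x; lra.
have d0 : 0 < nc (z - ac) by lra.
have D := mob_den_ge (ltW z1); have D0 : 0 < nc (1 - ac^*%C * z) by lra.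
have E : nc (mob ac z) = nc (z - ac) / nc (1 - ac^*%C * z) by rewrite /mob ncM ncV.
have F := nc_mob nc_ac_lt1 (ltW z1).
have r0 : 0 < nc (mob ac z) by rewrite E divr_gt0.
rewrite -lnV ?posrE//; apply: le_trans (ln_le_sqr _) _; first by rewrite invr_gt0.
have z2 : nc z ^+ 2 <= 1 by rewrite exprn_ile1 ?nc_ge0// ltW.
have G : (nc (mob ac z))^-1 ^+ 2 - 1 = (1 - nc ac ^+ 2) * (1 - nc z ^+ 2) / nc (z - ac) ^+ 2.
  have -> : (nc (mob ac z))^-1 ^+ 2 - 1 = (1 - nc (mob ac z) ^+ 2) / nc (mob ac z) ^+ 2.
    by field; rewrite gt_eqF.
  rewrite F E; field; rewrite !gt_eqF//.
rewrite G.
have A : 0 <= nc ac ^+ 2 by rewrite exprn_ge0// nc_ge0.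
have B : 4^-1 ^+ 2 <= nc (z - ac) ^+ 2 by rewrite lerXn2r ?nnegrE//; lra.
have y0 : 0 < nc (z - ac) ^+ 2 by rewrite exprn_gt0.
rewrite ler_pdivrMr// ler_pdivrMr//.
move: z2 A B; rewrite (_ : (4^-1 : R) ^+ 2 = 16^-1); last by rewrite exprVn -natrX.
move: (nc z ^+ 2) (nc ac ^+ 2) (nc (z - ac) ^+ 2) => p q y p1 q0 y4.
have : 0 <= (1 - p) * (16 * y - 1) by apply: mulr_ge0; lra.
have : 0 <= (1 - p) * q by apply: mulr_ge0; lra.
by lra.
Qed.

(** Only the horizontal distance from [z] to [a] is kept, which is why averaging over real [a] is
    enough. *)
Lemma ln_mob_near (z : C) : nc z < 1 -> Re z != a ->
  - ln (nc (mob ac z)) <= ln 2 - ln `|Re z - a|.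
Proof.
move=> z1 za.
have u0 : 0 < `|Re z - a| by rewrite normr_gt0 subr_eq0.
have D := mob_den_le (ltW z1).
have D0 : 0 < nc (1 - ac^*%C * z) by have := mob_den_ge (ltW z1); lra.
have E : nc (mob ac z) = nc (z - ac) / nc (1 - ac^*%C * z) by rewrite /mob ncM ncV.
have F : `|Re z - a| <= nc (z - ac).
  by have := nc_Re (z - ac); rewrite !ReImE.
have : `|Re z - a| / 2 <= nc (mob ac z).
  rewrite E; apply: ler_pM => //.
  by rewrite lef_pV2 ?posrE.
rewrite -ler_ln ?posrE ?divr_gt0//; last by rewrite E divr_gt0// (lt_le_trans u0 F).
by rewrite ln_div ?posrE//; lra.
Qed.

(** One majorant for two regimes. Near the circle the weight carries the bound and [logmaj] is at
    least 1; for [nc z < 3 / 4] the weight is at least [7 / 2] and [logmaj] carries the singularity.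
    Finiteness excludes [Re z = a], where [logmaj] is infinite. *)
Lemma kernel_bound (z : C) : nc z < 1 ->
  ((8 * (1 - nc z ^+ 2))%:E * logmaj (Re z - a) < +oo)%E ->
  mob ac z != 0 /\
  ((- ln (nc (mob ac z)))%:E <= (8 * (1 - nc z ^+ 2))%:E * logmaj (Re z - a))%E.
Proof.
move=> z1 fin.
have k0 : 0 < 8 * (1 - nc z ^+ 2) by rewrite mulr_gt0// subr_gt0 expr_lt1// nc_ge0.
have za : Re z != a \/ 3 / 4 <= nc z.
  have [e|] := eqVneq (Re z) a; last by left.
  by move: fin; rewrite e subrr logmaj0 gt0_muley ?lte_fin// ltxx.
have u2 : `|Re z - a| < 2.
  have := nc_Re z; have := ler_normB (Re z) a; move: a_le; lra.
have [z34|z34] := leP (3 / 4) (nc z); split.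
- rewrite /mob mulf_neq0 ?invr_eq0 ?mob_den ?nc_ac_lt1// ?ltW// subr_eq0.
  by apply/eqP => e; move: z34 nc_ac; rewrite e; lra.
- apply: (@le_trans _ _ (8 * (1 - nc z ^+ 2))%:E); first by rewrite lee_fin ln_mob_far.
  rewrite -[leLHS]mule1; apply: lee_wpmul2l; [by rewrite lee_fin ltW|exact: logmaj_ge1].
- case: za => [za|]; last by rewrite leNgt z34.
  rewrite /mob mulf_neq0 ?invr_eq0 ?mob_den ?nc_ac_lt1// ?ltW// subr_eq0.
  by apply/eqP => e; move: za; rewrite e eqxx.
- case: za => [za|]; last by rewrite leNgt z34.
  apply: (@le_trans _ _ (logmaj (Re z - a))).
    apply: le_trans (logmaj_ge_ln _); last by rewrite subr_eq0.
    by rewrite lee_fin ln_mob_near.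
  rewrite -[leLHS]mul1e lee_wpmul2r ?logmaj_ge0// lee_fin.
  have : nc z ^+ 2 <= (3 / 4) ^+ 2 by rewrite lerXn2r ?nnegrE ?nc_ge0// ?ltW//; lra.
  by rewrite expr2; lra.
Qed.

End Kernel.

Lemma phase (m : C) : exists2 c : C, nc c = 1 & c * m = (nc m)%:C%C.
Proof.
have [->|m0] := eqVneq m 0; first by exists 1; rewrite ?nc1// nc0 mulr0.
have n0 : 0 < nc m by rewrite nc_gt0.
have n0' : (nc m)%:C%C != 0 :> C by rewrite -nc_eq0 nc_real normr_eq0 gt_eqF.
exists (m^*%C / (nc m)%:C%C).
  by rewrite ncM ncV ncJ nc_real ger0_norm ?nc_ge0// divff// gt_eqF.
apply: (mulIf n0'); rewrite mulrAC divfK// mulrC -nc_sqrC rcX expr2 //.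
Qed.

Lemma cvg_scale0 (k : R) (u : nat -> R) : u @ \oo --> (0 : R) ->
  (fun n => k * u n) @ \oo --> (0 : R).
Proof. by move=> h; rewrite -[X in _ --> X](mulr0 k); apply: cvgM => //; exact: cvg_cst. Qed.

Section Blaschke.
Variables (Es : nat -> C -> C) (v : nat -> R).
Hypothesis wE : forall j, weakly_inner (Es j).
(** Summability of the defects at the origin in telescoped form: [v J] bounds their sum from [J]
    on. *)
Hypothesis hv : forall j, 1 - nc (Es j 0) ^+ 2 <= v j - v j.+1.
Hypothesis v0 : v @ \oo --> (0 : R).

Let nc0_lt1 : nc (0 : C) < 1. Proof. by rewrite nc0. Qed.
Let E_lt1 j z : nc z < 1 -> nc (Es j z) < 1.
Proof. by move=> z1; have [[_ ->]] := wE j. Qed.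
Let holE j : hol (Es j). Proof. by have [[]] := wE j. Qed.
Let d_ge0 j z : nc z < 1 -> 0 <= 1 - nc (Es j z) ^+ 2.
Proof. by move=> z1; rewrite subr_ge0 ltW// expr_lt1 ?nc_ge0// E_lt1. Qed.

Let v_dec j : v j.+1 <= v j.
Proof. by have := hv j; have := d_ge0 j nc0_lt1; lra. Qed.

Let v_ge0 j : 0 <= v j.
Proof.
have ni : nonincreasing_seq v by apply/nonincreasing_seqP.
have := nonincreasing_cvgn_ge ni (cvgP _ v0) j.
by rewrite (cvg_lim (@Rhausdorff R) v0).
Qed.

Let sum_tail N J : \sum_(J <= j < N) (v j - v j.+1) <= v J.
Proof.
have [JN|NJ] := leqP J N; last by rewrite big_geq ?v_ge0// ltnW.
rewrite (eq_bigr (fun j => - (v j.+1 - v j))); last by move=> i _; rewrite opprB.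
by rewrite sumrN telescope_sumr// opprB; have := v_ge0 N; lra.
Qed.

(* The tail of the series of defects is controlled uniformly in the radius by the values
   at the origin, the head by weak innerness. *)
Let small_defect (e : R) : 0 < e ->
  exists n, forall N, \sum_(0 <= j < N) defect (Es j) n <= e.
Proof.
move=> e0; have e2 : 0 < e / 2 by lra.
have [J _ hJ] : \forall J \near \oo, v J < e / 2.
  by apply: (cvgr_lt (0:R)).
have sumc : (fun n => \sum_(0 <= j < J) defect (Es j) n) @ \oo --> (0 : R).
  elim: J {hJ} => [|K IH].
    by under eq_fun do rewrite big_geq//; exact: cvg_cst.
  have h := cvgD IH (wE K).2; rewrite addr0 in h.
  rewrite (_ : (fun n => _) = (fun n => \sum_(0 <= j < K) defect (Es j) n) \+ defect (Es K)).
    exact: h.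
  by apply/funext => n; rewrite big_nat_recr.
have [n _ hn] : \forall n \near \oo, \sum_(0 <= j < J) defect (Es j) n < e / 2.
  by apply: (cvgr_lt (0:R)).
exists n => N.
have dg j : 0 <= defect (Es j) n.
  by apply: defect_ge0 => z z1; rewrite ltW// E_lt1.
have mono : \sum_(0 <= j < N) defect (Es j) n <= \sum_(0 <= j < J + N) defect (Es j) n.
  rewrite (big_cat_nat (n := N) (p := (J + N)%N)) ?leq_addl//= lerDl sumr_ge0//.
apply: le_trans mono _; rewrite (big_cat_nat (n := J)) ?leq_addr//=.
have := hn n (leqnn n); have := hJ J (leqnn J) => /= a b.
have : \sum_(J <= j < J + N) defect (Es j) n <= v J.
  apply: le_trans (sum_tail (J + N) J); apply: ler_sum => j _.
  exact: le_trans (defect_le n (holE j)) (hv j).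
by lra.
Qed.

Let J : set R := `[0, 2 * pi].
Let g n j t : R := 8 * (1 - nc (Es j (circ (rn R n) t)) ^+ 2).

Let g_cont n j : continuous (g n j).
Proof.
apply: real_continuousM; first by move=> t; exact: cvg_cst.
exact: (@rcirc_defect R (Es j) (ccirc_hol (holE j)) n).
Qed.

Let mJ : measurable J. Proof. exact: measurable_itv. Qed.

Lemma integral_J_rint (u : R -> R) : continuous u ->
  (\int[mu]_t (u t * \1_J t)%:E = (rint 0 (2 * pi) u)%:E)%E.
Proof.
move=> cu; rewrite /rint /Rintegral fineK; last first.
  exact: (integrable_fin_num _ (@continuous_integrable R 0 (2 * pi) u cu)).
rewrite [RHS]integral_mkcond; apply: eq_integral => t _.
by rewrite epatch_indic/= EFinM.
Qed.

Let g_ge0 n j t : 0 <= g n j t * \1_J t.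
Proof. by rewrite mulr_ge0// mulr_ge0// d_ge0// nc_circ_lt1. Qed.

(** One parameter serves for the origin, which yields [B 0 != 0], and for the circles, which yields
    small logarithmic means. The indicator of [J] appears because the selection integrates over the
    whole line. *)
Lemma frostman_choice : exists a : R, [/\ `|a| <= 2^-1,
  (\sum_(j <oo) (8 * (1 - nc (Es j 0%R) ^+ 2))%:E * logmaj (Re (Es j 0%R) - a) < +oo)%E &
  forall e : R, 0 < e -> exists n, (\int[mu]_t (\sum_(j <oo)
    (g n j t * \1_J t)%:E * logmaj (Re (Es j (circ (rn R n) t)) - a)) <= e%:E)%E].
Proof.
apply: (@frostman_selection R (fun n j t => g n j t * \1_J t)
   (fun n j t => Re (Es j (circ (rn R n) t))) (fun j => 8 * (1 - nc (Es j 0) ^+ 2))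
   (fun j => Re (Es j 0))).
- move=> n j; apply: measurable_funM; last exact: measurable_indic.
  by apply: continuous_measurable_fun; exact: g_cont.
- move=> n j; apply: continuous_measurable_fun.
  exact: (ccont_Re (ccirc_hol (holE j) n)).
- exact: g_ge0.
- by move=> j; rewrite mulr_ge0// d_ge0.
- apply: (@le_lt_trans _ _ (8 * v 0%N)%:E); last exact: ltry.
  apply: lime_le.
    by apply: is_cvg_nneseries => j _ _; rewrite lee_fin mulr_ge0// d_ge0.
  apply: nearW => N; rewrite sumEFin lee_fin -mulr_sumr ler_pM2l//.
  by apply: le_trans (sum_tail N 0); apply: ler_sum => j _.
- move=> e e0.
  have p0 : 0 < 2 * (pi : R) by rewrite mulr_gt0// pi_gt0.
  have [n hn] := @small_defect (e / (8 * (2 * pi))) ltac:(by rewrite divr_gt0// mulr_gt0).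
  exists n; apply: lime_le.
    by apply: is_cvg_nneseries => j _ _; apply: integral_ge0 => t _; rewrite lee_fin.
  apply: nearW => N.
  have E j : (\int[mu]_t (g n j t * \1_J t)%:E = (8 * (2 * pi) * defect (Es j) n)%:E)%E.
    rewrite integral_J_rint; last exact: g_cont.
    congr _%:E; rewrite /defect /rm.
    have -> : rint 0 (2 * pi) (g n j) = 2 * pi * rmean (g n j).
      by rewrite /rmean mulVKf// gt_eqF.
    rewrite /g rmeanZ; last exact: (@rcirc_defect R (Es j) (ccirc_hol (holE j)) n).
    by move: (rmean _) => m; ring.
  under eq_bigr do rewrite E.
  rewrite sumEFin lee_fin -mulr_sumr mulrC -ler_pdivlMr ?mulr_gt0//.
  exact: pi_gt0.
Qed.

Section Convergence.
Variables (a : R) (c : nat -> C).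
Hypothesis a_le : `|a| <= 2^-1.
Hypothesis c1 : forall j, nc (c j) = 1.
Local Notation ac := (a%:C%C : C).
Hypothesis c_phase : forall j, c j * mob ac (Es j 0) = (nc (mob ac (Es j 0)))%:C%C.

Let S j z := c j * mob ac (Es j z).
Let P n z := \prod_(0 <= j < n) S j z.
Let kappa z : \bar R :=
  (\sum_(j <oo) (8 * (1 - nc (Es j z) ^+ 2))%:E * logmaj (Re (Es j z) - a))%E.

Let nS j z : nc (S j z) = nc (mob ac (Es j z)).
Proof. by rewrite /S ncM c1 mul1r. Qed.

Let S_lt1 j z : nc z < 1 -> nc (S j z) < 1.
Proof. by move=> z1; rewrite nS nc_mob_lt1 ?nc_ac_lt1// E_lt1. Qed.

Let holS j : hol (S j).
Proof.
apply: holM; first exact: hol_cst.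
by apply: hol_mob_comp; [exact: nc_ac_lt1|exact: holE|move=> z z1; rewrite ltW// E_lt1].
Qed.

Let Kz z : R := 36 / (1 - nc z ^+ 2).

Let sq_lt1 z : nc z < 1 -> 0 < 1 - nc z ^+ 2.
Proof. by move=> z1; rewrite subr_gt0 expr_lt1 ?nc_ge0. Qed.

(** The phase [c j] makes [S j 0] a nonnegative real, so its distance to 1 is at most its defect,
    and [osc] from the origin does the rest. Here 36 is [(8 + 1) * 4], the 4 coming from
    [mob_defect4]. *)
Let S_near1 j z : nc z < 1 -> nc (S j z - 1) <= Kz z * (v j - v j.+1).
Proof.
move=> z1; have k0 := sq_lt1 z1.
have bS : hol_bounded (S j) 1 by split=> // u u1; rewrite ltW// S_lt1.
have := osc bS z1 nc0_lt1; rewrite nc0 expr0n subr0 mul1r => h.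
have s0 : S j 0 = (nc (S j 0))%:C%C by rewrite nS /S c_phase.
have t1 : nc (S j 0 - 1) = 1 - nc (S j 0).
  rewrite {1}s0 -rc1 -rcB nc_real ler0_norm ?opprB// subr_le0.
  by rewrite ltW// S_lt1.
have tri : nc (S j z - 1) <= nc (S j z - S j 0) + nc (S j 0 - 1).
  by apply: le_trans (ncD _ _); rewrite addrA subrK.
have d4 : 1 - nc (S j 0) ^+ 2 <= 4 * (v j - v j.+1).
  rewrite nS; apply: le_trans (mob_defect4 a_le _) _; first by rewrite ltW// E_lt1.
  by rewrite ler_pM2l// hv.
have x0 := nc_ge0 (S j 0); have x1 := S_lt1 j nc0_lt1.
move: tri h t1 d4 x0 x1; rewrite /Kz.
move: (nc (S j z - 1)) (nc (S j z - S j 0)) (nc (S j 0 - 1)) (nc (S j 0)) => p q r x.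
move=> pq qx e d4 x0 x1; rewrite e in pq.
have k1 : 1 - nc z ^+ 2 <= 1 by rewrite gerBl exprn_ge0// nc_ge0.
move: k0 k1 qx; move: (1 - nc z ^+ 2) (v j - v j.+1) d4 => k d d4 k0 k1 qx.
have b1 : 1 - x <= 1 - x ^+ 2 by rewrite expr2; nra.
have b2 : 1 - x ^+ 2 <= (1 - x ^+ 2) / k.
  by rewrite ler_pdivlMr// ler_piMr// subr_ge0 expr_le1// ltW.
have b3 : (1 - x ^+ 2) / k <= 4 * d / k by rewrite ler_pM2r ?invr_gt0.
have -> : 36 / k * d = 9 * (4 * d / k) by field; rewrite gt_eqF.
move: qx; rewrite (_ : 8 / k * (1 - x ^+ 2) = 8 * ((1 - x ^+ 2) / k)); last first.
  by field; rewrite gt_eqF.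
by move: b1 b2 b3; move: ((1 - x ^+ 2) / k) (4 * d / k) (1 - x ^+ 2) => A B D; lra.
Qed.

Let P_le1 n z : nc z < 1 -> nc (P n z) <= 1.
Proof.
move=> z1; rewrite /P nc_prod; apply: prodr_ile1 => j _.
by rewrite nc_ge0 ltW// S_lt1.
Qed.

Lemma hol_partial_product n : hol (P n).
Proof.
elim: n => [|n IH].
  by apply: (@hol_ext R (fun=> 1)) => [z _|]; [rewrite /P big_geq|exact: hol_cst].
apply: (@hol_ext R (fun z => P n z * S n z)) => [z _|]; last exact: holM.
by rewrite /P big_nat_recr.
Qed.

Let P_lim z : exists b : C, nc z < 1 ->
  clim (P ^~ z) b /\ forall n, nc (b - P n z) <= Kz z * v n.
Proof.
have [z1|_] := boolP (nc z < 1); last by exists 0.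
have vK : (fun n => Kz z * v n) @ \oo --> (0 : R).
  exact: cvg_scale0.
have [n|b hb eb] := @clim_telescope R (P ^~ z) (fun n => Kz z * v n) 0 _ vK.
  have -> : P n.+1 z - P n z = P n z * (S n z - 1).
    by rewrite /P big_nat_recr//= mulrBr mulr1.
  rewrite -mulrBr ncM; apply: le_trans (S_near1 n z1).
  by rewrite ler_piMl ?nc_ge0// P_le1.
by exists b => _; split=> // n; have := eb n; rewrite subr0.
Qed.

Let B : C -> C := projT1 (choice P_lim).
Let B_lim z : nc z < 1 -> clim (P ^~ z) (B z).
Proof. by move=> z1; have [] := projT2 (choice P_lim) z z1. Qed.
Let B_dist z n : nc z < 1 -> nc (B z - P n z) <= Kz z * v n.
Proof. by move=> z1; have [_ ->] := projT2 (choice P_lim) z z1. Qed.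

Lemma hol_product : hol B.
Proof.
apply: (@hol_limit R P) => [|r r1]; first exact: hol_partial_product.
have [r0|r0] := ltP r 0.
  exists v; split=> // n z zr; have := nc_ge0 z.
  by move=> z0; have := le_lt_trans (le_trans z0 zr) r0; rewrite ltxx.
exists (fun n => 36 / (1 - r ^+ 2) * v n); split.
  exact: cvg_scale0.
move=> n z zr; have z1 := le_lt_trans zr r1; rewrite -ncN opprB.
apply: le_trans (B_dist n z1) _; rewrite /Kz; apply: ler_wpM2r; first exact: v_ge0.
have r2 : 0 < 1 - r ^+ 2 by rewrite subr_gt0 expr_lt1.
rewrite ler_pM2l// lef_pV2 ?posrE ?sq_lt1// lerB// lerXn2r ?nnegrE ?nc_ge0//.
Qed.

Let B_le1 z : nc z < 1 -> nc (B z) <= 1.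
Proof. by move=> z1; apply: (clim_le (B_lim z1)) => n; exact: P_le1. Qed.

Lemma factor_lim z : nc z < 1 -> clim (S ^~ z) 1.
Proof.
move=> z1; apply: (@squeeze0 R _ (fun j => Kz z * (v j - v j.+1))) => [j|].
  by rewrite nc_ge0 S_near1.
have vs : (fun j => v j.+1) @ \oo --> (0 : R) by rewrite cvg_shiftS.
have h := cvgB v0 vs _; rewrite subr0 in h.
exact: (cvg_scale0 (Kz z) (h _)).
Qed.

Let term_ge0 j z : nc z < 1 ->
  (0 <= (8 * (1 - nc (Es j z) ^+ 2))%:E * logmaj (Re (Es j z) - a))%E.
Proof. by move=> z1; rewrite mule_ge0 ?logmaj_ge0// lee_fin mulr_ge0// d_ge0. Qed.

Let kappa_ge0 z : nc z < 1 -> (0 <= kappa z)%E.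
Proof. by move=> z1; apply: nneseries_ge0 => j _ _; exact: term_ge0. Qed.

(** A finite [kappa z] bounds all partial products below by [expR (- kappa z)]. The bound passes to
    the limit and gives nonvanishing and the logarithmic estimate together. *)
Lemma log_B_le z : nc z < 1 -> (kappa z < +oo)%E ->
  B z != 0 /\ ((- ln (nc (B z)))%:E <= kappa z)%E.
Proof.
move=> z1 fin.
have part n : (\sum_(0 <= j < n) (8 * (1 - nc (Es j z) ^+ 2))%:E *
    logmaj (Re (Es j z) - a) <= kappa z)%E.
  by apply: nneseries_lim_ge => j _ _; exact: term_ge0.
have tfin j : ((8 * (1 - nc (Es j z) ^+ 2))%:E * logmaj (Re (Es j z) - a) < +oo)%E.
  apply: le_lt_trans fin; apply: le_trans (part j.+1).
  by rewrite big_nat_recr//= leeDr// sume_ge0// => i _; exact: term_ge0.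
have tb j := kernel_bound a_le (E_lt1 j z1) (tfin j).
have np n : 0 < nc (P n z).
  by rewrite /P nc_prod; apply: prodr_gt0 => j _; rewrite nS nc_gt0; case: (tb j).
have lnP n : ((- ln (nc (P n z)))%:E <= kappa z)%E.
  apply: le_trans (part n); elim: n => [|n IH].
    by rewrite big_geq// /P big_geq// nc1 ln1 oppr0.
  have -> : nc (P n.+1 z) = nc (P n z) * nc (mob ac (Es n z)).
    by rewrite /P big_nat_recr//= ncM nS.
  rewrite lnM ?posrE//; last by rewrite nc_gt0; case: (tb n).
  rewrite opprD EFinD big_nat_recr//=; apply: leeD => //.
  by case: (tb n).
have kf : kappa z \is a fin_num by rewrite ge0_fin_numE// kappa_ge0.
pose k := fine (kappa z).
have ke : kappa z = k%:E by rewrite fineK.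
have low n : expR (- k) <= nc (P n z).
  by have := lnP n; rewrite ke lee_fin -{2}(lnK (np n : _ \in Num.pos)) ler_expR; lra.
have lB : expR (- k) <= nc (B z).
  rewrite leNgt; apply/negP => lt.
  have := clim_nc (B_lim z1) => /cvgr_lt /(_ _ lt)[n _ /(_ n (leqnn n))] /=.
  by rewrite ltNge low.
have b0 : 0 < nc (B z) by apply: lt_le_trans lB; exact: expR_gt0.
split; first by rewrite -nc_gt0.
rewrite ke lee_fin; have : ln (expR (- k)) <= ln (nc (B z)).
  by rewrite ler_ln ?posrE// expR_gt0.
by rewrite expRK; lra.
Qed.

Hypothesis kappa0 : (kappa 0%R < +oo)%E.
Hypothesis small_kappa : forall e : R, 0 < e -> exists n, (\int[mu]_t (\sum_(j <oo)
    (g n j t * \1_J t)%:E * logmaj (Re (Es j (circ (rn R n) t)) - a)) <= e%:E)%E.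

Lemma admissible_B : admissible B.
Proof.
split; last by have [] := log_B_le nc0_lt1 kappa0.
by split; [exact: hol_product|exact: B_le1].
Qed.

Let small_mean (x : R) : 0 < x -> exists2 r, 0 <= r < 1 &
  forall u : R -> R, continuous u -> (forall t, 0 <= u t) ->
    (forall t, B (circ r t) != 0 -> u t <= - ln (nc (B (circ r t)))) -> rmean u <= x.
Proof.
move=> x0; have p0 : 0 < 2 * (pi : R) by rewrite mulr_gt0// pi_gt0.
have [n hn] := small_kappa (mulr_gt0 p0 x0).
exists (rn R n); first by rewrite rn_ge0 rn_lt1.
move=> u cu u0 ub; rewrite /rmean ler_pdivrMl// -lee_fin.
rewrite -(integral_J_rint cu); apply: le_trans hn.
have mt (j : nat) : measurable_fun setT (fun t => (g n j t * \1_J t)%:E *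
    logmaj (Re (Es j (circ (rn R n) t)) - a))%E.
  apply: emeasurable_funM.
    apply/measurable_EFinP; apply: measurable_funM; last exact: measurable_indic.
    by apply: continuous_measurable_fun; exact: g_cont.
  apply: (measurableT_comp (@measurable_logmaj R)).
  apply: measurable_funB => //; apply: continuous_measurable_fun.
  exact: (ccont_Re (ccirc_hol (holE j) n)).
have tg j t : (0 <= (g n j t * \1_J t)%:E * logmaj (Re (Es j (circ (rn R n) t)) - a))%E.
  by rewrite mule_ge0 ?logmaj_ge0// lee_fin.
apply: ge0_le_integral => //.
- by move=> t _; rewrite lee_fin mulr_ge0.
- apply/measurable_EFinP; apply: measurable_funM; last exact: measurable_indic.
  exact: continuous_measurable_fun.
- by apply: (ge0_emeasurable_sum (P := xpredT)) => [j t _ _|j _]; [exact: tg|exact: mt].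
move=> t _; rewrite indicE; case: (boolP (t \in J)) => tJ; last first.
  by rewrite mulr0; apply: nneseries_ge0 => j _ _; rewrite mulr0 mul0e.
rewrite mulr1.
have -> : (\sum_(j <oo) (g n j t * 1%:R)%:E * logmaj (Re (Es j (circ (rn R n) t)) - a) =
    kappa (circ (rn R n) t))%E.
  by apply: eq_eseriesr => j _; rewrite mulr1.
have [kt|kt] := ltP (kappa (circ (rn R n) t)) +oo%E; last first.
  by apply: le_trans kt; rewrite leey.
have [b0 bl] := log_B_le (nc_circ_lt1 n t) kt.
by apply: le_trans bl; rewrite lee_fin ub.
Qed.

Lemma blaschke_B : blaschke_product B.
Proof. exact: (blaschke_criterion admissible_B small_mean). Qed.

(** A constant [B] would have modulus strictly between 0 and 1, since its first factor is less than
    1 in modulus at the origin; its logarithmic means would then be a fixed positive number. *)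
Lemma nonconstant_B : exists2 z, nc z < 1 & B z != B 0.
Proof.
apply: contrapT => H.
have E z : nc z < 1 -> B z = B 0.
  by move=> z1; apply: contrapT => /eqP h; apply: H; exists z.
have b0 : 0 < nc (B 0) by rewrite nc_gt0; case: admissible_B.
have b1 : nc (B 0) < 1.
  apply: le_lt_trans (S_lt1 0 nc0_lt1).
  apply: (clim_le (clim_shift (B_lim nc0_lt1))) => n.
  rewrite /P big_nat_recl//= ncM ler_piMr ?nc_ge0// nc_prod.
  by apply: prodr_ile1 => j _; rewrite nc_ge0 ltW// S_lt1.
have L : 0 < - ln (nc (B 0)) by rewrite oppr_gt0 ln_lt0// b0 b1.
have [r /andP[r0 r1] h] := @small_mean (- ln (nc (B 0)) / 2) ltac:(by rewrite divr_gt0).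
have := h (fun=> - ln (nc (B 0))) (fun t => @cvg_cst _ _ _ _ _) (fun=> ltW L).
rewrite rmean_cst => H2.
have : - ln (nc (B 0)) <= - ln (nc (B 0)) / 2.
  by apply: H2 => t _; rewrite E// nc_circ.
by move: L; move: (- ln _) => y; lra.
Qed.

Lemma product_conclusion : exists B' : C -> C, [/\ blaschke_product B',
  exists2 z, nc z < 1 & B' z != B' 0, B' 0 != 0,
  forall z, nc z < 1 -> clim (fun n => \prod_(0 <= j < n) (c j * mob ac (Es j z))) (B' z) &
  forall z, nc z < 1 -> clim (fun j => c j * mob ac (Es j z)) 1].
Proof.
exists B; split; [exact: blaschke_B|exact: nonconstant_B| |exact: B_lim|exact: factor_lim].
by case: admissible_B.
Qed.

End Convergence.

Lemma frostman_product : exists (a : R) (c : nat -> C) (B : C -> C),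
  [/\ `|a| <= 2^-1, forall j, nc (c j) = 1, blaschke_product B,
  exists2 z, nc z < 1 & B z != B 0 &
  [/\ B 0 != 0,
  forall z, nc z < 1 -> clim (fun n => \prod_(0 <= j < n) (c j * mob a%:C%C (Es j z))) (B z) &
  forall z, nc z < 1 -> clim (fun j => c j * mob a%:C%C (Es j z)) 1]].
Proof.
have [a [a_le k0 sk]] := frostman_choice.
have ex j : exists c : C, nc c = 1 /\
    c * mob a%:C%C (Es j 0) = (nc (mob a%:C%C (Es j 0)))%:C%C.
  by have [c c1 cE] := phase (mob a%:C%C (Es j 0)); exists c.
have [c hc] := choice ex.
have [B [h1 h2 h3 h4 h5]] := product_conclusion a_le (fun j => (hc j).1)
  (fun j => (hc j).2) k0 sk.
by exists a, c, B; split => // j; have [] := hc j.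
Qed.

End Blaschke.
End Product.

(** * Orbits of disk automorphisms *)

Section HyperbolicAutomorphism.
Variable R : realType.
Local Notation C := R[i].
Local Notation nc := (@ComplexField.Normc.normc R).
Local Notation Re := (@complex.Re R).
Local Notation Im := (@complex.Im R).

Lemma rc0 : 0%:C%C = 0 :> C. Proof. by []. Qed.
Lemma rcN (x : R) : (- x)%:C%C = - x%:C%C :> C. Proof. exact: rmorphN. Qed.

(** Under [det1], the action of the matrix of SU(1,1) with rows [al, b] and [b, conj al]. The
    off-diagonal entry is real, which a rotation of the variable can always achieve. *)
Definition automorphism (al : C) (b : R) (y : C) : C :=
  (al * y + b%:C%C) / (b%:C%C * y + al^*%C).

Section Iterates.
Variables (al : C) (b : R).
Hypothesis det1 : nc al ^+ 2 = 1 + b ^+ 2.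
Local Notation bc := (b%:C%C : C).
Local Notation Mf := (automorphism al b).

Lemma al_gt0 : 0 < nc al.
Proof.
have : 0 < nc al ^+ 2 by rewrite det1 ltr_pwDl// sqr_ge0.
by rewrite exprn_even_gt0//= lt_neqAle eq_sym nc_ge0 andbT.
Qed.

Lemma al_neq0 : al != 0. Proof. by rewrite -nc_gt0 al_gt0. Qed.
Lemma alJ_neq0 : al^*%C != 0. Proof. by rewrite -nc_gt0 ncJ al_gt0. Qed.

Let center : C := - (bc / al).

Let center_lt1 : nc center < 1.
Proof.
rewrite /center ncN ncM ncV nc_real ltr_pdivrMr ?al_gt0// mul1r.
rewrite -(@ltr_pXn2r _ 2) ?nnegrE ?nc_ge0// det1 real_normK ?num_real//.
by rewrite ltrDr.
Qed.

Lemma automorphismE (y : C) : Mf y = al / al^*%C * mob center y.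
Proof.
have e : bc * y + al^*%C = al^*%C * (1 - center^*%C * y).
  rewrite /center !cjE mulNr opprK mulrDr mulr1 addrC; congr (_ + _).
  by rewrite !mulrA [_ * bc]mulrC mulfK// alJ_neq0.
have f : al * y + bc = al * (y - center).
  by rewrite /center opprK mulrDr mulrCA mulfV ?al_neq0// mulr1.
by rewrite /automorphism e f /mob invfM !mulrA; congr (_ * _); rewrite mulrAC.
Qed.

Let rot1 : nc (al / al^*%C) = 1.
Proof. by rewrite ncM ncV ncJ divff// gt_eqF// al_gt0. Qed.

Lemma weakly_inner_automorphism k H : weakly_inner H ->
  weakly_inner (fun z => iter k Mf (H z)).
Proof.
move=> wH; elim: k => [//|k IH].
have h := weakly_inner_rot rot1 (weakly_inner_mob center_lt1 IH).
have -> // : (fun z => iter k.+1 Mf (H z)) =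
  (fun z => al / al^*%C * mob center (iter k Mf (H z))).
by apply/funext => z; rewrite iterS automorphismE.
Qed.

Section Growth.
Hypothesis trace2 : 1 <= Re al.
Hypothesis b_neq0 : b != 0.
Variable y : C.
Hypothesis y1 : nc y < 1.

Let x := Re al.
(* The powers of the matrix of the automorphism are V_k M - W_k. *)
Let VW := fix VW k := if k is k'.+1 then (2 * x * (VW k').1 - (VW k').2, (VW k').1)
                      else (0, -1) : R * R.
Let V k := (VW k).1.
Let W k := (VW k).2.

(** [V k - W k] is the last increment of [V], and [x >= 1] keeps it from decreasing. In the
    parabolic case [x = 1] the growth is exactly linear. *)
Let VW_step k : V k - W k >= 1 /\ V k >= k%:R.
Proof.
elim: k => [|k [IH1 IH2]]; first by rewrite /V /W/=; split=> //; lra.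
rewrite /V /W/= -/(V k) -/(W k).
have V0 : 0 <= V k by apply: le_trans IH2.
have x1 : 1 <= x by [].
have : 0 <= (x - 1) * V k by apply: mulr_ge0 => //; lra.
have -> : (k.+1%:R : R) = k%:R + 1 by rewrite -natr1.
move: (V k) (W k) (k%:R : R) (x) IH1 IH2 V0 x1 => v w n x' IH1 IH2 V0 x1 h; split; lra.
Qed.

(** The left-hand side is the determinant of the [k]-th power of the matrix. *)
Let VW_inv k : V k ^+ 2 - 2 * x * V k * W k + W k ^+ 2 = 1.
Proof.
elim: k => [|k IH]; first by rewrite /V /W/=; ring.
by rewrite /V /W/= -/(V k) -/(W k) -[RHS]IH; ring.
Qed.

Let N k : C := (V k)%:C%C * (al * y + bc) - (W k)%:C%C * y.
Let D k : C := (V k)%:C%C * (bc * y + al^*%C) - (W k)%:C%C.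

Let N0 : N 0 = y.
Proof. by rewrite /N (_ : V 0 = 0)// (_ : W 0 = -1)// rcN rc1 rc0 mul0r sub0r mulN1r opprK. Qed.
Let D0 : D 0 = 1.
Proof. by rewrite /D (_ : V 0 = 0)// (_ : W 0 = -1)// rcN rc1 rc0 mul0r sub0r opprK. Qed.

Let trace : (2 * x)%:C%C = al + al^*%C :> C.
Proof. by apply: complex_eqP; rewrite !ReImE /x/=; ring. Qed.

Let det : al * al^*%C = 1 + bc ^+ 2.
Proof. by rewrite -nc_sqrC det1 rcD rc1 rcX. Qed.

Let N_step k : N k.+1 = al * N k + bc * D k.
Proof.
rewrite /N /D /V /W/= -/(V k) -/(W k) rcB rcM trace.
move: ((V k)%:C%C) ((W k)%:C%C) => v w.
have -> : ((al + al^*%C) * v - w) * (al * y + bc) - v * y =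
  v * (al ^+ 2 * y + al * al^*%C * y + (al + al^*%C) * bc - y) - w * (al * y + bc) by ring.
by rewrite det; ring.
Qed.

Let D_step k : D k.+1 = bc * N k + al^*%C * D k.
Proof.
rewrite /N /D /V /W/= -/(V k) -/(W k) rcB rcM trace.
move: ((V k)%:C%C) ((W k)%:C%C) => v w.
have -> : ((al + al^*%C) * v - w) * (bc * y + al^*%C) - v =
  v * ((al + al^*%C) * bc * y + al * al^*%C + al^*%C ^+ 2 - 1) - w * (bc * y + al^*%C) by ring.
by rewrite det; ring.
Qed.

Let form_step (n d : C) :
  nc (bc * n + al^*%C * d) ^+ 2 - nc (al * n + bc * d) ^+ 2 = nc d ^+ 2 - nc n ^+ 2.
Proof.
have -> : nc d ^+ 2 - nc n ^+ 2 = (nc al ^+ 2 - b ^+ 2) * (nc d ^+ 2 - nc n ^+ 2).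
  by rewrite det1 addrK mul1r.
by rewrite !nc_sqr !ReImE/=; ring.
Qed.

(** The Hermitian form [|d|^2 - |n|^2] is invariant under SU(1,1). The defect of the [k]-th iterate
    is therefore exactly [(1 - |y|^2) / |D k|^2], and only the growth of [D k] matters. *)
Let form k : nc (D k) ^+ 2 - nc (N k) ^+ 2 = 1 - nc y ^+ 2.
Proof.
elim: k => [|k IH]; last by rewrite N_step D_step form_step.
by rewrite N0 D0 nc1 expr1n.
Qed.

Let gap : 0 < 1 - nc y ^+ 2. Proof. by rewrite subr_gt0 expr_lt1 ?nc_ge0. Qed.

Let D_gt0 k : 0 < nc (D k) ^+ 2.
Proof. by have := form k; have := gap; have := sqr_ge0 (nc (N k)); lra. Qed.

Let D_neq0 k : D k != 0.
Proof. by apply/eqP => e; have := D_gt0 k; rewrite e nc0 expr0n ltxx. Qed.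

Let iterE k : iter k Mf y = N k / D k.
Proof.
elim: k => [|k IH].
  by rewrite N0 D0 divr1.
rewrite iterS IH /automorphism N_step D_step.
have e (u w n d : C) : d != 0 -> u * (n / d) + w = (u * n + w * d) / d.
  by move=> d0; rewrite mulrDl mulfK// mulrA.
have f (p q d : C) : d != 0 -> (p / d) / (q / d) = p / q.
  by move=> d0; rewrite invf_div mulrA divfK.
by rewrite (e _ _ _ _ (D_neq0 k)) (e _ _ _ _ (D_neq0 k)) (f _ _ _ (D_neq0 k)).
Qed.

(** [p] is the lower diagonal entry of the matrix power; its determinant 1 makes [|p|] exceed the
    off-diagonal entry [V k * |b|], so [D k], which is [p] plus that entry times [y], stays
    large. *)
Let D_ge k : k%:R * `|b| * (1 - nc y) <= nc (D k).
Proof.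
have [_ Vk] := VW_step k; have V0 : 0 <= V k by apply: le_trans Vk.
pose p := (V k)%:C%C * al^*%C - (W k)%:C%C : C.
have np : nc p ^+ 2 = 1 + (V k * `|b|) ^+ 2.
  rewrite exprMn real_normK ?num_real// -[1](VW_inv k) nc_sqr /p !ReImE/=.
  have := det1; rewrite nc_sqr -/x => h.
  have -> : b ^+ 2 = x ^+ 2 + Im al ^+ 2 - 1 by rewrite /x h; ring.
  by rewrite /x; ring.
have pge : V k * `|b| <= nc p.
  rewrite -(@ler_pXn2r _ 2)// ?nnegrE ?nc_ge0 ?mulr_ge0// np.
  by rewrite lerDr.
have -> : D k = p - (- ((V k)%:C%C * bc * y)) by rewrite /D /p; ring.
apply: le_trans (ncB_ge _ _); rewrite ncN !ncM !nc_real (ger0_norm V0).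
have : k%:R * `|b| * (1 - nc y) <= V k * `|b| * (1 - nc y).
  apply: ler_wpM2r; first by rewrite subr_ge0 ltW.
  by apply: ler_wpM2r.
by lra.
Qed.

Lemma iter_automorphism_gap k : (0 < k)%N ->
  1 - nc (iter k Mf y) ^+ 2 <= ((b * (1 - nc y)) ^+ 2)^-1 / k%:R ^+ 2.
Proof.
move=> k0; have kp : (0 : R) < k%:R by rewrite ltr0n.
have b0 : 0 < `|b| by rewrite normr_gt0.
have g0 : 0 < 1 - nc y by rewrite subr_gt0.
have -> : 1 - nc (iter k Mf y) ^+ 2 = (1 - nc y ^+ 2) / nc (D k) ^+ 2.
  rewrite iterE ncM ncV expr_div_n -(form k) mulrBl divff//.
  by rewrite gt_eqF.
have c0 : 0 < k%:R * `|b| * (1 - nc y) by rewrite !mulr_gt0.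
have -> : ((b * (1 - nc y)) ^+ 2)^-1 / k%:R ^+ 2 = ((k%:R * `|b| * (1 - nc y)) ^+ 2)^-1.
  by rewrite -invfM !exprMn real_normK ?num_real//; congr _^-1; ring.
rewrite -[leRHS]mul1r; apply: ler_pM.
- exact: ltW gap.
- by rewrite invr_ge0 ltW.
- by rewrite gerBl sqr_ge0.
- rewrite lef_pV2 ?posrE// ?exprn_gt0//.
  by rewrite lerXn2r ?nnegrE ?nc_ge0 ?D_ge// ltW.
Qed.

End Growth.
End Iterates.

Lemma automorphismK (al : C) (b : R) y : nc al ^+ 2 = 1 + b ^+ 2 -> nc y < 1 ->
  automorphism al^*%C (- b) (automorphism al b y) = y.
Proof.
move=> det y1.
have d : b%:C%C * y + al^*%C != 0.
  apply/eqP => e; have h : nc al <= nc (b%:C%C * y).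
    have -> : b%:C%C * y = - al^*%C by apply/eqP; rewrite -subr_eq0 opprK e.
    by rewrite ncN ncJ.
  have : nc (b%:C%C * y) <= `|b| by rewrite ncM nc_real ler_piMr// ltW.
  move=> h2; have := le_trans h h2.
  by rewrite -(@ler_pXn2r _ 2)// ?nnegrE ?nc_ge0// det real_normK ?num_real//; lra.
have dc : al * al^*%C = 1 + b%:C%C ^+ 2 :> C by rewrite -nc_sqrC det rcD rc1 rcX.
rewrite /automorphism conjcK rcN; move: d dc.
move: (b%:C%C : C) (al^*%C) => bb aj d dc.
have e : - bb * ((al * y + bb) / (bb * y + aj)) + al = (bb * y + aj)^-1.
  apply: (mulIf d); rewrite mulVf// mulrDl -mulrA divfK//.
  have -> : - bb * (al * y + bb) + al * (bb * y + aj) = al * aj - bb ^+ 2 by ring.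
  by rewrite dc addrK.
have f : aj * ((al * y + bb) / (bb * y + aj)) + - bb = y / (bb * y + aj).
  apply: (mulIf d); rewrite divfK// mulrDl -mulrA divfK//.
  have -> : aj * (al * y + bb) + - bb * (bb * y + aj) = (al * aj - bb ^+ 2) * y by ring.
  by rewrite dc addrK mul1r.
by rewrite e f invrK divfK.
Qed.

Lemma clim_subseq (u : nat -> C) (a : C) (f : nat -> nat) : (forall n, (n <= f n)%N) ->
  clim u a -> clim (fun n => u (f n)) a.
Proof.
move=> hf /climP h; apply/climP => e /h[N hN]; exists N => n Nn.
by apply: hN; exact: leq_trans Nn (hf n).
Qed.

(** * The Blaschke product over a two-sided orbit *)

Section Orbit.
Variables (phi H : C -> C) (al : C) (b : R).
Hypothesis phi_lt1 : forall z, nc z < 1 -> nc (phi z) < 1.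
Hypothesis wH : weakly_inner H.
Hypothesis det1 : nc al ^+ 2 = 1 + b ^+ 2.
Hypothesis trace2 : 1 <= Re al.
Hypothesis b_neq0 : b != 0.
Hypothesis model : forall z, nc z < 1 -> H (phi z) = automorphism al b (H z).

Let Mf := automorphism al b.
Let Mi := automorphism al^*%C (- b).
Let A k z := iter k Mf (H z).
Let B k z := iter k Mi (H z).
(** Interleaves the two half-orbits: index [2k] carries the power [k] of the automorphism and index
    [2k + 1] the power [- (k + 1)], so each integer occurs once and a one-sided product suffices. *)
Let Es j := if odd j then B j./2.+1 else A j./2.

Let det1' : nc al^*%C ^+ 2 = 1 + (- b) ^+ 2.
Proof. by rewrite ncJ sqrrN. Qed.

Let H1 z : nc z < 1 -> nc (H z) < 1.
Proof. by move=> z1; have [[_ ->]] := wH. Qed.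

Let A_phi k z : nc z < 1 -> A k (phi z) = A k.+1 z.
Proof. by move=> z1; rewrite /A model// iterSr. Qed.

Let B_phi k z : nc z < 1 -> B k.+1 (phi z) = B k z.
Proof. by move=> z1; rewrite /B model// iterSr /Mi automorphismK// H1. Qed.

Let wEs j : weakly_inner (Es j).
Proof.
rewrite /Es; case: (odd j).
  exact: (weakly_inner_automorphism det1' j./2.+1 wH).
exact: (weakly_inner_automorphism det1 j./2 wH).
Qed.

Let K := ((b * (1 - nc (H 0))) ^+ 2)^-1.
(** [v j - v j.+1] is [4 * (2 + 6 * K) / ((j + 1) * (j + 2))]; the 4 pays for the interleaving,
    where [j] is about twice the exponent. *)
Let v (j : nat) : R := (8 + 24 * K) / j.+1%:R.

Let K_ge0 : 0 <= K. Proof. by rewrite invr_ge0 sqr_ge0. Qed.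

(** The 6 is the largest ratio [(k + 2) * (k + 3) / (k + 1)^2], reached at [k = 0]; the 2 covers the
    zeroth power, where the defect is only known to be at most 1. *)
Let gapA k : 1 - nc (A k 0) ^+ 2 <= (2 + 6 * K) / (k.+1%:R * k.+2%:R).
Proof.
case: k => [|k].
  apply: (@le_trans _ _ 1); first by rewrite gerBl sqr_ge0.
  by rewrite ler_pdivlMr ?mulr_gt0// -natrM; have := K_ge0; lra.
have h := iter_automorphism_gap det1 trace2 b_neq0 (H1 (_ : nc 0 < 1)) (ltn0Sn k).
apply: le_trans (h _) _; first by rewrite nc0.
rewrite -/K ler_pdivrMr ?exprn_gt0// mulrAC ler_pdivlMr ?mulr_gt0//.
have e2 : (k.+2%:R : R) = k.+1%:R + 1 by rewrite -natr1.
have e3 : (k.+3%:R : R) = k.+1%:R + 2 by rewrite -natr1 e2; lra.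
rewrite e2 e3; have k1 : (1 : R) <= k.+1%:R by rewrite ler1n.
move: (k.+1%:R : R) k1 K_ge0 => n n1; move: K => c c0.
have h1 : 0 <= c * (n - 1) by apply: mulr_ge0; lra.
have h2 : 0 <= c * (n - 1) * n by apply: mulr_ge0 => //; lra.
have h3 : 0 <= n ^+ 2 by exact: sqr_ge0.
by move: h3; rewrite !expr2; lra.
Qed.

Let gapB k : 1 - nc (B k.+1 0) ^+ 2 <= (2 + 6 * K) / (k.+2%:R * k.+3%:R).
Proof.
have x2 : 1 <= Re al^*%C by rewrite !ReImE.
have nb : - b != 0 by rewrite oppr_eq0.
have h := iter_automorphism_gap det1' x2 nb (H1 (_ : nc 0 < 1)) (ltn0Sn k).
apply: le_trans (h _) _; first by rewrite nc0.
rewrite mulNr sqrrN -/K ler_pdivrMr ?exprn_gt0// mulrAC ler_pdivlMr ?mulr_gt0//.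
have e2 : (k.+2%:R : R) = k.+1%:R + 1 by rewrite -natr1.
have e3 : (k.+3%:R : R) = k.+1%:R + 2 by rewrite -natr1 e2; lra.
rewrite e2 e3; have k1 : (1 : R) <= k.+1%:R by rewrite ler1n.
move: (k.+1%:R : R) k1 K_ge0 => n n1; move: K => c c0.
have h1 : 0 <= c * (n - 1) by apply: mulr_ge0; lra.
have h2 : 0 <= c * (n - 1) * n by apply: mulr_ge0 => //; lra.
have h3 : 0 <= n ^+ 2 by exact: sqr_ge0.
by move: h3; rewrite !expr2; lra.
Qed.

Let gapEs j : 1 - nc (Es j 0) ^+ 2 <= v j - v j.+1.
Proof.
have -> : v j - v j.+1 = (2 + 6 * K) * 4 / (j.+1%:R * j.+2%:R).
  rewrite /v; have : (j.+2%:R : R) = j.+1%:R + 1 by rewrite -natr1.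
  move=> ->; have : (0 : R) < j.+1%:R by [].
  move: (j.+1%:R : R) => n n0; field.
  by rewrite !gt_eqF//; lra.
have k0 : 0 <= 2 + 6 * K by have := K_ge0; lra.
rewrite /Es; have := odd_double_half j; case: (odd j) => /=; move: j./2 => i ji.
- apply: le_trans (gapB i) _; rewrite -mulrA; apply: ler_wpM2l => //.
  rewrite ler_pdivlMr ?mulr_gt0// mulrC ler_pdivrMr ?mulr_gt0//.
  rewrite -ji -muln2 -!natrM ler_nat; nia.
- apply: le_trans (gapA i) _; rewrite -mulrA; apply: ler_wpM2l => //.
  rewrite ler_pdivlMr ?mulr_gt0// mulrC ler_pdivrMr ?mulr_gt0//.
  rewrite -ji -muln2 -!natrM ler_nat; nia.
Qed.

Let v_lim : v @ \oo --> (0 : R).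
Proof. by apply: (cvg_scale0 (8 + 24 * K)); exact: cvg_harmonic. Qed.

(* Both sides are the product of m over the whole orbit segment. *)
Let orbit_product (m : C -> C) k z : nc z < 1 ->
  (\prod_(0 <= j < k.*2) m (Es j (phi z))) * m (B k z) =
  (\prod_(0 <= j < k.*2) m (Es j z)) * m (A k z).
Proof.
move=> z1; elim: k => [|k IH]; first by rewrite !big_geq.
have Eo w : Es k.*2.+1 w = B k.+1 w by rewrite /Es/= odd_double/= uphalf_double.
have Ee w : Es k.*2 w = A k w by rewrite /Es odd_double doubleK.
rewrite doubleS; do 2 rewrite [in LHS]big_nat_recr// [in RHS]big_nat_recr//.
rewrite !Eo !Ee A_phi// B_phi//.
move: IH; move: (\prod_(_ <= _ < _) m _) (\prod_(_ <= _ < _) m _) => p q IH.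
move: IH; move: (m (A k z)) (m (B k z)) (m (A k.+1 z)) (m (B k.+1 z)) => x y x' y' IH.
rewrite [LHS](_ : _ = q * y * x' * y'); last by rewrite /=; ring.
by rewrite IH /=; ring.
Qed.

Lemma orbit_blaschke : exists (F : C -> C) (tau : C), [/\ blaschke_product F,
  exists2 z, nc z < 1 & F z != F 0, nc tau = 1 &
  forall z, nc z < 1 -> F (phi z) = tau * F z].
Proof.
have [a [c [F [a_le c1 bF ncF [F0 limF lim1]]]]] := frostman_product wEs gapEs v_lim.
move: (mob (a%:C%C : C)) limF lim1 => m limF lim1.
pose P n z := \prod_(0 <= j < n) (c j * m (Es j z)).
(* Each truncated product receives one extra factor, which tends to 1, so that both run over the
   same orbit segment. They then differ by a unimodular constant [t k] that does not depend on
   [z]. *)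
pose X k z := P k.+1.*2 (phi z) * (c k.*2.+1 * m (Es k.*2.+1 z)).
pose Y k z := P k.+1.*2 z * (c k.+1.*2 * m (Es k.+1.*2 z)).
pose t k := c k.+1.*2 / c k.*2.+1.
have z01 : nc (0 : C) < 1 by rewrite nc0.
have cn0 j : c j != 0 by rewrite -nc_gt0 c1.
have t1 k : nc (t k) = 1 by rewrite /t ncM ncV !c1 divr1.
have XY k z : nc z < 1 -> X k z * t k = Y k z.
  move=> z1; have := orbit_product m k.+1 z1.
  have -> : B k.+1 z = Es k.*2.+1 z by rewrite /Es/= odd_double/= uphalf_double.
  have -> : A k.+1 z = Es k.+1.*2 z by rewrite /Es odd_double doubleK.
  move=> h; rewrite /X /Y /P !big_split/=.
  move: h; move: (\prod_(_ <= _ < _) m _) (\prod_(_ <= _ < _) m _) => q p.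
  move: (m (Es k.*2.+1 z)) (m (Es k.+1.*2 z)) (\prod_(_ <= _ < _) c _) => x y d h.
  have -> : d * p * (c k.*2.+1 * x) * t k = d * (p * x) * (c k.*2.+1 * t k) by ring.
  have -> : c k.*2.+1 * t k = c k.+1.*2 by rewrite /t mulrC divfK.
  by rewrite h; ring.
have le1 k : (k <= k.+1.*2)%N by rewrite -addnn leqW// leq_addr.
have le2 k : (k <= k.*2.+1)%N by rewrite leqW// -addnn leq_addr.
have X_lim z : nc z < 1 -> clim (X ^~ z) (F (phi z)).
  move=> z1; rewrite -[F _]mulr1; apply: climM.
    exact: (@clim_subseq (fun n => P n (phi z)) _ (fun k => k.+1.*2) le1 (limF _ (phi_lt1 z1))).
  exact: (@clim_subseq (fun j => c j * m (Es j z)) _ (fun k => k.*2.+1) le2 (lim1 _ z1)).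
have Y_lim z : nc z < 1 -> clim (Y ^~ z) (F z).
  move=> z1; rewrite -[F _]mulr1; apply: climM.
    exact: (@clim_subseq (fun n => P n z) _ (fun k => k.+1.*2) le1 (limF _ z1)).
  exact: (@clim_subseq (fun j => c j * m (Es j z)) _ (fun k => k.+1.*2) le1 (lim1 _ z1)).
have nF : nc (F (phi 0)) = nc (F 0).
  have h1 := clim_nc (X_lim 0 z01); have h2 := clim_nc (Y_lim 0 z01).
  have e : (fun k => nc (X k 0)) = (fun k => nc (Y k 0)).
    by apply/funext => k; rewrite -XY// ncM t1 mulr1.
  by rewrite e in h1; exact: (cvg_unique (@Rhausdorff R) h1 h2).
(* Cross-multiplying with the values at 0 cancels [t k], so its convergence need not be discussed;
   dividing by [F 0 != 0] then gives [tau]. *)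
have E z : nc z < 1 -> F (phi z) * F 0 = F z * F (phi 0).
  move=> z1; apply: (@clim_unique R (fun k => X k z * Y k 0)).
    exact: climM (X_lim z z1) (Y_lim 0 z01).
  apply: (clim_eq (u := fun k => Y k z * X k 0)); last exact: climM (Y_lim z z1) (X_lim 0 z01).
  by move=> k; rewrite -!XY//; ring.
exists F, (F (phi 0) / F 0); split=> //.
  by rewrite ncM ncV nF divff// nc_eq0.
by move=> z z1; apply: (mulIf F0); rewrite E// mulrAC divfK// mulrC.
Qed.

End Orbit.

(** With [p = conj nu * ('i * x)] the fixed point equation becomes the real quadratic
    [l * x^2 - 2 * s * x + l = 0], where [s] is the imaginary part of [nu]. Its roots have product 1
    and are real and distinct as [l < s]; the smaller one lies in [(0, 1)]. *)
Lemma elliptic_fixed_point (nu : C) (l : R) : nc nu = 1 -> 0 < l < Im nu ->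
  exists2 p, nc p < 1 & nu ^+ 2 * p + l%:C%C - p * (1 + l%:C%C * nu ^+ 2 * p) = 0.
Proof.
move=> nu1 /andP[l0 ls]; pose s := Im nu.
have s0 : 0 < s by apply: lt_trans ls.
have q2 : 0 < s ^+ 2 - l ^+ 2 by rewrite subr_gt0 ltrXn2r ?nnegrE ?ltW.
pose q := Num.sqrt (s ^+ 2 - l ^+ 2).
have qE : q ^+ 2 = s ^+ 2 - l ^+ 2 by rewrite sqr_sqrtr// ltW.
have q0 : 0 < q by rewrite sqrtr_gt0.
have qs : q < s by rewrite -(@ltr_pXn2r _ 2)// ?nnegrE ?ltW// qE gtrBl exprn_gt0.
have sl : s - q < l.
  rewrite -subr_gt0; have : 0 < (s + q) * (l - (s - q)).
    rewrite (_ : _ * _ = l * (s - l + q)); last first.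
      by have := qE; rewrite !expr2 => h; ring: h.
    by rewrite mulr_gt0// addr_gt0// subr_gt0.
  by rewrite pmulr_rgt0// addr_gt0.
pose x := (s - q) / l.
have x0 : 0 < x by rewrite divr_gt0// subr_gt0.
have x1 : x < 1 by rewrite ltr_pdivrMr// mul1r.
have lx : l * x = s - q by rewrite mulrC divfK// gt_eqF.
clearbody x q.
have xE : l * x ^+ 2 - 2 * s * x + l = 0.
  apply: (@mulfI _ l); first by rewrite gt_eqF.
  have -> : l * (l * x ^+ 2 - 2 * s * x + l) = (l * x) ^+ 2 - 2 * s * (l * x) + l ^+ 2 by ring.
  by rewrite lx; have := qE; rewrite !expr2 mulr0 => h; ring: h.
exists (nu^*%C * ('i%C * x%:C%C)).
  by rewrite !ncM ncJ nu1 mul1r nc_real ger0_norm ?ltW// (_ : nc 'i%C = 1) ?mul1r//= expr0n expr1n add0r sqrtr1.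
have nn : nu * nu^*%C = 1 by rewrite -nc_sqrC nu1 expr1n rc1.
have ii : 'i%C * 'i%C = -1 :> C by rewrite -expr2 sqr_i.
have e1 : nu ^+ 2 * (nu^*%C * ('i%C * x%:C%C)) = nu * ('i%C * x%:C%C).
  by rewrite expr2 mulrA -(mulrA nu) nn mulr1.
have e2 : nu - nu^*%C = (2 * s)%:C%C * 'i%C.
  by apply: complex_eqP; rewrite !ReImE /s/=; ring.
have -> : nu ^+ 2 * (nu^*%C * ('i%C * x%:C%C)) + l%:C%C -
   nu^*%C * ('i%C * x%:C%C) * (1 + l%:C%C * nu ^+ 2 * (nu^*%C * ('i%C * x%:C%C))) =
   (nu - nu^*%C) * 'i%C * x%:C%C + l%:C%C - l%:C%C * x%:C%C ^+ 2 * (nu * nu^*%C) * ('i%C * 'i%C).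
  by rewrite -[l%:C%C * nu ^+ 2 * _]mulrA e1; ring.
rewrite nn ii e2 -[(2 * s)%:C%C * 'i%C * 'i%C]mulrA ii.
rewrite (_ : _ - _ = (l * x ^+ 2 - 2 * s * x + l)%:C%C); first by rewrite xE.
rewrite !(rcD, rcB, rcM, rcX); ring.
Qed.

End HyperbolicAutomorphism.

(** * Maps without and with a fixed point in the disk *)

Section Main.
Variable R : realType.
Local Notation C := R[i].
Local Notation nc := (@ComplexField.Normc.normc R).
Local Notation Re := (@complex.Re R).
Local Notation Im := (@complex.Im R).

Lemma rhoE (z w : C) : rho z w = (nc (mob z w))%:C%C.
Proof.
rewrite /rho normE mobC; congr (_%:C)%C.
by rewrite -[LHS]ncN -mulNr opprB.
Qed.

Lemma unimodular_sqrt (L : C) : nc L = 1 ->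
  exists nu : C, [/\ nu ^+ 2 = L, nc nu = 1 & 0 <= Re nu].
Proof.
move=> L1; pose nu := sqrtc L.
have e : nu ^+ 2 = L by exact: sqr_sqrtc.
have n1 : nc nu = 1.
  have : nc nu ^+ 2 = 1 by rewrite -ncX e.
  by move/eqP; rewrite sqrp_eq1 ?nc_ge0// => /eqP.
have [r0|r0] := leP 0 (Re nu); first by exists nu.
by exists (- nu); rewrite sqrrN ncN !ReImE oppr_ge0 ltW.
Qed.

Section NonElliptic.
Variables (phi G : C -> C) (L : C) (l : R).
Hypothesis phi_lt1 : forall z, nc z < 1 -> nc (phi z) < 1.
Hypothesis wG : weakly_inner G.
Hypothesis L1 : nc L = 1.
Hypothesis l01 : 0 < l < 1.
Hypothesis model : forall z, nc z < 1 -> mob l%:C%C (G (phi z)) = L * G z.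
Hypothesis nonelliptic : forall p, nc p < 1 ->
  L * p + l%:C%C - p * (1 + l%:C%C * L * p) != 0.

Let l0 : 0 < l. Proof. by case/andP: l01. Qed.
Let l2 : 0 < 1 - l ^+ 2. Proof. by case/andP: l01 => a b; rewrite subr_gt0 expr_lt1// ltW. Qed.

(** Otherwise [|Im nu| > l], and [nu] or [- nu] would produce a fixed point in the disk. After
    division by [s] this is the condition that the matrix has trace at least 2. *)
Let Re_ge (nu : C) : nu ^+ 2 = L -> nc nu = 1 -> 0 <= Re nu -> Num.sqrt (1 - l ^+ 2) <= Re nu.
Proof.
move=> e n1 r0.
rewrite -(@ler_pXn2r _ 2)// ?nnegrE ?sqrtr_ge0// sqr_sqrtr; last exact: ltW.
rewrite leNgt; apply/negP => lt.
have im : l ^+ 2 < Im nu ^+ 2.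
  have : nc nu ^+ 2 = 1 by rewrite n1 expr1n.
  by rewrite nc_sqr; lra.
have im' : l < `|Im nu|.
  by rewrite -(@ltr_pXn2r _ 2)// ?nnegrE ?ltW// real_normK ?num_real.
have [i0|i0] := leP 0 (Im nu).
  have [|p p1 pE] := @elliptic_fixed_point R nu l n1.
    by rewrite l0; move: im'; rewrite ger0_norm.
  by move: pE; rewrite e => /eqP; apply/negP; exact: nonelliptic.
have [| |p p1 pE] := @elliptic_fixed_point R (- nu) l.
- by rewrite ncN.
- by rewrite l0 !ReImE; move: im'; rewrite ltr0_norm.
by move: pE; rewrite sqrrN e => /eqP; apply/negP; exact: nonelliptic.
Qed.

Lemma nonelliptic_blaschke : exists (F : C -> C) (tau : C), [/\ blaschke_product F,
  exists2 z, nc z < 1 & F z != F 0, nc tau = 1 &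
  forall z, nc z < 1 -> F (phi z) = tau * F z].
Proof.
have [nu [nuE nu1 nu0]] := unimodular_sqrt L1.
pose s := Num.sqrt (1 - l ^+ 2).
have s0 : 0 < s by rewrite sqrtr_gt0.
have s2 : s ^+ 2 = 1 - l ^+ 2 by rewrite sqr_sqrtr// ltW.
have sr : s <= Re nu by exact: Re_ge.
clearbody s.
(* Rotating [G] by a square root [nu] of [L] gives the matrix with rows [nu, l] and [l, conj nu], of
   determinant [1 - l^2 = s^2]; dividing by [s] normalises it. *)
pose al : C := (s^-1)%:C%C * nu; pose b := s^-1 * l.
have wH := weakly_inner_rot nu1 wG.
have det : nc al ^+ 2 = 1 + b ^+ 2.
  rewrite /al /b ncM nu1 mulr1 nc_posreal ?invr_ge0 ?ltW// exprMn.
  have -> : l ^+ 2 = 1 - s ^+ 2 by rewrite s2; ring.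
  by field; rewrite gt_eqF.
have tr : 1 <= Re al.
  have -> : Re al = Re nu / s by rewrite /al !ReImE/=; ring.
  by rewrite ler_pdivlMr// mul1r.
have b0 : b != 0 by rewrite mulf_neq0 ?invr_eq0 ?gt_eqF.
apply: (orbit_blaschke phi_lt1 wH det tr b0) => z z1 /=.
have g1 : nc (G z) < 1 by have [[_ ->]] := wG.
have g1' : nc (G (phi z)) < 1 by have [[_ ->]] := wG; rewrite ?phi_lt1.
have nl : nc (l%:C%C : C) < 1 by rewrite nc_posreal ?ltW//; case/andP: l01.
have Lg1 : nc (L * G z) < 1 by rewrite ncM L1 mul1r.
have -> : G (phi z) = mob (- l%:C%C) (L * G z) by rewrite -model// mobK.
have D0 := @mob_den R (- l%:C%C) (L * G z) _ (ltW Lg1).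
have nu_neq0 : nu != 0 by rewrite -nc_gt0 nu1.
have nuj : nu^*%C = nu^-1.
  by apply: (mulfI nu_neq0); rewrite -nc_sqrC nu1 expr1n mulfV.
have sc0 : (s%:C%C : C) != 0 by rewrite -nc_gt0 nc_posreal ?ltW.
rewrite /mob /automorphism /al /b !cjE nuj rcM rcV.
have := D0 _; rewrite ncN !cjE => /(_ nl).
move: (G z) (s%:C%C : C) (l%:C%C : C) sc0 => g sc lc sc0 D1.
rewrite -nuE in D1 *; field; rewrite nu_neq0 sc0 /=.
by move: D1; apply: contra => /eqP h; apply/eqP; rewrite -h; ring.
Qed.

End NonElliptic.

Section Elliptic.
Variables (phi : C -> C) (q : C).
Hypothesis sphi : selfmap phi.
Hypothesis q1 : nc q < 1.
Hypothesis fixq : phi q = q.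

Let f z := mob q (phi (mob (- q) z)).

Let nq1 : nc (- q) < 1. Proof. by rewrite ncN. Qed.

Let conj_step z : nc z < 1 -> mob q (phi z) = f (mob q z).
Proof. by move=> z1; rewrite /f mobK. Qed.

Let schwarz_quotient : exists2 g, hol_bounded g 1 &
  forall z, nc z < 1 -> mob q (phi z) = mob q z * g (mob q z).
Proof.
have [hphi phi1] := sphi.
have bf : hol_bounded f 1.
  split.
    apply: hol_mob_comp => //.
      apply: (hol_comp (hol_mob nq1) _ hphi) => z z1; exact: nc_mob_lt1.
    by move=> z z1; rewrite ltW// phi1// nc_mob_lt1.
  by move=> z z1; rewrite ltW// nc_mob_lt1// phi1// nc_mob_lt1.
have f0 : f 0 = 0 by rewrite /f mob0 opprK fixq moba.
have [g bg gE] := schwarz bf f0.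
by exists g => // z z1; rewrite conj_step// gE// nc_mob_lt1.
Qed.

(* A non-rotation contracts towards its fixed point at a uniform rate on each orbit. *)
Let step_to0 g z0 : hol_bounded g 1 ->
  (forall z, nc z < 1 -> mob q (phi z) = mob q z * g (mob q z)) -> nc (g 0) < 1 ->
  nc z0 < 1 -> (fun n => nc (mob (iter n phi z0) (iter n.+1 phi z0))) @ \oo --> (0 : R).
Proof.
move=> bg gE g01 z01; have [hphi phi1] := sphi.
pose z n := iter n phi z0; pose w n := mob q (z n).
have z1 n : nc (z n) < 1 by elim: n => //= n IH; exact: phi1.
have w1 n : nc (w n) < 1 by exact: nc_mob_lt1.
have wS n : w n.+1 = w n * g (w n) by rewrite /w /= gE.
have g1 n : nc (g (w n)) <= 1 by case: bg => _; apply.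
have wr n : nc (w n) <= nc (w 0).
  elim: n => // n IH; apply: le_trans IH; rewrite wS ncM.
  by rewrite ler_piMr// nc_ge0.
pose r := nc (w 0); have r0 : 0 <= r by exact: nc_ge0. have r1 : r < 1 by exact: w1.
have k0 : 0 < 1 - r ^+ 2 by rewrite subr_gt0 expr_lt1.
pose K := 8 / (1 - r ^+ 2); have K0 : 0 < K by rewrite divr_gt0.
(* For [x = nc (g (w n))], [osc] gives [x - nc (g 0) <= K * (1 - x^2) <= 2 * K * (1 - x)], which
   rearranges to [t <= 1 - x]. *)
pose t := (1 - nc (g 0)) / (1 + 2 * K).
have K2 : 0 < 1 + 2 * K by move: K0; move: (K) => k; lra.
have t0 : 0 < t by rewrite divr_gt0 ?subr_gt0.
have gt n : t <= 1 - nc (g (w n)).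
  have zz : nc (0 : C) < 1 by rewrite nc0.
  have h := osc bg zz (w1 n); rewrite nc0 expr0n subr0 mulr1 in h.
  have kn : 8 / (1 - nc (w n) ^+ 2) <= K.
    rewrite /K ler_pM2l// lef_pV2 ?posrE//; last by rewrite subr_gt0 expr_lt1// nc_ge0.
    by rewrite lerB// lerXn2r ?nnegrE ?nc_ge0// wr.
  have d0 : 0 <= 1 - nc (g (w n)) ^+ 2 by rewrite subr_ge0 exprn_ile1 ?nc_ge0.
  have h1 := le_trans h (ler_wpM2r d0 kn).
  have h2 := le_trans (ncB_ge (g 0) (g (w n))) h1.
  have h3 : nc (g (w n)) - nc (g 0) <= K * (1 - nc (g (w n)) ^+ 2).
    by apply: le_trans h1; rewrite -[leRHS]ncN opprB; exact: ncB_ge.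
  rewrite /t ler_pdivrMr//; move: h3 (g1 n) (nc_ge0 (g (w n))) K0.
  move: (nc (g 0)) (nc (g (w n))) (K) => a x k; rewrite expr2 => h3 x1 x0 k0'.
  have : 0 <= k * ((1 - x) * (1 - x)) by apply: mulr_ge0; [exact: ltW|apply: mulr_ge0; rewrite subr_ge0].
  by lra.
have t1 : 0 <= 1 - t by have := gt 0%N; have := nc_ge0 (g (w 0)); lra.
have wn n : nc (w n) <= (1 - t) ^+ n.
  elim: n => [|n IH]; first by rewrite expr0 ltW.
  rewrite wS ncM mulrC exprS; apply: ler_pM; rewrite ?nc_ge0//.
  by have := gt n; lra.
apply: (@squeeze0 R _ (fun n => 2 / (1 - r) * (1 - t) ^+ n)); last first.
  apply: cvg_scale0; apply: cvg_expr; rewrite ger0_norm//; lra.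
move=> n; rewrite nc_ge0 /=.
have e : nc (mob (z n) (z n.+1)) = nc (mob (w n) (w n.+1)).
  rewrite /w mob_mob// [RHS]ncM.
  have -> : 1 - q * (z n)^*%C = (1 - q^*%C * z n)^*%C by rewrite !cjE.
  have d := mob_den q1 (ltW (z1 n)).
  rewrite [X in _ = X * _](_ : _ = 1) ?mul1r//.
  by rewrite ncM ncV ncJ divff// nc_eq0.
rewrite -/(z n) -[phi _]/(z n.+1) e /mob ncM ncV.
have den : 1 - r <= nc (1 - (w n)^*%C * w n.+1).
  have h := ncB_ge 1 ((w n)^*%C * w n.+1); rewrite nc1 ncM ncJ in h.
  have : nc (w n) * nc (w n.+1) <= r * 1.
    by apply: ler_pM; rewrite ?nc_ge0 ?wr// ltW.
  by move: h; move: (nc (1 - _)) => x; lra.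
have num : nc (w n.+1 - w n) <= 2 * (1 - t) ^+ n.
  apply: le_trans (ncB _ _) _; have := wn n; have : nc (w n.+1) <= nc (w n).
    by rewrite wS ncM ler_piMr ?nc_ge0.
  by lra.
have r1' : 0 < 1 - r by rewrite subr_gt0.
rewrite mulrAC; apply: ler_pM; rewrite ?nc_ge0 ?invr_ge0 ?nc_ge0//.
by rewrite lef_pV2 ?posrE// (lt_le_trans r1').
Qed.

Let factorE : exists2 u : C, nc u = 1 & forall z, blaschke_factor (Some q) z = u * mob q z.
Proof.
have [->|q0] := eqVneq q 0.
  exists 1 => [|z]; first exact: nc1.
  have c0 : (0 : C)^*%C = 0 by exact: rmorph0.
  by rewrite /blaschke_factor eqxx /mob c0 mul0r !subr0 divr1 mul1r.
exists (- ((nc q)%:C%C / q)) => [|z]; last exact: bfE.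
by rewrite ncN ncM ncV nc_posreal ?nc_ge0// divff// nc_eq0.
Qed.

Let blaschke_single : blaschke_product (blaschke_factor (Some q)).
Proof.
exists 1, (fun n => if n is 0%N then Some q else None); split; first exact: normr1.
split; first by move=> [|n] x //= [<-]; exact/in_diskE.
split.
  apply: (cvgP (Re (1 - `|q|))); apply: cvg_near_cst; exists 1%N => // -[//|n] _ /=.
  by rewrite /series/= big_nat_recl// big1 ?addr0.
move=> z _; apply: cvg_near_cst; exists 1%N => // -[//|n] _ /=.
by rewrite big_ord_recl big1 ?mulr1 ?mul1r.
Qed.

Lemma elliptic_blaschke (z0 : C) (l : R) : nc z0 < 1 -> 0 < l ->
  (fun n => nc (mob (iter n phi z0) (iter n.+1 phi z0))) @ \oo --> l ->
  exists (F : C -> C) (tau : C), [/\ blaschke_product F,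
  exists z1 z2, [/\ nc z1 < 1, nc z2 < 1 & F z1 != F z2], nc tau = 1 &
  forall z, nc z < 1 -> F (phi z) = tau * F z].
Proof.
move=> z01 l0 el; have [g bg gE] := schwarz_quotient.
have zz : nc (0 : C) < 1 by rewrite nc0.
have g01 : nc (g 0) <= 1 by case: bg => _; apply.
have gu : nc (g 0) = 1.
  apply/eqP; rewrite eq_le g01/= leNgt; apply/negP => lt.
  have h := step_to0 bg gE lt z01.
  by have e := cvg_unique (@Rhausdorff R) el h; move: l0; rewrite e ltxx.
have gc := hol_unimodular_cst bg zz gu.
have [u u1 uE] := factorE.
exists (blaschke_factor (Some q)), (g 0); split => //.
- have h1 : nc (2^-1%:C%C : C) < 1 by rewrite nc_posreal ?invr_ge0//; lra.
  exists q, (mob (- q) 2^-1%:C%C); split=> //; first exact: nc_mob_lt1.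
  rewrite !uE moba mulr0 mobNK// eq_sym -nc_gt0 ncM u1 mul1r nc_posreal ?invr_ge0//.
- by move=> z z1; rewrite !uE gE// gc ?nc_mob_lt1//; ring.
Qed.

End Elliptic.
End Main.

Theorem theorem3p4 (R : realType) (phi : R[i] -> R[i]) :
  inner phi -> positive_hyperbolic_step phi ->
  exists (B : R[i] -> R[i]) (tau : R[i]),
    blaschke_product B /\
    (exists z1 z2, in_disk z1 /\ in_disk z2 /\ B z1 <> B z2) /\
    `|tau| = 1 /\
    forall z, in_disk z -> B (phi z) = tau * B z.
Proof.
move=> iphi [z0 [z01 [lc [lc0 elc]]]].
pose nc := @ComplexField.Normc.normc R.
have wphi := inner_weakly_inner iphi; have [sphi _] := wphi.
have {}z01 : nc z0 < 1 by exact/in_diskE.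
pose l := nc lc.
have l0 : 0 < l by rewrite nc_gt0 gt_eqF.
have el : (fun n => nc (mob (iter n phi z0) (iter n.+1 phi z0))) @ \oo --> l.
  have h := clim_nc ((clim_cvgP _ _).1 elc).
  rewrite (_ : (fun n => _) = (fun n => nc (rho (iter n phi z0) (iter n.+1 phi z0)))).
    exact: h.
  by apply/funext => n; rewrite rhoE /nc nc_posreal ?nc_ge0.
suff [F [tau [bF [z1 [z2 [h1 h2 h12]]] t1 FE]]] : exists (F : R[i] -> R[i]) (tau : R[i]),
    [/\ blaschke_product F,
    exists z1 z2, [/\ nc z1 < 1, nc z2 < 1 & F z1 != F z2], nc tau = 1 &
    forall z, nc z < 1 -> F (phi z) = tau * F z].
  exists F, tau; split=> //; split.
    by exists z1, z2; split; [exact/in_diskE|split; [exact/in_diskE|exact/eqP]].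
  split; first by rewrite normE -[ComplexField.Normc.normc _]/(nc tau) t1 rc1.
  by move=> z /in_diskE; exact: FE.
have [[q q1 fq]|nofix] := pselect (exists2 q, nc q < 1 & phi q = q).
  exact: (elliptic_blaschke sphi q1 fq z01 l0 el).
have [G [L [wG L1 l1 model ne]]] := linear_model wphi z01 l0 el.
have phi1 z : nc z < 1 -> nc (phi z) < 1 by case: sphi => _; apply.
have nf z : nc z < 1 -> phi z != z.
  by move=> z1; apply/eqP => e; apply: nofix; exists z.
have l01 : 0 < l < 1 by rewrite l0 l1.
have [F [tau [bF [z z1 Fz] t1 FE]]] := nonelliptic_blaschke phi1 wG L1 l01 model (ne nf).
exists F, tau; split=> //; exists z, 0; split=> //.
by rewrite /nc nc0.
Qed.
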